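(* Let $n\ge 2$, let $B_1\subset\mathbb{R}^n$ be the open unit ball, let $f\colon[0,+\infty)\to[0,\infty)$ be a $C^2$ function with $f'>0$ in $(0,+\infty)$, let $\lambda\ge 0$, and let $(\alpha_\lambda,\psi_\lambda)$ be a solution of the constrained problem on $\Omega=B_1$ described in the context, with associated weight $V_\lambda=f'(\alpha_\lambda+\lambda\psi_\lambda)$ and first eigenvalue $\sigma_1$. Let $\phi_1\in H^1_0(B_1)\setminus\{0\}$ be a radial first eigenfunction, i.e. a radial eigenfunction of $\sigma_1$. Then $\phi_1$ has at most two generalized nodal domains.
   Context: Constrained problem. A solution is a pair $(\alpha_\lambda,\psi_\lambda)$ with $\alpha_\lambda\in\mathbb{R}$, $\alpha_\lambda>0$, and $\psi_\lambda\in C^2(\overline{B_1})$ such that $-\Delta\psi_\lambda=f(\alpha_\lambda+\lambda\psi_\lambda)$ in $B_1$, $\int_{B_1}f(\alpha_\lambda+\lambda\psi_\lambda)\,dx=1$, $\psi_\lambda>0$ in $B_1$, and $\psi_\lambda=0$ on $\partial B_1$. On the ball, $\psi_\lambda$ is radial by the theorem of Gidas–Ni–Nirenberg, so $V_\lambda:=f'(\alpha_\lambda+\lambda\psi_\lambda)$ is a radial function, and $V_\lambda>0$ on $\overline{B_1}$. Notation. $\langle\phi\rangle_\lambda:=\frac{\int_{B_1}V_\lambda\phi\,dx}{\int_{B_1}V_\lambda\,dx}$ and $[\phi]_\lambda:=\phi-\langle\phi\rangle_\lambda$. Eigenvalues. The linearized operator is $L_\lambda(\phi)=-\Delta\phi-\lambda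 V_\lambda[\phi]_\lambda$. A number $\sigma\in\mathbb{R}$ is an eigenvalue with eigenfunction $\phi\in H^1_0(B_1)\setminus\{0\}$ if $\phi$ is a weak solution of $-\Delta\phi-\lambda V_\lambda[\phi]_\lambda=\sigma V_\lambda[\phi]_\lambda$ in $B_1$. The first eigenvalue is $$\sigma_1=\min_{\phi\in H^1_0(B_1)\setminus\{0\}}\frac{\int_{B_1}|\nabla\phi|^2-\lambda\int_{B_1}V_\lambda[\phi]_\lambda^2}{\int_{B_1}V_\lambda[\phi]_\lambda^2}.$$ A radial eigenfunction is written $\phi=\phi(r)$, $r=|x|\in[0,1]$. Singular points. Let $\phi$ be a radial eigenfunction with $\langle\phi\rangle_\lambda>0$. A singular point of $\phi$ is a point $r_0\in[0,1]$ with $\phi(r_0)=0$, $\phi'(r_0)=0$, $\phi''(r_0)>0$. Generalized nodal domains. Let $\phi$ be a radial eigenfunction with $\langle\phi\rangle_\lambda>0$. A generalized nodal domain of $\phi$ is a radial domain $\Omega_0\subseteq B_1$ (a ball centered at the origin or an open spherical shell centered at the origin) such that: (i) $\phi\equiv0$ on $\partial\Omega_0$, and $\partial_r\phi\ne0$ on each boundary sphere of $\Omega_0$ of radius $r\in[0,1)$; (ii) in $\Omega_0$ either $\phi\ge0$ or $\phi\le0$; (iii) if $\phi\le0$ in $\Omega_0$, then $\phi<0$ in $\Omega_0$; (iv) if $\phi\ge0$ in $\Omega_0$, then $\phi>0$ in $\Omega_0$ possibly with the exception of finitely many spheres $\{|x|=r_i\}$ such that each $r_i$ is a singular point of $\phi$.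 If $\Omega_0$ is a ball $B_r(0)$, the boundary condition is just $\phi(r)=0$. Convention: if $\langle\phi\rangle_\lambda<0$, the generalized nodal domains of $\phi$ are those of $-\phi$. (A radial eigenfunction on $B_1$ always has $\langle\phi\rangle_\lambda\ne0$.) *)

(* Defs.v *)
Set Warnings "-all".
From HB Require Import structures.
From mathcomp Require Import all_boot all_order all_algebra.
From mathcomp Require Import all_classical all_reals all_analysis.

Set Implicit Arguments.
Unset Strict Implicit.
Unset Printing Implicit Defensive.

Import Order.TTheory GRing.Theory Num.Theory.
Import numFieldNormedType.Exports.

Local Open Scope classical_set_scope.
Local Open Scope ring_scope.

Definition rV_display : measure_display.
Proof. exact. Qed.

(* 'rV[R]_n carries the product sigma-algebra, i.e. the Borel one. *)
Section rV_measurable.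
Context {R : realType} {n : nat}.

Let coord (i : 'I_n) (x : 'rV[R]_n) : measurableTypeR R := x 0 i.

Let rV_measurable0 : g_sigma_preimage coord set0.
Proof. exact: sigma_algebra0. Qed.

Let rV_measurableC A :
  g_sigma_preimage coord A -> g_sigma_preimage coord (~` A).
Proof. exact: sigma_algebraC. Qed.

Let rV_measurable_bigcup (F : (set 'rV[R]_n)^nat) :
  (forall i, g_sigma_preimage coord (F i)) ->
  g_sigma_preimage coord (\bigcup_i (F i)).
Proof. exact: sigma_algebra_bigcup. Qed.

HB.instance Definition _ := @isMeasurable.Build rV_display
  'rV[R]_n (g_sigma_preimage coord)
  rV_measurable0 rV_measurableC rV_measurable_bigcup.

Lemma measurable_coord (i : 'I_n) :
  measurable_fun [set: 'rV[R]_n] (fun x => x 0 i : measurableTypeR R).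
Proof.
move=> _ Y mY; rewrite setTI; apply: sub_sigma_algebra => /=.
rewrite -bigcup_seq/=; exists i => /=; first by rewrite mem_index_enum.
by exists Y => //; rewrite setTI.
Qed.

Lemma measurable_rVP d (T : measurableType d) (f : T -> 'rV[R]_n) :
  (forall i, measurable_fun setT (fun t => f t 0 i : measurableTypeR R)) ->
  measurable_fun setT f.
Proof.
move=> mf _ A mA; rewrite setTI.
have : preimage_set_system setT f (g_sigma_preimage coord) (f @^-1` A).
  by exists A => //; rewrite setTI.
rewrite -g_sigma_preimage_comp; apply: smallest_sub => //.
  exact: sigma_algebra_measurable.
rewrite -bigcup_seq/= => B /= [i _ [Y mY <-]].
exact: mf.
Qed.

End rV_measurable.

(* Lebesgue measure on R^n, by recursion on n: the image of the product of the
   Lebesgue measures on R and R^n under (t, x) |-> row_mx t x. *)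
Section rV_cons.
Context {R : realType} {n : nat}.

Definition rV_cons (p : measurableTypeR R * 'rV[R]_n) : 'rV[R]_n.+1 :=
  row_mx (p.1%:M : 'rV_1) p.2.

Definition rV_uncons (x : 'rV[R]_n.+1) : measurableTypeR R * 'rV[R]_n :=
  (x 0 0, \row_j x 0 (lift ord0 j)).

Lemma rV_consK : cancel rV_cons rV_uncons.
Proof.
move=> [t x]; rewrite /rV_uncons /rV_cons/=; congr (_, _).
  by rewrite mxE; case: splitP => //= j; rewrite ord1 mxE eqxx mulr1n.
apply/rowP => j; rewrite !mxE; case: splitP => //= k.
  by rewrite ord1.
by rewrite /bump/= => /addnI /val_inj ->.
Qed.

Lemma rV_cons0 t x : rV_cons (t, x) 0 ord0 = t.
Proof. by have [] := rV_consK (t, x). Qed.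

Lemma rV_consS t x (j : 'I_n) : rV_cons (t, x) 0 (lift ord0 j) = x 0 j.
Proof. by have [_ /rowP/(_ j)] := rV_consK (t, x); rewrite mxE. Qed.

Lemma measurable_rV_cons : measurable_fun setT rV_cons.
Proof.
apply: measurable_rVP => i; rewrite /rV_cons.
under eq_fun do rewrite mxE.
case: splitP => j _.
  under eq_fun do rewrite ord1 mxE eqxx mulr1n.
  exact: measurable_fst.
apply: (measurableT_comp (measurable_coord j)).
exact: measurable_snd.
Qed.

Lemma measurable_rV_uncons : measurable_fun setT rV_uncons.
Proof.
apply/measurable_fun_pairP; split.
  exact: measurable_coord.
apply: measurable_rVP => i /=; rewrite /rV_uncons/= /comp/=.
under eq_fun do rewrite mxE.
exact: measurable_coord.
Qed.

Variable mu : {sigma_finite_measure set 'rV[R]_n -> \bar R}.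

Definition rV_cons_measure : set 'rV[R]_n.+1 -> \bar R :=
  pushforward (@lebesgue_measure R \x mu)%E rV_cons.

Let rV_cons_measure0 : rV_cons_measure set0 = 0%E.
Proof. by rewrite /rV_cons_measure /pushforward preimage_set0 measure0. Qed.

Let rV_cons_measure_ge0 A : (0 <= rV_cons_measure A)%E.
Proof. by rewrite /rV_cons_measure /pushforward measure_ge0. Qed.

Let rV_cons_measure_sigma_additive : semi_sigma_additive rV_cons_measure.
Proof.
move=> F mF tF mUF; rewrite /rV_cons_measure /pushforward preimage_bigcup.
have mp A : measurable A -> measurable (rV_cons @^-1` A).
  by move=> mA; rewrite -[X in measurable X]setTI; exact: measurable_rV_cons.
apply: measure_semi_sigma_additive => [k||].
- exact: mp.
- apply/trivIsetP => /= i j _ _ ij; rewrite -preimage_setI.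
  by move/trivIsetP : tF => /(_ _ _ _ _ ij) ->//; rewrite preimage_set0.
- by rewrite -preimage_bigcup; exact: mp.
Qed.

HB.instance Definition _ := isMeasure.Build _ _ _ rV_cons_measure
  rV_cons_measure0 rV_cons_measure_ge0 rV_cons_measure_sigma_additive.

Let rV_cons_measure_sigma_finite : sigma_finite setT rV_cons_measure.
Proof.
have /sigma_finiteP[F [FT ndF Foo]] := sigma_finiteT (@lebesgue_measure R).
have /sigma_finiteP[G [GT ndG Goo]] := sigma_finiteT mu.
exists (fun k => rV_uncons @^-1` (F k `*` G k)).
  apply/seteqP; split => // x _.
  have [i _ Fi] : (\bigcup_i F i) (rV_uncons x).1 by rewrite -FT.
  have [j _ Gj] : (\bigcup_j G j) (rV_uncons x).2 by rewrite -GT.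
  exists (maxn i j) => //; split.
  - by move: Fi; exact/subsetPset/ndF/leq_maxl.
  - by move: Gj; exact/subsetPset/ndG/leq_maxr.
move=> k; have [mF Fk] := Foo k; have [mG Gk] := Goo k; split.
  rewrite -[X in measurable X]setTI; apply: measurable_rV_uncons => //.
  exact: measurableX.
rewrite /rV_cons_measure /pushforward -comp_preimage.
rewrite (_ : rV_uncons \o rV_cons = id); last first.
  by apply/funext => x /=; rewrite rV_consK.
by rewrite preimage_id product_measure1E// lte_mul_pinfty// ge0_fin_numE.
Qed.

HB.instance Definition _ := Measure_isSigmaFinite.Build _ _ _
  rV_cons_measure rV_cons_measure_sigma_finite.

End rV_cons.

Fixpoint lebesgue_rV (R : realType) (n : nat) :
    {sigma_finite_measure set 'rV[R]_n -> \bar R} :=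
  match n with
  | 0 => [the {sigma_finite_measure set 'rV[R]_0 -> \bar R} of \d_ (0 : 'rV[R]_0)]
  | n'.+1 => [the {sigma_finite_measure set 'rV[R]_n'.+1 -> \bar R} of
      rV_cons_measure (lebesgue_rV R n')]
  end.

Lemma lebesgue_rV_box (R : realType) (n : nat)
    (A : 'I_n -> set (measurableTypeR R)) :
  (forall i, measurable (A i)) ->
  lebesgue_rV R n [set x | forall i, A i (x 0 i)] =
  (\prod_(i < n) lebesgue_measure (A i))%E.
Proof.
elim: n A => [|n IH] A mA.
  rewrite big_ord0 /= diracE mem_set//= => -[].
  by [].
have mbox : measurable [set x : 'rV[R]_n | forall j, A (lift ord0 j) (x 0 j)].
  rewrite (_ : [set x | _] =
      \big[setI/setT]_(j < n) ((fun x : 'rV[R]_n => x 0 j) @^-1` A (lift ord0 j))).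
    apply: bigsetI_measurable => j _.
    by rewrite -[X in measurable X]setTI; exact: measurable_coord.
  rewrite -bigcap_seq; apply/seteqP; split => x /= Ax j.
    by move=> _; exact: Ax.
  exact: Ax j (mem_index_enum j).
rewrite big_ord_recl -IH// -product_measure1E//=.
rewrite /rV_cons_measure /pushforward; congr (product_measure1 _ _ _).
apply/seteqP; split => -[t x] /=.
  move=> Ax; split => [|j] /=; first by rewrite -(rV_cons0 t x); exact: Ax.
  by rewrite -(rV_consS t); exact: Ax.
by move=> [/= At Ax] i; have [j ->|->] := unliftP ord0 i;
  rewrite ?rV_consS ?rV_cons0//; exact: Ax.
Qed.

Section euclidean.
Context {R : realType} {n : nat}.
Implicit Types (x y : 'rV[R]_n) (D : set 'rV[R]_n).

Definition dotr x y : R := \sum_i x 0 i * y 0 i.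

(* The norm `|x| of the library on 'rV[R]_n is the sup norm. *)
Definition enorm x : R := Num.sqrt (dotr x x).

Definition eball (r : R) : set 'rV[R]_n := [set x | enorm x < r].

Definition eshell (a b : R) : set 'rV[R]_n := [set x | a < enorm x < b].

Definition partial (i : 'I_n) (g : 'rV[R]_n -> R) x : R :=
  'D_(delta_mx 0 i) g x.

Definition gradient (g : 'rV[R]_n -> R) x : 'rV[R]_n :=
  \row_i partial i g x.

Definition laplacian (g : 'rV[R]_n -> R) x : R :=
  \sum_i partial i (partial i g) x.

End euclidean.

Definition extends_continuously (R : realType) (T : topologicalType)
    (D : set T) (g : T -> R) : Prop :=
  exists2 h : T -> R, {within closure D, continuous h} &
    forall x, D x -> h x = g x.

(* g belongs to C^2(closure D), for D open. *)
Definition C2_closure (R : realType) (n : nat) (D : set 'rV[R]_n)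
    (g : 'rV[R]_n -> R) : Prop :=
  [/\ {within closure D, continuous g},
      forall x, D x -> differentiable g x,
      forall i x, D x -> differentiable (partial i g) x,
      forall i, extends_continuously D (partial i g) &
      forall i j, extends_continuously D (partial j (partial i g))].

(* f belongs to C^2([0, +oo)); values of f on the negative half-line are
   irrelevant. *)
Definition C2_halfline (R : realType) (f : R -> R) : Prop :=
  [/\ {within `[0, +oo[, continuous f},
      forall t, 0 < t -> derivable f t 1,
      forall t, 0 < t -> derivable (derive1 f) t 1,
      extends_continuously (`]0, +oo[ : set R) (derive1 f) &
      extends_continuously (`]0, +oo[ : set R) (derive1 (derive1 f))].

Section sobolev.
Context {R : realType} {n : nat}.
Local Notation mu := (lebesgue_rV R n).
Implicit Types (D : set 'rV[R]_n) (g : 'rV[R]_n -> R)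
  (G : 'rV[R]_n -> 'rV[R]_n).

Definition C1c D g : Prop :=
  [/\ forall x, differentiable g x,
      forall i, continuous (partial i g) &
      exists K, [/\ compact K, K `<=` D & forall x, ~ K x -> g x = 0]].

Definition L2 D g : Prop :=
  measurable_fun D g /\ mu.-integrable D (fun x => (g x ^+ 2)%:E).

Definition weak_gradient D g G : Prop :=
  forall eta, C1c D eta -> forall i,
    \int[mu]_(x in D) (g x * partial i eta x) =
    - \int[mu]_(x in D) (G x 0 i * eta x).

(* g belongs to H^1(D), with weak gradient G. *)
Definition H1 D g G : Prop :=
  [/\ L2 D g, forall i, L2 D (fun x => G x 0 i) & weak_gradient D g G].

(* g belongs to H^1_0(D), the closure of C^1_c(D) in H^1(D), with weak
   gradient G. *)
Definition H10 D g G : Prop :=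
  H1 D g G /\
  exists eta : nat -> 'rV[R]_n -> R,
    [/\ forall k, C1c D (eta k),
        (\int[mu]_(x in D) ((eta k x - g x) ^+ 2)%:E)%E
          @[k --> \oo] --> 0%E &
        (\int[mu]_(x in D) (enorm (gradient (eta k) x - G x) ^+ 2)%:E)%E
          @[k --> \oo] --> 0%E].

Definition nonzero D g : Prop := ~ {ae mu, forall x, D x -> g x = 0}.

End sobolev.

Section linearized_problem.
Context {R : realType} {n : nat}.
Local Notation mu := (lebesgue_rV R n).
Local Notation B := (@eball R n 1).

Definition constrained_solution (f : R -> R) (lam alpha : R)
    (psi : 'rV[R]_n -> R) : Prop :=
  [/\ 0 < alpha,
      C2_closure B psi,
      forall x, B x -> - laplacian psi x = f (alpha + lam * psi x),
      \int[mu]_(x in B) f (alpha + lam * psi x) = 1 &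
      (forall x, B x -> 0 < psi x) /\ (forall x, enorm x = 1 -> psi x = 0)].

Definition weight (f : R -> R) (lam alpha : R) (psi : 'rV[R]_n -> R)
    (x : 'rV[R]_n) : R :=
  derive1 f (alpha + lam * psi x).

Variable V : 'rV[R]_n -> R.

Definition wmean (phi : 'rV[R]_n -> R) : R :=
  (\int[mu]_(x in B) (V x * phi x)) / (\int[mu]_(x in B) V x).

Definition wcenter (phi : 'rV[R]_n -> R) (x : 'rV[R]_n) : R :=
  phi x - wmean phi.

Definition eigenfunction (lam sigma : R) (phi : 'rV[R]_n -> R) : Prop :=
  nonzero B phi /\
  exists2 G, H10 B phi G &
    forall eta Geta, H10 B eta Geta ->
      \int[mu]_(x in B) dotr (G x) (Geta x)
        - lam * \int[mu]_(x in B) (V x * wcenter phi x * eta x) =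
      sigma * \int[mu]_(x in B) (V x * wcenter phi x * eta x).

Definition rayleigh (lam : R) (phi : 'rV[R]_n -> R)
    (G : 'rV[R]_n -> 'rV[R]_n) : R :=
  (\int[mu]_(x in B) enorm (G x) ^+ 2
     - lam * \int[mu]_(x in B) (V x * wcenter phi x ^+ 2))
  / \int[mu]_(x in B) (V x * wcenter phi x ^+ 2).

Definition first_eigenvalue (lam sigma1 : R) : Prop :=
  (exists phi G, [/\ H10 B phi G, nonzero B phi & sigma1 = rayleigh lam phi G])
  /\ forall phi G, H10 B phi G -> nonzero B phi -> sigma1 <= rayleigh lam phi G.

(* phi is radial with profile u: the continuous representative of phi is
   x |-> u |x|. *)
Definition radial_profile (phi : 'rV[R]_n -> R) (u : R -> R) : Prop :=
  {within `[0, 1], continuous u} /\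
  {ae mu, forall x, B x -> phi x = u (enorm x)}.

End linearized_problem.

Section nodal_domains.
Context {R : realType} {n : nat}.
Implicit Types (u : R -> R) (Omega : set 'rV[R]_n).

(* Derivative on [0, 1], one-sided at 0 and 1. *)
Definition deriv01 u (r : R) : R :=
  lim ((u t - u r) / (t - r) @[t --> within `[0, 1] r^']).

Definition singular_point u (r0 : R) : Prop :=
  [/\ 0 <= r0 <= 1, u r0 = 0, deriv01 u r0 = 0 & 0 < deriv01 (deriv01 u) r0].

(* For a ball, the boundary condition is only u r = 0: no condition is imposed
   on the derivative at r. *)
Definition radial_domain_with_bc u Omega : Prop :=
  (exists r, [/\ 0 < r <= 1, Omega = eball r & u r = 0]) \/
  (exists a b, [/\ 0 <= a, a < b, b <= 1 & Omega = eshell a b] /\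
     [/\ u a = 0, u b = 0, deriv01 u a <> 0 & b < 1 -> deriv01 u b <> 0]).

Definition nodal_domain_of u Omega : Prop :=
  let ge0 := forall x, Omega x -> 0 <= u (enorm x) in
  let le0 := forall x, Omega x -> u (enorm x) <= 0 in
  [/\ radial_domain_with_bc u Omega,
      ge0 \/ le0,
      le0 -> forall x, Omega x -> u (enorm x) < 0 &
      ge0 -> exists s : seq R, (forall r, r \in s -> singular_point u r) /\
        forall x, Omega x -> enorm x \notin s -> 0 < u (enorm x)].

(* The case of mean zero is left out: it does not occur for eigenfunctions. *)
Definition generalized_nodal_domains (V : 'rV[R]_n -> R) u :
    set (set 'rV[R]_n) :=
  let m := wmean V (fun x => u (enorm x)) in
  [set Omega | (0 < m /\ nodal_domain_of u Omega) \/
               (m < 0 /\ nodal_domain_of (fun r => - u r) Omega)].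

End nodal_domains.

(* Main.v *)
Require Import Defs.
Set Warnings "-all".
From HB Require Import structures.
From mathcomp Require Import all_boot all_order all_algebra.
From mathcomp Require Import all_classical all_reals all_analysis.
From mathcomp Require Import measurable_realfun ring lra.

Set Implicit Arguments.
Unset Strict Implicit.
Unset Printing Implicit Defensive.

Import Order.TTheory GRing.Theory Num.Theory.
Import numFieldNormedType.Exports.

Local Open Scope classical_set_scope.
Local Open Scope ring_scope.

(* On the ball, a radial eigenfunction u (normalised so that its weighted mean m is
   positive) satisfies c r^(n-1) u'(r) = - la Phi(r), where la = lam + sigma1, c is
   the area of the unit sphere and Phi(r) is the integral of V (u - m) over B_r;
   moreover u(1) = 0 and Phi(1) = 0. Since sigma1 is the least eigenvalue,
   la int V eta^2 <= int |grad eta|^2 for all eta with int V eta = 0.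

   If u were positive at r1 < r0 < r2 except for u(r0) <= 0, then truncations
   g_i of max(u - e, 0), supported on either side of r0, combined into
   eta = c1 g1 - c2 g2 with int V eta = 0, would satisfy
     la int V eta^2 <= int |grad eta|^2 <= la sum_i c_i^2 int V (u - m) g_i,
   impossible because (u - m) g_i < g_i^2 where g_i > 0 once 2 e < m. Hence
   there is a such that u <= 0 on [0, a[ and u > 0 on ]a, 1[ (near 1 the flux Phi
   is positive, so u > 0). On [0, a[ the flux is negative, so u is strictly
   increasing and thus negative there. The zeros of u leave room for at
   most two generalized nodal domains. *)

(** * Lebesgue measure on R^n *)

(** The obstacles are of regularity. The eigenfunction is only in H^1_0 with a continuous profile,
    so the radial equation and u(1) = 0 must be extracted from the weak form. In place of polar
    coordinates, integrals over B_r are differentiated in r: for h bounded and k of class C^1,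
    int_{B_r} h k(|x|) - k(r) int_{B_r} h has derivative -k'(r) int_{B_r} h, although neither term
    need be differentiable. Several integral relations on B_1 are then proved by following a
    function T(s) of the radius from s = 0 to s = 1.

    Test functions must have V-mean zero because only then does eta - <eta> reduce to eta and the
    nonlocal Rayleigh quotient become a local one; this is why two bumps are combined. They must
    also be C^1 with compact support: a C^1 truncation of u at height e vanishes near r0, where u <=
    0, and near the boundary, where u is small. The truncation loses at most 2 e, and the mean m > 0
    pays for it. The equation is odd in (u, m), which reduces m < 0 to m > 0. *)

Lemma scaled_pushforward_measure d d' (T : measurableType d) (U : measurableType d')
    (R : realType) (mu : {measure set T -> \bar R}) (phi : T -> U) (c : R) :
  0 <= c -> measurable_fun setT phi ->
  exists m : {measure set U -> \bar R},
    forall A, m A = (c%:E * mu (phi @^-1` A))%E.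
Proof.
move=> c0 mphi; pose phi' : {mfun _ >-> _} := HB.pack phi (isMeasurableFun.Build _ _ _ _ _ mphi).
by unshelve eexists (mscale (NngNum c0) (pushforward mu phi')).
Qed.

Lemma lebesgue_measure_affine (R : realType) (a b : R) (A : set R) :
  0 < a -> measurable A ->
  lebesgue_measure ((fun t => a * t + b) @^-1` A) =
  (a^-1%:E * lebesgue_measure A)%E.
Proof.
move=> a0 mA.
pose phi0 (t : measurableTypeR R) : measurableTypeR R := a * t + b.
have mphi : measurable_fun setT phi0.
  by apply: measurable_funD => //; exact: measurable_funM.
have [m' m'E] := scaled_pushforward_measure (@lebesgue_measure R) (ltW a0) mphi.
(* Uniqueness of Lebesgue measure: [a] times the image measure under [t |-> a * t + b] gives each
   []x, y]] its length. *)
rewrite (@lebesgue_measure_unique R m' _ A mA).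
  by rewrite m'E muleA -EFinM mulVf ?gt_eqF// mul1e.
move=> _ [[x y] _ <-] /=; rewrite m'E.
have E : lebesgue_measure (phi0 @^-1` `]x, y]) = (if x < y then (y - x) / a else 0)%:E.
  have H := @lebesgue_measure_itv R `](x - b) / a, (y - b) / a].
  move: H; rewrite /= lte_fin ltr_pM2r ?invr_gt0// ltrD2r => H.
  transitivity (lebesgue_measure (`](x - b) / a, (y - b) / a]%classic : set R)).
    congr (_ _); apply/seteqP; split => t /=; rewrite /phi0 !in_itv/= ltr_pdivrMr// ler_pdivlMr//.
      by move=> /andP[? ?]; apply/andP; split; lra.
    by move=> /andP[? ?]; apply/andP; split; lra.
  rewrite H; case: ifPn => // _; rewrite -EFinD; congr EFin.
  by field; rewrite gt_eqF.
transitivity (a%:E * (if x < y then (y - x) / a else 0)%R%:E)%E; last by congr (_ * _)%E; exact/esym/E.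
rewrite (lebesgue_measure_itv `]x, y]) /= lte_fin.
case: ifPn => xy; last by rewrite mule0.
by rewrite -EFinD -EFinM; congr EFin; field; rewrite gt_eqF.
Qed.

Definition affine {R : realType} {n : nat} (a : R) (b x : 'rV[R]_n) : 'rV[R]_n :=
  a *: x + b.

Lemma measurable_affine (R : realType) n (a : R) (b : 'rV[R]_n) :
  measurable_fun setT (affine a b).
Proof.
apply: measurable_rVP => i.
under eq_fun do rewrite !mxE.
by apply: measurable_funD => //; apply: measurable_funM => //; exact: measurable_coord.
Qed.

Lemma measurable_affine_preimage (R : realType) n (a : R) (b : 'rV[R]_n) A :
  measurable A -> measurable (affine a b @^-1` A).
Proof.
by move=> mA; rewrite -[X in measurable X]setTI; exact: measurable_affine.
Qed.

(** Induction on the dimension: through [rV_cons] the map splits into an affine map of the first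
    coordinate and one of the others, and a product measure is determined by its values on
    rectangles. Dilations give the volume of balls, translations ([a = 1]) the invariance behind
    integration by parts. *)
Lemma lebesgue_rV_affine (R : realType) n (a : R) (b : 'rV[R]_n) (A : set 'rV[R]_n) :
  0 < a -> measurable A ->
  lebesgue_rV R n (affine a b @^-1` A) = ((a^-1 ^+ n)%:E * lebesgue_rV R n A)%E.
Proof.
move=> a0; elim: n b A => [|n IH] b A mA.
  rewrite expr0 mul1e/=; congr (_ _ _); apply/seteqP; split => x /=;
  by rewrite (_ : affine a b x = x)//; apply/rowP => -[].
pose S (p : measurableTypeR R * 'rV[R]_n) : measurableTypeR R * 'rV[R]_n :=
  (a * p.1 + (rV_uncons b).1, affine a (rV_uncons b).2 p.2).
have mS : measurable_fun setT S.
  apply/measurable_fun_pairP; split.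
    by apply: measurable_funD => //; exact: measurable_funM.
  by apply: (measurableT_comp (measurable_affine _ _)) => //; exact: measurable_snd.
have maff : measurable_fun setT (fun t : measurableTypeR R => a * t + (rV_uncons b).1 : measurableTypeR R).
  by apply: measurable_funD => //; exact: measurable_funM.
have SK p : affine a b (rV_cons p) = rV_cons (S p).
  case: p => t x; apply/rowP => i; have [j ->|->] := unliftP ord0 i.
    by rewrite /affine [LHS]mxE [X in X + _]mxE !rV_consS !mxE.
  by rewrite /affine [LHS]mxE [X in X + _]mxE !rV_cons0.
have an0 : 0 <= a ^+ n.+1 by rewrite exprn_ge0// ltW.
have [m' m'E] := scaled_pushforward_measure (@lebesgue_measure R \x lebesgue_rV R n)%E an0 mS.
have mX : measurable (rV_cons @^-1` A).
  by rewrite -[X in measurable X]setTI; exact: measurable_rV_cons.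
have H := @product_measure_unique _ _ _ _ R (@lebesgue_measure R) (lebesgue_rV R n) m' _ _ mX.
rewrite /= /rV_cons_measure /pushforward H; last first.
  move=> X Y mX' mY; rewrite m'E.
  rewrite (_ : S @^-1` _ = ((fun t => a * t + (rV_uncons b).1) @^-1` X) `*`
     (affine a (rV_uncons b).2 @^-1` Y)); last by apply/seteqP; split.
  pose X' : set (measurableTypeR R) := (fun t => a * t + (rV_uncons b).1) @^-1` X.
  have mX1 : measurable X' by rewrite -[X in measurable X]setTI; apply: maff.
  have E := product_measure1E (@lebesgue_measure R) (lebesgue_rV R n) mX1
    (measurable_affine_preimage a (rV_uncons b).2 mY).
  transitivity ((a ^+ n.+1)%:E * ((a^-1)%:E * lebesgue_measure X * ((a^-1 ^+ n)%:E * lebesgue_rV R n Y)))%E.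
    congr (_ * _)%E; rewrite -(IH (rV_uncons b).2)// -(lebesgue_measure_affine (rV_uncons b).1)//; exact: E.
  suff F (x y : \bar R) :
      ((a ^+ n.+1)%:E * ((a^-1)%:E * x * ((a^-1 ^+ n)%:E * y)) = x * y)%E by exact: F.
  rewrite muleACA -EFinM (muleA (a ^+ n.+1)%:E) -EFinM.
  rewrite [X in X%:E](_ : _ = 1) ?mul1e// exprVn exprS; field.
  by rewrite expf_neq0 ?gt_eqF.
rewrite m'E muleA -EFinM exprVn mulVf ?expf_neq0 ?gt_eqF//.
rewrite mul1e; congr (product_measure1 _ _ _).
by apply/seteqP; split => p /=; rewrite SK.
Qed.

Lemma coord_le_norm (R : realType) n (x : 'rV[R]_n) i : `|x 0 i| <= `|x|.
Proof.
rewrite [leRHS]/Num.norm /= mx_normrE; apply/bigmax_geP; right => /=.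
by exists (0, i).
Qed.

Lemma measurable_box (R : realType) n (A : 'I_n -> set (measurableTypeR R)) :
  (forall i, measurable (A i)) -> measurable [set x : 'rV[R]_n | forall i, A i (x 0 i)].
Proof.
move=> mA.
rewrite (_ : mkset _ = \big[setI/setT]_(j < n) ((fun x : 'rV[R]_n => x 0 j) @^-1` A j)).
  apply: bigsetI_measurable => j _.
  by rewrite -[X in measurable X]setTI; exact: (measurable_coord j).
rewrite -bigcap_seq; apply/seteqP; split => x /= Ax j.
  by move=> _; exact: Ax.
exact: Ax j (mem_index_enum j).
Qed.

Lemma continuous_sum (R : realType) (T : topologicalType) (I : finType) (F : I -> T -> R) :
  (forall i, continuous (F i)) -> continuous (fun x => \sum_i F i x).
Proof.
move=> cF x; elim: (index_enum I) => [|i s IH].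
  by under eq_fun do rewrite big_nil; exact: cvg_cst.
under eq_fun do rewrite big_cons.
by apply: cvgD => //; exact: cF.
Qed.

(** The sigma-algebra is generated by the coordinates; an open set belongs to it as a countable
    union of cubes with rational centres. *)
Lemma open_measurable_rV (R : realType) n (U : set 'rV[R]_n) :
  open U -> measurable U.
Proof.
move=> oU.
pose C (p : 'rV[rat]_n * nat) : set 'rV[R]_n :=
  [set x | forall i, `|ratr (p.1 0 i) - x 0 i| < p.2.+1%:R^-1].
pose D p := if pselect (C p `<=` U) then C p else set0.
have mC p : measurable (C p).
  apply: (@measurable_box _ _ (fun j => ball (ratr (p.1 0 j) : R) p.2.+1%:R^-1)) => i.
  exact: measurable_ball.
rewrite (_ : U = \bigcup_p D p).
  apply: countable_bigcupT_measurable; first exact: countableP.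
  by move=> p; rewrite /D; case: pselect => [?|?]; [exact: mC|exact: measurable0].
apply/seteqP; split => [x Ux|x [p _]]; last by rewrite /D; case: pselect => // + /= => /[apply].
have /nbhs_ballP[e /= e0 xe] : nbhs x U by exact: open_nbhs_nbhs.
(* Both [x] and any other point of the cube are within [1/(k+1)] of its centre, coordinate by
   coordinate; hence the factor 2. *)
have [k ke] : exists k, 2 * k.+1%:R^-1 < e.
  exists (Num.truncn (2 / e)); rewrite -ltr_pdivlMl// mulrC -[ltRHS]invrK.
  rewrite ltf_pV2 ?posrE ?invr_gt0 ?divr_gt0//.
    by rewrite invfM invrK mulrC truncnS_gt.
  by rewrite mulr_gt0// invr_gt0.
have H i : exists q : rat, `|ratr q - x 0 i| < k.+1%:R^-1.
  have [|q] := @rat_in_itvoo R (x 0 i - k.+1%:R^-1) (x 0 i + k.+1%:R^-1).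
    by rewrite ltrBlDr -addrA ltrDl addr_gt0.
  rewrite in_itv/= => /andP[q1 q2]; exists q.
  by rewrite ltr_norml ltrBrDr ltrBlDr addrC q1 addrC q2.
have [q Hq] := choice H.
exists (\row_i q i, k) => //; rewrite /D; case: pselect => [_ i|]; first by rewrite mxE.
case=> y Cy; apply: xe; split => // i j; rewrite ord1 /ball/=.
apply: le_lt_trans ke; have := Cy j; rewrite !mxE/= => Cyj.
rewrite (_ : x 0 j - y 0 j = (x 0 j - ratr (q j)) + (ratr (q j) - y 0 j)); last by ring.
by rewrite (le_trans (ler_normD _ _))// mulr_natl mulr2n lerD ?ltW// distrC.
Qed.

Lemma continuous_on_measurable (R : realType) n (U : set 'rV[R]_n) (g : 'rV[R]_n -> R) :
  open U -> {in U, continuous g} -> measurable_fun U g.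
Proof.
move=> oU cg; apply: (measurability _ (RGenOpens.measurableE R)).
move=> _ [_ [a [b ->] <-]]; apply: open_measurable_rV.
rewrite openE => x [Ux gx]; apply: filterI; first exact: open_nbhs_nbhs.
apply: (cg x); first exact/mem_set.
by apply: open_nbhs_nbhs; split => //; exact: interval_open.
Qed.

(** * Euclidean norm and volume of balls *)

Section euclidean_norm.
Context {R : realType} {n : nat}.
Implicit Types (x y : 'rV[R]_n) (a r : R).

Lemma dotr_ge0 x : 0 <= dotr x x.
Proof. by apply: sumr_ge0 => i _; rewrite -expr2 sqr_ge0. Qed.

Lemma enorm_ge0 x : 0 <= enorm x. Proof. exact: sqrtr_ge0. Qed.

Lemma enorm_sqr x : enorm x ^+ 2 = dotr x x.
Proof. by rewrite sqr_sqrtr// dotr_ge0. Qed.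

Lemma coord_le_enorm x i : `|x 0 i| <= enorm x.
Proof.
rewrite -(@ler_pXn2r _ 2) ?nnegrE ?enorm_ge0// enorm_sqr real_normK ?num_real//.
rewrite /dotr (bigD1 i)//= -expr2 lerDl; apply: sumr_ge0 => j _.
by rewrite -expr2 sqr_ge0.
Qed.

Lemma dotr_le_norm x : dotr x x <= n%:R * `|x| ^+ 2.
Proof.
rewrite /dotr (@le_trans _ _ (\sum_(i < n) `|x| ^+ 2))//.
  apply: ler_sum => i _; rewrite -expr2 -real_normK ?num_real//.
  by rewrite ler_pXn2r ?nnegrE//; exact: coord_le_norm.
by rewrite sumr_const card_ord mulr_natl.
Qed.

Lemma enormZ a x : enorm (a *: x) = `|a| * enorm x.
Proof.
rewrite /enorm (_ : dotr (a *: x) _ = a ^+ 2 * dotr x x).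
  by rewrite sqrtrM ?sqr_ge0// sqrtr_sqr.
by rewrite /dotr mulr_sumr; apply: eq_bigr => i _; rewrite !mxE; ring.
Qed.

Lemma enorm0 : enorm (0 : 'rV[R]_n) = 0.
Proof. by rewrite -(scale0r 0) enormZ normr0 mul0r. Qed.

Lemma enorm_eq0 x : enorm x = 0 -> x = 0.
Proof.
move=> x0; apply/rowP => i; rewrite mxE; apply/eqP; rewrite -normr_eq0.
by rewrite eq_le normr_ge0 andbT -x0 coord_le_enorm.
Qed.

Lemma continuous_dotr : continuous (fun x => dotr x x).
Proof.
apply: continuous_sum => i x.
have c := @coord_continuous R 1 n 0 i x.
exact: (cvgM c c).
Qed.

Lemma continuous_enorm : continuous (@enorm R n).
Proof.
move=> x; apply: (@continuous_comp _ _ _ (fun x => dotr x x) (fun t : R => Num.sqrt t)).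
  exact: continuous_dotr.
exact: sqrt_continuous.
Qed.

Lemma open_eball r : open (eball r : set 'rV[R]_n).
Proof.
rewrite (_ : eball r = enorm @^-1` [set t | t < r])//.
by apply: open_comp => [x _|]; [exact: continuous_enorm|exact: open_lt].
Qed.

Lemma measurable_eball r : measurable (eball r : set 'rV[R]_n).
Proof. by apply: open_measurable_rV; exact: open_eball. Qed.

Lemma eball_sub r r' : r <= r' -> eball r `<=` (eball r' : set 'rV[R]_n).
Proof. by move=> rr' x; rewrite /eball/= => /lt_le_trans; exact. Qed.

Lemma eball_le0 r : r <= 0 -> eball r = set0 :> set 'rV[R]_n.
Proof.
move=> r0; apply/seteqP; split => // x; rewrite /eball/= => xr.
by have := enorm_ge0 x; rewrite leNgt (lt_le_trans xr).
Qed.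

Lemma eball_dilation r a : 0 < a ->
  affine a 0 @^-1` eball r = eball (r / a) :> set 'rV[R]_n.
Proof.
move=> a0; apply/seteqP; split => x; rewrite /eball/= /affine addr0 enormZ gtr0_norm//;
by rewrite ltr_pdivlMr// mulrC.
Qed.

Definition box r : set 'rV[R]_n := [set x | forall i, `[- r, r]%classic (x 0 i)].

Lemma measurable_cube r : measurable (box r).
Proof. by apply: (@measurable_box _ _ (fun=> `[- r, r]%classic)) => _; exact: measurable_itv. Qed.

Lemma box_fin r : (lebesgue_rV R n (box r) < +oo)%E.
Proof.
have mB (i : 'I_n) : measurable (`[- r, r]%classic : set (measurableTypeR R)) by exact: measurable_itv.
rewrite /box (@lebesgue_rV_box _ _ (fun=> `[- r, r]%classic) mB).
rewrite ltey_eq; apply/orP; left; elim/big_ind: _ => // [x y x0 y0|i _]; first exact: fin_numM.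
by rewrite lebesgue_measure_itv/=; case: ifPn.
Qed.

Lemma eball_fin r : (lebesgue_rV R n (eball r) < +oo)%E.
Proof.
apply: le_lt_trans (box_fin r); apply: le_measure; rewrite ?inE; first exact: measurable_eball.
  exact: measurable_cube.
move=> x xr i; rewrite /= in_itv/= -ler_norml.
by rewrite (le_trans (coord_le_enorm x i))// ltW.
Qed.

Lemma eball1_gt0 : (0 < lebesgue_rV R n (eball 1))%E.
Proof.
(* With half-side [1/(n+1)] the cube lies in the unit ball: its points have squared norm at most
   [n/(n+1) < 1]. *)
pose e : R := n.+1%:R^-1.
have mB (i : 'I_n) : measurable (`]- e, e[%classic : set (measurableTypeR R)) by exact: measurable_itv.
apply: (@lt_le_trans _ _ (lebesgue_rV R n [set x | forall i, `]- e, e[%classic (x 0 i)])); last first.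
  apply: le_measure; rewrite ?inE; last 2 first.
  - exact: measurable_eball.
  - move=> x /= xe; rewrite /eball/= -(@ltr_pXn2r _ 2) ?nnegrE ?enorm_ge0// enorm_sqr expr1n.
    apply: (@le_lt_trans _ _ (\sum_(i < n) e)).
      apply: ler_sum => i _; have := xe i; rewrite in_itv/= -ltr_norml => xi.
      rewrite -expr2 -real_normK ?num_real// expr2.
      apply: (@le_trans _ _ (1 * e)); last by rewrite mul1r.
      apply: ler_pM => //; last exact: ltW.
      by rewrite (le_trans (ltW xi))// invf_le1// ler1n.
    rewrite sumr_const card_ord -mulr_natr mulrC -ltr_pdivlMr ?invr_gt0// div1r invrK.
    by rewrite ltr_nat.
  exact: (measurable_box mB).
rewrite (@lebesgue_rV_box _ _ (fun=> `]- e, e[%classic) mB).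
elim/big_ind: _ => [|x y x0 y0|i _]; rewrite ?lte01//; first exact: mule_gt0.
rewrite lebesgue_measure_itv/= ifT ?lte_fin ?gtrN// ?invr_gt0//.
by rewrite subr_gt0 gtrN// invr_gt0.
Qed.

Definition unit_volume : R := fine (lebesgue_rV R n (eball 1)).

Lemma unit_volume_gt0 : 0 < unit_volume.
Proof. by rewrite fine_gt0// eball1_gt0 eball_fin. Qed.

Lemma volume_eball r : (0 < n)%N -> 0 <= r ->
  lebesgue_rV R n (eball r) = (unit_volume * r ^+ n)%:E.
Proof.
move=> n0; rewrite le_eqVlt => /predU1P[<-|r0].
  by rewrite eball_le0// measure0 expr0n -(prednK n0)/= mulr0.
have -> : eball r = affine r^-1 0 @^-1` (eball 1) :> set 'rV[R]_n.
  by rewrite eball_dilation ?invr_gt0// invrK mul1r.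
rewrite lebesgue_rV_affine ?invr_gt0//; last exact: measurable_eball.
rewrite invrK mulrC EFinM fineK// ge0_fin_numE ?eball_fin//.
Qed.

End euclidean_norm.

(** * Differentiation in one variable *)

Section one_variable.
Context {R : realType}.
Implicit Types (f g : R -> R) (x d : R).

(** The first-order expansion, which allows [y = x], is easier to combine with estimates than the
    difference quotient. *)
Lemma is_deriveP f x d : is_derive x 1 f d <->
  forall e : R, 0 < e -> exists2 del : R, 0 < del &
    forall y : R, `|y - x| < del -> `|f y - f x - d * (y - x)| <= e * `|y - x|.
Proof.
split=> [[df dfE] e e0|H].
  have : h^-1 *: (f (h *: 1 + x) - f x) @[h --> 0^'] --> d by rewrite -dfE; exact: df.
  move=> /cvgrPdist_le /(_ e e0); rewrite near_withinE.
  move=> /nbhs_ballP[del /= del0 H]; exists del => // y yx.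
  have [yx0|yx0] := eqVneq (y - x) 0.
    by rewrite (subr0_eq yx0) !subrr !mulr0 !normr0 subrr normr0 mulr0.
  have := H (y - x); rewrite /ball/= sub0r normrN => /(_ yx yx0).
  rewrite /GRing.scale/= mulr1 subrK => Hy.
  rewrite -[leLHS]mul1r -[X in X * _](@mulVf _ `|y - x|) ?normr_eq0//.
  rewrite mulrAC ler_pM2r ?normr_gt0// -normfV -normrM mulrBr mulrCA mulVf// mulr1.
  by rewrite distrC.
have Hc : h^-1 *: (f (h *: 1 + x) - f x) @[h --> 0^'] --> d.
  apply/cvgrPdist_le => e e0; have [del del0 {}H] := H _ e0.
  rewrite near_withinE; apply/nbhs_ballP; exists del => //= h; rewrite /ball/= sub0r normrN => hd h0.
  have := H (h + x); rewrite addrK => /(_ hd) Hh.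
  rewrite /GRing.scale/= mulr1 distrC -[d](mulKf h0) -mulrBr normrM normfV.
  by rewrite ler_pdivrMl ?normr_gt0// (mulrC h) (mulrC _ e).
by split; [apply/cvg_ex; exists d|exact/cvg_lim].
Qed.

Lemma is_derive_near f g x d (del : R) : 0 < del ->
  (forall y, `|y - x| < del -> f y = g y) -> is_derive x 1 f d -> is_derive x 1 g d.
Proof.
move=> del0 fg /is_deriveP H; apply/is_deriveP => e e0; have [d1 d10 {}H] := H _ e0.
exists (Num.min d1 del) => [|y]; first by rewrite lt_min d10.
by rewrite lt_min => /andP[yd1 ydel]; rewrite -!fg ?subrr ?normr0//; exact: H.
Qed.

Lemma is_derive_continuous f x d : is_derive x 1 f d -> {for x, continuous f}.
Proof. by move=> [df _]; exact/differentiable_continuous/derivable1_diffP. Qed.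

(** As [p] vanishes at [x], continuity of [q] suffices. Later [q] is a ball integral of a bounded
    measurable function, which may fail to be differentiable. *)
Lemma is_derive_zero_mul (p q : R -> R) x d : p x = 0 ->
  is_derive x 1 p d -> {for x, continuous q} ->
  is_derive x 1 (fun y => p y * q y) (d * q x).
Proof.
move=> px0 /is_deriveP dp cq; apply/is_deriveP => e e0.
(* [M] bounds [|d|] and, near [x], also [|q y|]; each of the two error terms below is then at most
   half of [e * |y - x|]. *)
pose M := `|q x| + 1 + `|d|.
have M0 : 0 < M by rewrite /M; have := normr_ge0 (q x); have := normr_ge0 d; lra.
have eM : 0 < e / (2 * M) by rewrite divr_gt0// mulr_gt0.
have [d1 d10 H1] := dp _ eM.
have m1 : 0 < Num.min 1 (e / (2 * M)) by rewrite lt_min ltr01.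
move/cvgrPdist_lt : cq => /(_ _ m1) /nbhs_ballP[d2 /= d20 H2].
exists (Num.min d1 d2) => [|y]; first by rewrite lt_min d10.
rewrite lt_min => /andP[y1 y2].
have {}H1 := H1 _ y1; rewrite px0 subr0 in H1.
have := H2 y; rewrite /ball/= distrC => /(_ y2); rewrite lt_min => /andP[q1 q2].
rewrite px0 mul0r subr0.
have -> : p y * q y - d * q x * (y - x) =
  (p y - d * (y - x)) * q y - d * (y - x) * (q x - q y) by ring.
have qy : `|q y| <= M.
  rewrite -[q y](subrK (q x)); apply: (le_trans (ler_normD _ _)).
  by rewrite distrC /M; have := normr_ge0 d; lra.
apply: (le_trans (ler_normB _ _)); rewrite !normrM.
have -> : e * `|y - x| = e / (2 * M) * `|y - x| * M + M * `|y - x| * (e / (2 * M)).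
  by field; rewrite gt_eqF.
apply: lerD; first exact: ler_pM.
apply: ler_pM; rewrite ?mulr_ge0//; last exact: ltW.
by apply: ler_wpM2r => //; rewrite /M; have := normr_ge0 (q x); lra.
Qed.

Lemma is_derive_exprn (n : nat) x : is_derive x 1 (fun y => y ^+ n) (n%:R * x ^+ n.-1).
Proof.
have H := @is_deriveX R R id n x 1 1 (is_derive_id x 1).
rewrite [X in is_derive _ _ _ X](_ : _ = (n%:R * id x ^+ n.-1) *: 1); last first.
  by rewrite /GRing.scale/= mulr1.
by apply: (is_derive_near ltr01 _ H) => y _; rewrite exprfctE.
Qed.

Lemma is_derive_ge0_le f df (a b : R) : a <= b ->
  (forall x, a < x < b -> is_derive x 1 f (df x)) -> (forall x, a < x < b -> 0 <= df x) ->
  {within `[a, b], continuous f} -> f a <= f b.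
Proof.
move=> ab df1 df0 cf; move: ab; rewrite le_eqVlt => /predU1P[->//|ab].
have [c cab E] := MVT ab (fun x xab => df1 x xab) cf.
by rewrite -subr_ge0 E mulr_ge0// ?df0// subr_ge0 ltW.
Qed.

Lemma exprn_lipschitz (n : nat) (r s : R) : 0 <= r -> r <= s -> s <= 1 ->
  s ^+ n - r ^+ n <= n%:R * (s - r).
Proof.
move=> r0 rs s1; elim: n => [|n IH]; first by rewrite !expr0 subrr mul0r.
have s0 : 0 <= s by exact: le_trans rs.
have -> : s ^+ n.+1 - r ^+ n.+1 = s * (s ^+ n - r ^+ n) + r ^+ n * (s - r).
  by rewrite !exprS; ring.
have -> : n.+1%:R * (s - r) = 1 * (n%:R * (s - r)) + 1 * (s - r) by rewrite -natr1; ring.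
apply: lerD; last first.
  by apply: ler_wpM2r; [rewrite subr_ge0|rewrite exprn_ile1// (le_trans rs)].
apply: (le_trans (ler_wpM2l s0 IH)); apply: ler_wpM2r => //.
by rewrite mulr_ge0// subr_ge0.
Qed.

End one_variable.

(** * Integrals over balls *)

Section radial_integrals.
Context {R : realType} {n : nat}.
Hypothesis n_gt0 : (0 < n)%N.
Local Notation mu := (lebesgue_rV R n).
Local Notation omega := (@unit_volume R n).
Implicit Types (h : 'rV[R]_n -> R) (k : R -> R) (r s C : R).

(** As a function of the radius it takes the place of polar coordinates, for integrands that are not
    necessarily radial. *)
Definition ball_integral h r : R := \int[mu]_(x in eball r) h x.

Lemma bounded_integrable (D : set 'rV[R]_n) h C : measurable D -> D `<=` eball 1 ->
  measurable_fun D h -> (forall x, D x -> `|h x| <= C) -> mu.-integrable D (EFin \o h).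
Proof.
move=> mD DB mh hC; apply: measurable_bounded_integrable => //.
  apply: (le_lt_trans _ (eball_fin 1)); apply: le_measure => //; rewrite inE//.
  exact: measurable_eball.
exists C; split; first exact: num_real.
by move=> M CM x Dx; apply: (le_trans (hC _ Dx)); exact: ltW.
Qed.

Lemma measurable_shell r s : measurable (eball s `\` eball r : set 'rV[R]_n).
Proof. by apply: measurableD; exact: measurable_eball. Qed.

Lemma volume_shell r s : 0 <= r -> r <= s ->
  fine (mu (eball s `\` eball r)) = omega * (s ^+ n - r ^+ n).
Proof.
move=> r0 rs; have s0 := le_trans r0 rs.
rewrite measureD ?eball_fin//; [|exact: measurable_eball..].
rewrite setIidr; last exact: eball_sub.
transitivity (fine ((omega * s ^+ n)%:E - (omega * r ^+ n)%:E)%E); last by rewrite /= mulrBr.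
by congr (fine (_ - _)%E); exact: volume_eball.
Qed.

Lemma ball_integral_increment h C r s : measurable_fun (eball 1) h ->
  (forall x, eball 1 x -> `|h x| <= C) -> 0 <= r -> r <= s -> s <= 1 ->
  ball_integral h s - ball_integral h r = \int[mu]_(x in eball s `\` eball r) h x.
Proof.
move=> mh hC r0 rs s1.
have E : eball s = eball r `|` (eball s `\` eball r) :> set 'rV[R]_n.
  by rewrite setDE setUIr setUCr setIT setUidr//; exact: eball_sub.
rewrite /ball_integral {1}E Rintegral_setU; first by rewrite addrC addKr.
- exact: measurable_eball.
- exact: measurable_shell.
- rewrite -E; apply: (@bounded_integrable _ _ C).
  + exact: measurable_eball.
  + exact: eball_sub.
  + by apply: measurable_funS mh; [exact: measurable_eball|exact: eball_sub].
  + by move=> x /(eball_sub s1); exact: hC.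
- by apply/disj_setPRL => x /= [].
Qed.

Lemma shell_integral_le h C r s : measurable_fun (eball 1) h ->
  0 <= r -> r <= s -> s <= 1 ->
  (forall x, eball s x -> ~ eball r x -> `|h x| <= C) ->
  `|\int[mu]_(x in eball s `\` eball r) h x| <= C * (omega * (s ^+ n - r ^+ n)).
Proof.
move=> mh r0 rs s1 hC.
have mS := measurable_shell r s.
have SB : (eball s `\` eball r : set 'rV[R]_n) `<=` eball 1.
  by move=> x [] /(eball_sub s1).
have mhS : measurable_fun (eball s `\` eball r) h.
  by apply: measurable_funS mh => //; exact: measurable_eball.
have ih : mu.-integrable (eball s `\` eball r) (EFin \o h).
  by apply: (@bounded_integrable _ _ C) => // x []; exact: hC.
apply: (le_trans (le_normr_Rintegral mS ih)).
rewrite -volume_shell// -Rintegral_cst//.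
apply: le_Rintegral => //.
- by apply: (@bounded_integrable _ _ C) => // [|x []]; [exact: measurableT_comp|
    rewrite normr_id; exact: hC].
- by apply: (@bounded_integrable _ _ `|C|) => //; exact: measurable_cst.
- by move=> x []; exact: hC.
Qed.

Lemma bound_ge0 h C : (forall x, eball 1 x -> `|h x| <= C) -> 0 <= C.
Proof. by move=> hC; apply: le_trans (hC 0 _) => //; rewrite /eball/= enorm0. Qed.

Lemma ball_integral_lipschitz h C r s : measurable_fun (eball 1) h ->
  (forall x, eball 1 x -> `|h x| <= C) -> 0 <= r <= 1 -> 0 <= s <= 1 ->
  `|ball_integral h s - ball_integral h r| <= C * omega * n%:R * `|s - r|.
Proof.
move=> mh hC; have C0 := bound_ge0 hC; wlog rs : r s / r <= s => [H|] /andP[r0 r1] /andP[s0 s1].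
  have [rs|/ltW sr] := leP r s; first by apply: H => //; exact/andP.
  by rewrite distrC [`|s - r|]distrC; apply: H => //; exact/andP.
rewrite (ball_integral_increment mh hC)//.
apply: (le_trans (@shell_integral_le _ C _ _ mh r0 rs s1 _)).
  by move=> x /(eball_sub s1) /hC.
rewrite -!mulrA; apply: ler_wpM2l => //; apply: ler_wpM2l; first exact/ltW/unit_volume_gt0.
by rewrite [`|s - r|]ger0_norm ?subr_ge0//; exact: exprn_lipschitz.
Qed.

Lemma continuous_ball_integral h C : measurable_fun (eball 1) h ->
  (forall x, eball 1 x -> `|h x| <= C) -> {within `[0, 1], continuous (ball_integral h)}.
Proof.
move=> mh hC; apply/subspace_continuousP => x; rewrite /= in_itv/= => x01.
have C0 := bound_ge0 hC; apply/cvgrPdist_le => e e0; rewrite near_withinE; apply/nbhs_ballP.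
pose L := C * omega * n%:R + 1.
have L0 : 0 < L by rewrite ltr_wpDl// !mulr_ge0//; exact/ltW/unit_volume_gt0.
exists (e / L) => /=; first exact: divr_gt0.
move=> y; rewrite /ball/= => yx; rewrite in_itv/= => y01.
apply: (le_trans (ball_integral_lipschitz mh hC y01 x01)).
apply: (@le_trans _ _ (L * `|x - y|)); first by rewrite ler_wpM2r// lerDl.
by rewrite mulrC -ler_pdivlMr// ltW.
Qed.

Lemma measurable_radial (D : set 'rV[R]_n) k : continuous k ->
  measurable_fun D (k \o enorm).
Proof.
move=> ck; apply: (@measurable_funS _ _ _ _ setT) => //.
apply: continuous_on_measurable; first exact: openT.
by move=> x _; apply: continuous_comp; [exact: continuous_enorm|exact: ck].
Qed.

Lemma continuous_bounded_segment k (a b : R) : a <= b -> continuous k ->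
  exists2 K, 0 <= K & forall s, a <= s <= b -> `|k s| <= K.
Proof.
move=> ab ck; have cn : {within `[a, b], continuous (fun s => `|k s|)}.
  apply: continuous_subspaceT => s; apply: continuous_comp; first exact: ck.
  exact: norm_continuous.
have [c _ H] := EVT_max ab cn.
by exists `|k c| => // s sab; apply: H; rewrite in_itv.
Qed.

(** On the shell between the radii [r] and [y], [k (enorm x)] differs from [k r] by o(1), while the
    volume of the shell is O(|y - r|). So the increment is o(|y - r|) for every bounded [h]. *)
Lemma is_derive_radial_frozen h C k r : measurable_fun (eball 1) h ->
  (forall x, eball 1 x -> `|h x| <= C) -> continuous k -> 0 < r < 1 ->
  is_derive r 1
    (fun s => ball_integral (fun x => h x * k (enorm x)) s - k r * ball_integral h s) 0.
Proof.
move=> mh hC ck /andP[r0 r1].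
have C0 := bound_ge0 hC.
have [K K0 hK] := continuous_bounded_segment ler01 ck.
have mhk : measurable_fun (eball 1) (fun x => h x * k (enorm x)).
  by apply: measurable_funM => //; exact: measurable_radial.
have hkC x : eball 1 x -> `|h x * k (enorm x)| <= C * K.
  move=> x1; rewrite normrM ler_pM ?hC// hK// enorm_ge0/=; exact: ltW.
apply/is_deriveP => e e0.
pose L := C * omega * n%:R + 1.
have L0 : 0 < L by rewrite ltr_wpDl// !mulr_ge0//; exact/ltW/unit_volume_gt0.
have /cvgrPdist_le/(_ (e / L)) := ck r.
rewrite divr_gt0// => /(_ isT)/nbhs_ballP[d1 /= d10 H].
exists (Num.min d1 (Num.min r (1 - r))) => [|y]; first by rewrite !lt_min d10 r0 subr_gt0.
rewrite !lt_min => /andP[yd1 /andP[yr y1r]]; rewrite mul0r subr0.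
pose F a b := ball_integral (fun x => h x * k (enorm x)) b - k r * ball_integral h b -
  (ball_integral (fun x => h x * k (enorm x)) a - k r * ball_integral h a).
(* [F a b] is the increment from [a] to [b]; ordering [r] and [y] covers both sides of [r] at
   once. *)
suff key a b : 0 <= a -> a <= b -> b <= 1 -> `|a - r| < d1 -> `|b - r| < d1 ->
    `|F a b| <= e * (b - a).
  have y0 : 0 <= y by move: yr; rewrite ltr_norml => /andP[+ _]; rewrite ltrBrDr addNr => /ltW.
  have y1 : y <= 1 by move: y1r; rewrite ltr_norml => /andP[_]; rewrite ltrD2r => /ltW.
  have [ry|/ltW yr'] := leP r y.
    rewrite [X in _ <= _ * X]ger0_norm ?subr_ge0//; apply: key => //; [exact: ltW|].
    by rewrite subrr normr0.
  rewrite distrC [X in _ <= _ * X]distrC [X in _ <= _ * X]ger0_norm ?subr_ge0//.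
  by apply: key => //; [exact: ltW|rewrite subrr normr0].
move=> a0 ab b1 ad bd; rewrite /F.
have -> : ball_integral (fun x => h x * k (enorm x)) b - k r * ball_integral h b -
  (ball_integral (fun x => h x * k (enorm x)) a - k r * ball_integral h a) =
  (ball_integral (fun x => h x * k (enorm x)) b - ball_integral (fun x => h x * k (enorm x)) a)
   - k r * (ball_integral h b - ball_integral h a) by ring.
rewrite (ball_integral_increment mhk hkC)// (ball_integral_increment mh hC)//.
have mS := measurable_shell a b.
have SB : (eball b `\` eball a : set 'rV[R]_n) `<=` eball 1.
  by move=> x [] /(eball_sub b1).
have ih : mu.-integrable (eball b `\` eball a) (EFin \o h).
  apply: (@bounded_integrable _ _ C) => // [|x /SB/hC//].
  by apply: measurable_funS mh => //; exact: measurable_eball.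
have ihk : mu.-integrable (eball b `\` eball a) (EFin \o (fun x => h x * k (enorm x))).
  apply: (@bounded_integrable _ _ (C * K)) => // [|x /SB/hkC//].
  by apply: measurable_funS mhk => //; exact: measurable_eball.
rewrite -RintegralZl// -RintegralB//; last first.
  apply: (@bounded_integrable _ _ (`|k r| * C)) => // [|x /SB/hC].
    apply: measurable_funM => //; apply: measurable_funS mh => //; exact: measurable_eball.
  by rewrite normrM; exact: ler_wpM2l.
apply: (@le_trans _ _ (C * (e / L) * (omega * (b ^+ n - a ^+ n)))).
  apply: shell_integral_le => //.
    apply: measurable_funB => //; apply: measurable_funM => //.
  move=> x xb xa.
  have -> : h x * k (enorm x) - k r * h x = h x * (k (enorm x) - k r) by ring.
  rewrite normrM ler_pM//; first by apply: hC; exact: eball_sub xb.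
  rewrite distrC; apply: H; rewrite /ball/= distrC.
  move: xb ad bd; rewrite /eball/= => xb; move/negP: xa; rewrite -leNgt => xa.
  rewrite !ltr_norml => /andP[ad _] /andP[_ bd]; apply/andP; split; lra.
apply: (@le_trans _ _ (C * (e / L) * (omega * (n%:R * (b - a))))).
  apply: ler_wpM2l; first by rewrite mulr_ge0// ltW// divr_gt0.
  by apply: ler_wpM2l; [exact/ltW/unit_volume_gt0|exact: exprn_lipschitz].
have -> : C * (e / L) * (omega * (n%:R * (b - a))) = (C * omega * n%:R) / L * (e * (b - a)).
  by ring.
rewrite -[leRHS]mul1r; apply: ler_wpM2r; first by rewrite mulr_ge0 ?subr_ge0// ltW.
by rewrite ler_pdivrMr// mul1r lerDl.
Qed.

Lemma is_derive_radial k r : continuous k -> 0 < r < 1 ->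
  is_derive r 1 (ball_integral (k \o enorm)) (omega * n%:R * r ^+ n.-1 * k r).
Proof.
move=> ck /[dup] r01 /andP[r0 r1].
have m1 : measurable_fun (eball 1 : set 'rV[R]_n) (fun=> 1 : R) by exact: measurable_cst.
have b1 (x : 'rV[R]_n) : eball 1 x -> `|1 : R| <= 1 by rewrite normr1.
have H := is_derive_radial_frozen m1 b1 ck r01.
have dv : is_derive r 1 (fun s => k r * (omega * s ^+ n)) (omega * n%:R * r ^+ n.-1 * k r).
  rewrite (_ : _ * k r = (k r * omega) *: (n%:R * r ^+ n.-1)); last by rewrite /GRing.scale/=; ring.
  rewrite (_ : (fun s => _) = (k r * omega) \*: (fun s => s ^+ n)).
    by apply: is_deriveZ; exact: is_derive_exprn.
  by apply/funext => s; rewrite /GRing.scale/= mulrA.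
have -> : omega * n%:R * r ^+ n.-1 * k r = 0 + omega * n%:R * r ^+ n.-1 * k r by rewrite add0r.
apply: (is_derive_near r0 _ (is_deriveD H dv)) => y yr.
have y0 : 0 <= y by move: yr; rewrite ltr_norml => /andP[+ _]; rewrite ltrBrDr addNr => /ltW.
transitivity (ball_integral (fun x => 1 * k (enorm x)) y - k r * ball_integral (fun=> 1) y +
  k r * (omega * y ^+ n)) => //.
have -> : ball_integral (fun=> 1) y = omega * y ^+ n.
  rewrite /ball_integral Rintegral_cst ?mul1r; last exact: measurable_eball.
  by transitivity (fine (omega * y ^+ n)%:E) => //; congr fine; exact: volume_eball.
rewrite subrK; apply: eq_Rintegral => x _.
by rewrite mul1r.
Qed.

(* By Fubini the differentiated function is minus the integral over [0, r] of
   k' times ball_integral h. *)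
Lemma is_derive_layer_cake h C k dk r : measurable_fun (eball 1) h ->
  (forall x, eball 1 x -> `|h x| <= C) -> continuous k -> 0 < r < 1 ->
  is_derive r 1 k dk ->
  is_derive r 1
    (fun s => ball_integral (fun x => h x * k (enorm x)) s - k s * ball_integral h s)
    (- (dk * ball_integral h r)).
Proof.
move=> mh hC ck r01 dk1.
have H := is_derive_radial_frozen mh hC ck r01.
have ch : {for r, continuous (ball_integral h)}.
  have /continuous_within_itvP := continuous_ball_integral mh hC.
  by move=> /(_ ltr01)[+ _ _]; apply; rewrite in_itv.
have dk0 : is_derive r 1 (fun s => k s - k r) dk.
  by rewrite -[X in is_derive _ _ _ X]subr0; apply: is_deriveB.
have H2 := is_derive_zero_mul (subrr (k r) : (fun s => k s - k r) r = 0) dk0 ch.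
rewrite -sub0r; apply: (is_derive_near ltr01 _ (is_deriveB H H2)) => y _.
transitivity (ball_integral (fun x => h x * k (enorm x)) y - k r * ball_integral h y -
  (k y - k r) * ball_integral h y) => //; ring.
Qed.

Lemma continuous_layer_cake h C k : measurable_fun (eball 1) h ->
  (forall x, eball 1 x -> `|h x| <= C) -> continuous k ->
  {within `[0, 1], continuous
    (fun s => ball_integral (fun x => h x * k (enorm x)) s - k s * ball_integral h s)}.
Proof.
move=> mh hC ck; have [K K0 hK] := continuous_bounded_segment ler01 ck.
have mhk : measurable_fun (eball 1) (fun x => h x * k (enorm x)).
  by apply: measurable_funM => //; exact: measurable_radial.
have hkC x : eball 1 x -> `|h x * k (enorm x)| <= C * K.
  by move=> x1; rewrite normrM ler_pM ?hC// hK// enorm_ge0/=; exact: ltW.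
move=> x; apply: cvgB; first exact: (continuous_ball_integral mhk hkC).
apply: cvgM; last exact: (continuous_ball_integral mh hC).
by apply: continuous_subspaceT; exact: ck.
Qed.

End radial_integrals.

(** * C^1 test functions and weak gradients *)

Section C1_functions.
Context {R : realType} {n : nat}.
Local Notation mu := (lebesgue_rV R n).
Local Notation B := (eball 1 : set 'rV[R]_n).
Implicit Types (g h eta : 'rV[R]_n -> R) (D : set 'rV[R]_n).

Definition C1 g := (forall x, differentiable g x) /\ forall i, continuous (partial i g).

Lemma continuous_mul (T : topologicalType) (f g : T -> R) :
  continuous f -> continuous g -> continuous (fun x => f x * g x).
Proof. by move=> cf cg x; exact: (cvgM (cf x) (cg x)). Qed.

Lemma C1c_C1 D g : C1c D g -> C1 g.
Proof. by case. Qed.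

Lemma C1_continuous g : C1 g -> continuous g.
Proof. by move=> [dg _] x; exact: differentiable_continuous. Qed.

Lemma C1_derivable g x v : C1 g -> derivable g x v.
Proof. by move=> [dg _]; exact: diff_derivable. Qed.

Lemma partialM g h i x : C1 g -> C1 h ->
  partial i (fun y => g y * h y) x = g x * partial i h x + partial i g x * h x.
Proof.
move=> Cg Ch; rewrite /partial [LHS](@deriveM _ _ g h); [|exact: C1_derivable..].
by rewrite /GRing.scale/= [h x * _]mulrC.
Qed.

Lemma C1M g h : C1 g -> C1 h -> C1 (fun x => g x * h x).
Proof.
move=> Cg Ch; split=> [x|i].
  by apply: differentiableM; [case: Cg|case: Ch].
rewrite (_ : partial i _ = fun x => g x * partial i h x + partial i g x * h x); last first.
  by apply/funext => x; exact: partialM.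
move=> x; have cg := C1_continuous Cg; have ch := C1_continuous Ch.
have [_ dg] := Cg; have [_ dh] := Ch.
exact: (cvgD (cvgM (cg x) (dh i x)) (cvgM (dg i x) (ch x))).
Qed.

Lemma partial_eq0_off D g i x : closed D -> (forall y, ~ D y -> g y = 0) -> ~ D x ->
  partial i g x = 0.
Proof.
move=> cD g0 Dx; rewrite /partial.
transitivity ('D_(delta_mx 0 i) (cst 0 : 'rV[R]_n -> R) x); last exact: derive_cst.
apply: near_eq_derive.
have oD : open (~` D) by exact: closed_openC.
have := open_nbhs_nbhs (conj oD (Dx : (~` D) x)).
by apply: filterS => y /= Dy; rewrite g0.
Qed.

Lemma compact_eball_closure : compact [set x : 'rV[R]_n | enorm x <= 1].
Proof.
apply: bounded_closed_compact.
  exists 1; split; first exact: num_real.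
  move=> M M1 x /= x1; apply: le_trans (ltW M1); apply: le_trans x1.
  rewrite [leLHS]/Num.norm /= mx_normrE; apply/bigmax_leP; split; first exact: enorm_ge0.
  by move=> -[i j] _ /=; rewrite ord1 coord_le_enorm.
rewrite (_ : mkset _ = enorm @^-1` [set t | t <= 1])//.
by apply: closed_comp => [x _|]; [exact: continuous_enorm|exact: closed_le].
Qed.

Lemma continuous_compact_bounded (K : set 'rV[R]_n) g : compact K ->
  {within K, continuous g} -> exists2 C, 0 <= C & forall x, K x -> `|g x| <= C.
Proof.
move=> cK cg; have := compact_bounded (continuous_compact cg cK).
move=> [M [_ HM]]; exists (`|M| + 1); first by rewrite addr_ge0.
move=> x Kx; apply: (HM (`|M| + 1)); last by exists x.
by rewrite (le_lt_trans (ler_norm M))// ltrDl.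
Qed.

Lemma continuous_bounded_eball g : continuous g ->
  exists2 C, 0 <= C & forall x, B x -> `|g x| <= C.
Proof.
move=> cg; have [|C C0 HC] := continuous_compact_bounded compact_eball_closure (g := g).
  exact: continuous_subspaceT.
by exists C => // x xB; apply: HC; rewrite /= ltW.
Qed.

Lemma measurable_continuous D g : continuous g -> measurable_fun D g.
Proof.
move=> cg; apply: (@measurable_funS _ _ _ _ setT) => //.
by apply: continuous_on_measurable; [exact: openT|move=> x _; exact: cg].
Qed.

Lemma continuous_integrable_eball g : continuous g -> mu.-integrable B (EFin \o g).
Proof.
move=> cg; have [C C0 HC] := continuous_bounded_eball cg.
apply: (@bounded_integrable _ _ _ _ C) => //; first exact: measurable_eball.
exact: measurable_continuous.
Qed.

Definition translate (v x : 'rV[R]_n) := x + v.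

Lemma measurable_translate v : measurable_fun setT (translate v).
Proof.
rewrite (_ : translate v = affine 1 v); first exact: measurable_affine.
by apply/funext => x; rewrite /translate /affine scale1r.
Qed.

Lemma integral_translate v g : continuous g -> mu.-integrable setT (EFin \o (g \o translate v)) ->
  \int[mu]_x g (x + v) = \int[mu]_x g x.
Proof.
move=> cg ig; congr fine.
have mg : measurable_fun setT (EFin \o g).
  by apply/measurable_EFinP; exact: measurable_continuous.
have := integral_pushforward (measurable_translate v) mg _ measurableT.
move=> /(_ mu); rewrite preimage_setT => /(_ ig).
rewrite /= => <-; apply: eq_measure_integral => [|mf A mA _ /=]; first exact: measurable_translate.
rewrite /pushforward (_ : translate v @^-1` A = affine 1 v @^-1` A).
  by rewrite lebesgue_rV_affine// invr1 expr1n mul1e.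
by apply/seteqP; split => x; rewrite /= /translate /affine scale1r.
Qed.

Lemma is_derive_line g x v (t : R) : C1 g ->
  is_derive t 1 (fun s : R => g (x + s *: v)) ('D_v g (x + t *: v)).
Proof.
move=> Cg.
have E : (fun h : R => h^-1 *: (g (x + (h *: 1 + t) *: v) - g (x + t *: v))) =
         (fun h : R => h^-1 *: (g (h *: v + (x + t *: v)) - g (x + t *: v))).
  apply/funext => h; congr (_ *: (g _ - _)).
  have -> : h *: (1 : R) = h by rewrite /GRing.scale/= mulr1.
  by rewrite scalerDl addrCA.
have dg := @C1_derivable g (x + t *: v) v Cg.
split; first by rewrite /derivable E.
by rewrite /derive E.
Qed.

Lemma mean_value_line g x v (M t : R) : C1 g -> (forall y, `|'D_v g y| <= M) -> 0 <= t ->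
  `|g (x + t *: v) - g x| <= M * t.
Proof.
move=> Cg gM t0.
have [||c _] := @MVT_segment R (fun s : R => g (x + s *: v)) (fun s => 'D_v g (x + s *: v)) 0 t t0.
- by move=> s _; exact: is_derive_line.
- apply: continuous_subspaceT => s.
  exact: (is_derive_continuous (is_derive_line x v s Cg)).
by rewrite scale0r addr0 subr0 => ->; rewrite normrM (ger0_norm t0) ler_wpM2r.
Qed.

Lemma integrable_indic_box (C r : R) :
  mu.-integrable setT (EFin \o (fun x : 'rV[R]_n => C * \1_(box r) x)).
Proof.
have iI : mu.-integrable setT (EFin \o (\1_(box r) : 'rV[R]_n -> R)).
  apply/integrableP; split.
    by apply/measurable_EFinP/measurable_indic; exact: measurable_cube.
  under eq_integral do rewrite /= ger0_norm//.
  by rewrite integral_indic ?setIT//; [exact: box_fin|exact: measurable_cube].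
exact: (integrableZl measurableT C iI).
Qed.

Lemma box_bounded_integrable g (C r : R) : continuous g ->
  (forall x, `|g x| <= C * \1_(box r) x) -> mu.-integrable setT (EFin \o g).
Proof.
move=> cg gC; apply: le_integrable (integrable_indic_box C r) => //.
  by apply/measurable_EFinP; exact: measurable_continuous.
by move=> x _; rewrite /= lee_fin (le_trans (gC x))// ler_norm.
Qed.

(** Difference quotients in direction [e] have integral 0 by translation invariance. The mean value
    theorem bounds them by a constant on a fixed cube, and dominated convergence passes to the
    partial derivative. *)
Lemma integral_partial_eq0 (K : set 'rV[R]_n) h i : C1 h -> compact K -> K `<=` B ->
  (forall x, ~ K x -> h x = 0) -> \int[mu]_(x in B) partial i h x = 0.
Proof.
move=> Ch cK KB h0; have clK : closed K by exact: compact_closed.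
have p0 x : ~ K x -> partial i h x = 0 by exact: partial_eq0_off.
pose e : 'rV[R]_n := delta_mx 0 i.
have cp : continuous (partial i h) by case: Ch.
have [M M0 HM] : exists2 M : R, 0 <= M & forall x, `|partial i h x| <= M.
  have [|M M0 HM] := continuous_compact_bounded cK (g := partial i h).
    exact: continuous_subspaceT.
  exists M => // x; have [/HM//|/p0 ->] := pselect (K x); by rewrite normr0.
pose t (k : nat) : R := k.+1%:R^-1.
have t_gt0 k : 0 < t k by rewrite invr_gt0.
have t_le1 k : t k <= 1 by rewrite invf_le1// ler1n.
pose q k (x : 'rV[R]_n) := (t k)^-1 * (h (x + t k *: e) - h x).
(* The cube of half-side 2 contains every [x] with [x + s *: e] in [K] for some [s] in [0, 1], hence
   the supports of all the quotients. *)
pose D2 : set 'rV[R]_n := box 2.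
pose G x : R := M * \1_D2 x.
have ch : continuous h by exact: C1_continuous.
have chk k : continuous (fun x : 'rV[R]_n => h (x + t k *: e)).
  move=> x; apply: (@continuous_comp _ _ _ (fun x : 'rV[R]_n => x + t k *: e) h); last exact: ch.
  have := @cvgD R 'rV[R]_n _ (nbhs x) _ id (cst (t k *: e)) x (t k *: e).
  by apply; [exact: cvg_id|exact: cvg_cst].
have e1 : enorm e = 1.
  rewrite /enorm /dotr (bigD1 i)//= big1 => [|j ji].
    by rewrite !mxE !eqxx mulr1 addr0 sqrtr1.
  by rewrite !mxE (negbTE ji) andbF mulr0.
have K_D2 x s : 0 <= s <= 1 -> K (x + s *: e) -> D2 x.
  move=> /andP[s0 s1] /KB; rewrite /eball/= => xe j; rewrite /= in_itv/= -ler_norml.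
  have -> : x 0 j = (x + s *: e) 0 j - s * (i == j)%:R by rewrite !mxE eqxx/= eq_sym addrK.
  apply: (le_trans (ler_normB _ _)); apply: (@le_trans _ _ (1 + 1)); last by rewrite -natr1.
  apply: lerD; first exact: le_trans (coord_le_enorm _ _) (ltW xe).
  by case: eqP => _; rewrite ?mulr1 ?mulr0 ?normr0// ger0_norm.
have K_D2' x : K x -> D2 x.
  by move=> Kx; apply: (K_D2 x 0); rewrite ?lexx ?ler01// scale0r addr0.
have qG k x : `|q k x| <= G x.
  rewrite /G indicE; have [_|x2] := boolP (x \in D2).
    rewrite mulr1 /q normrM normfV (gtr0_norm (t_gt0 k)).
    rewrite ler_pdivrMl// mulrC.
    by apply: mean_value_line => //; exact: ltW.
  move: x2; rewrite notin_setE => x2; rewrite mulr0 /q !h0 ?subrr ?mulr0 ?normr0//.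
    by move=> /K_D2'.
  by move=> xe; apply: x2; apply: K_D2 xe; rewrite ltW/=.
have [Ch0 Ch0' hCh] := continuous_compact_bounded cK (continuous_subspaceT ch).
have hD2 s x : 0 <= s <= 1 -> `|h (x + s *: e)| <= Ch0 * \1_D2 x.
  move=> s01; rewrite indicE; have [Kx|Kx] := pselect (K (x + s *: e)).
    by rewrite mem_set ?mulr1; [exact: hCh|exact: K_D2 Kx].
  by rewrite h0// normr0 mulr_ge0.
have ih : mu.-integrable setT (EFin \o h).
  apply: box_bounded_integrable ch _ => x.
  by rewrite -[X in h X]addr0 -(scale0r e); apply: hD2; rewrite lexx ler01.
have ihk k : mu.-integrable setT (EFin \o (fun x => h (x + t k *: e))).
  apply: box_bounded_integrable => x; first exact: chk.
  by apply: hD2; rewrite ltW/=.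
have q0 k : \int[mu]_x q k x = 0.
  rewrite RintegralZl//; last exact: (integrableB measurableT (ihk k) ih).
  by rewrite RintegralB// (@integral_translate (t k *: e) h ch (ihk k)) subrr mulr0.
have cq k : continuous (q k).
  by move=> x; exact: (cvgM (cvg_cst _) (cvgB (chk k x) (ch x))).
have iq k : mu.-integrable setT (EFin \o q k) by exact: box_bounded_integrable (cq k) (qG k).
have ip : mu.-integrable setT (EFin \o partial i h).
  apply: (@box_bounded_integrable _ M 2) => // x; rewrite indicE.
  have [Kx|Kx] := pselect (K x); first by rewrite mem_set ?mulr1//; exact: K_D2'.
  by rewrite p0// normr0 mulr_ge0.
have iG : mu.-integrable setT (EFin \o G) by exact: integrable_indic_box.
have lim0 : \int[mu]_x (partial i h x) = 0.
  have qp x : q k x @[k --> \oo] --> partial i h x.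
    apply/cvgrPdist_le => r r0.
    have /is_deriveP/(_ r r0)[del del0 H] := @is_derive_line h x e 0 Ch.
    near=> k; have := H (t k); rewrite !subr0 (gtr0_norm (t_gt0 k)) scale0r addr0.
    have tk : t k < del by near: k; exact: (near_infty_natSinv_lt (PosNum del0)).
    move=> /(_ tk) Hk.
    have -> : partial i h x - q k x = - ((t k)^-1 * (h (x + t k *: e) - h x - 'D_e h x * t k)).
      by rewrite /q /partial -/e; field; rewrite gt_eqF.
    by rewrite normrN normrM normfV (gtr0_norm (t_gt0 k)) ler_pdivrMl// (mulrC _ r).
  have := @dominated_cvg _ _ _ mu setT measurableT (fun k => EFin \o q k)
    (EFin \o partial i h) (EFin \o G).
  move=> H; have {}H : (\int[mu]_x (EFin \o q k) x)%E @[k --> \oo] --> (\int[mu]_x (partial i h x)%:E)%E.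
    apply: H => //.
    - by move=> k; apply/measurable_EFinP; exact: measurable_continuous.
    - by move=> x _; apply: cvg_EFin; [exact: nearW|exact: qp].
    - by move=> k x _; rewrite /= lee_fin.
  have E : (fun k => \int[mu]_x (EFin \o q k) x)%E = (fun=> 0%E).
    apply/funext => k; rewrite -(@fineK _ (\int[mu]_x _)%E); last exact: integrable_fin_num.
    by congr EFin; exact: q0.
  rewrite E in H; rewrite /Rintegral.
  by rewrite -(cvg_unique (@ereal_hausdorff R) (cvg_cst 0%E) H).
rewrite -[RHS]lim0 Rintegral_mkcond; apply: eq_Rintegral => x _ /=.
by rewrite patchE; case: ifPn => //; rewrite notin_setE => xB; rewrite p0// => /KB.
Unshelve. all: by end_near. Qed.

Lemma integration_by_parts_C1c g eta i : C1 g -> C1c B eta ->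
  \int[mu]_(x in B) (g x * partial i eta x) = - \int[mu]_(x in B) (partial i g x * eta x).
Proof.
move=> Cg /[dup] /C1c_C1 Ceta [_ _ [K [cK KB eta0]]].
have E := integral_partial_eq0 i (C1M Cg Ceta) cK KB.
apply/eqP; rewrite -subr_eq0 opprK; apply/eqP.
have cg := C1_continuous Cg; have ce := C1_continuous Ceta.
rewrite -RintegralD; last 3 first.
- exact: measurable_eball.
- apply: (@continuous_integrable_eball (fun x => g x * partial i eta x)).
  by apply: continuous_mul => //; case: Ceta.
- apply: (@continuous_integrable_eball (fun x => partial i g x * eta x)).
  by apply: continuous_mul => //; case: Cg.
rewrite -[RHS]E; last by move=> x /eta0 ->; rewrite mulr0.
by apply: eq_Rintegral => x _; rewrite partialM.
Qed.

Lemma continuous_L2 g : continuous g -> L2 B g.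
Proof.
move=> cg; split; first exact: measurable_continuous.
apply: (@continuous_integrable_eball (fun x => g x ^+ 2)).
by rewrite (_ : (fun x => _) = fun x => g x * g x); [exact: continuous_mul|apply/funext].
Qed.

Lemma C1c_H10 eta : C1c B eta -> H10 B eta (gradient eta).
Proof.
move=> Ceta; have C := C1c_C1 Ceta; split.
  split.
  - exact/continuous_L2/C1_continuous.
  - move=> i; apply: continuous_L2.
    rewrite (_ : (fun x => _) = partial i eta); first by case: C.
    by apply/funext => x; rewrite mxE.
  - move=> zeta Czeta i; rewrite integration_by_parts_C1c//; congr (- _).
    by apply: eq_Rintegral => x _; rewrite mxE.
exists (fun=> eta); split=> //.
  rewrite (_ : (fun k => _) = (fun=> 0%E)); first exact: cvg_cst.
  by apply/funext => k; apply: integral0_eq => x _; rewrite subrr expr0n.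
rewrite (_ : (fun k => _) = (fun=> 0%E)); first exact: cvg_cst.
by apply/funext => k; apply: integral0_eq => x _; rewrite subrr enorm0 expr0n.
Qed.

Lemma L2_integrable f : L2 B f -> mu.-integrable B (EFin \o f).
Proof.
move=> [mf if2]; have mB := @measurable_eball R n 1.
have i1 : mu.-integrable B (EFin \o (fun=> 1 : R)).
  by apply: (@continuous_integrable_eball (cst 1)); exact: cst_continuous.
apply: le_integrable (integrableD mB i1 if2) => //; first exact/measurable_EFinP.
move=> x _; rewrite /= lee_fin [leRHS]ger0_norm ?addr_ge0 ?sqr_ge0//.
rewrite -[f x ^+ 2]real_normK ?num_real//; have := sqr_ge0 (`|f x| - 2^-1); nra.
Qed.

Lemma L2_mul_bounded f (w : 'rV[R]_n -> R) (C : R) : L2 B f -> measurable_fun B w ->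
  (forall x, B x -> `|w x| <= C) -> mu.-integrable B (EFin \o (fun x => f x * w x)).
Proof.
move=> [mf if2] mw wC; have mB := @measurable_eball R n 1.
have iC := integrableZl mB C (L2_integrable (conj mf if2)).
apply: le_integrable iC => //; first by apply/measurable_EFinP; exact: measurable_funM.
move=> x Bx; rewrite /= lee_fin !normrM mulrC ler_wpM2r//.
by rewrite (le_trans (wC x Bx))// ler_norm.
Qed.

Lemma L2B f g : L2 B f -> L2 B g -> L2 B (fun x => f x - g x).
Proof.
move=> [mf if2] [mg ig2]; have mB := @measurable_eball R n 1.
have mfg : measurable_fun B (fun x => f x - g x) by exact: measurable_funB.
split=> //.
have i2 := integrableD mB (integrableZl mB 2 if2) (integrableZl mB 2 ig2).
apply: le_integrable i2 => //; first by apply/measurable_EFinP; exact: measurable_funX.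
move=> x _; rewrite /= lee_fin ger0_norm ?sqr_ge0// ger0_norm; last first.
  by rewrite addr_ge0// mulr_ge0// sqr_ge0.
by have := sqr_ge0 (f x + g x); nra.
Qed.

(* Cauchy-Schwarz replaced by the pointwise bound |y| <= d + y^2 / d. *)
Lemma L2_mul_bounded_le f (w : 'rV[R]_n -> R) (C del : R) : L2 B f -> measurable_fun B w ->
  (forall x, B x -> `|w x| <= C) -> 0 < del ->
  `|\int[mu]_(x in B) (f x * w x)| <=
    C * (del * @unit_volume R n + del^-1 * \int[mu]_(x in B) (f x ^+ 2)).
Proof.
move=> Lf mw wC del0; have mB := @measurable_eball R n 1.
have ifw := L2_mul_bounded Lf mw wC; have [mf if2] := Lf.
have C0 : 0 <= C by apply: le_trans (wC 0 _) => //; rewrite /eball/= enorm0.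
have i1 : mu.-integrable B (EFin \o (fun=> del)).
  by apply: (@continuous_integrable_eball (cst del)); exact: cst_continuous.
have i2 : mu.-integrable B (EFin \o (fun x => del^-1 * f x ^+ 2)) by exact: (integrableZl mB del^-1 if2).
have i3 : mu.-integrable B (EFin \o (fun x => del + del^-1 * f x ^+ 2)) by exact: (integrableD mB i1 i2).
apply: (le_trans (le_normr_Rintegral mB ifw)).
rewrite -RintegralZl// -Rintegral_cst// -RintegralD// -RintegralZl//.
apply: le_Rintegral => //.
- by have := integrable_norm ifw.
- exact: (integrableZl mB C i3).
move=> x Bx; rewrite normrM mulrC ler_pM ?wC//.
rewrite -(ler_pM2l del0) mulrDr mulVKf ?gt_eqF// -[f x ^+ 2]real_normK ?num_real//.
by have := sqr_ge0 (`|f x| - del / 2); nra.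
Qed.

(** Here [g] need not vanish on the boundary; the boundary term disappears because [phi] is a limit
    of C^1_c functions, for which the formula is known. This is where membership in H^1_0 rather
    than H^1 enters. *)
Lemma H10_by_parts g phi G i : H10 B phi G -> C1 g ->
  \int[mu]_(x in B) (phi x * partial i g x) = - \int[mu]_(x in B) (G x 0 i * g x).
Proof.
move=> [[Lphi LG _] [eta [Ceta cphi cG]]] Cg; have mB := @measurable_eball R n 1.
have cg := C1_continuous Cg; have cdg : continuous (partial i g) by case: Cg.
have [K1 K10 gK1] := continuous_bounded_eball cg.
have [K2 K20 gK2] := continuous_bounded_eball cdg.
have mg : measurable_fun B g by exact: measurable_continuous.
have mdg : measurable_fun B (partial i g) by exact: measurable_continuous.
apply/eqP; rewrite -subr_eq0 opprK -normr_eq0 eq_le normr_ge0 andbT.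
apply/ler_addgt0Pr => e e0; rewrite add0r.
have V0 := @unit_volume_gt0 R n; set om := @unit_volume R n in V0.
have K3 : 0 < K1 + K2 + 1 by rewrite ltr_wpDl// addr_ge0.
have om1 : 0 < om + 1 by rewrite addr_gt0.
(* Once the squared L^2 errors are at most [del ^+ 2], each error integral is at most
   [del * (om + 1)] times [K1] or [K2]; this choice brings the total below [e]. *)
pose del := e / ((K1 + K2 + 1) * (om + 1)).
have del0 : 0 < del by rewrite divr_gt0// mulr_gt0.
have L0 k : L2 B (eta k) by exact: continuous_L2 (C1_continuous (C1c_C1 (Ceta k))).
have L1 k : L2 B (fun x => phi x - eta k x) by exact: L2B.
have cd k : continuous (partial i (eta k)) by case: (Ceta k).
have L2' k : L2 B (fun x => G x 0 i - partial i (eta k) x) by apply: L2B => //; exact: continuous_L2.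
have Ld k j : L2 B (fun x => partial j (eta k) x - G x 0 j).
  by apply: L2B => //; apply: continuous_L2; case: (Ceta k).
have ie k : mu.-integrable B (EFin \o (fun x => enorm (gradient (eta k) x - G x) ^+ 2)).
  have : mu.-integrable B (fun x => \sum_(j < n) ((partial j (eta k) x - G x 0 j) ^+ 2)%:E)%E.
    by apply: integrable_sum => // j _; have [_] := Ld k j.
  apply: eq_integrable => // x _; rewrite /= enorm_sqr /dotr sumEFin; congr EFin.
  by apply: eq_bigr => j _; rewrite !mxE expr2.
have small : \forall k \near \oo,
    \int[mu]_(x in B) ((phi x - eta k x) ^+ 2) <= del ^+ 2 /\
    \int[mu]_(x in B) ((G x 0 i - partial i (eta k) x) ^+ 2) <= del ^+ 2.
  have d2 : 0 < del ^+ 2 by rewrite exprn_gt0.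
  have /fine_cvgP[_ /cvgrPdist_le/(_ _ d2) H1] := cphi.
  have /fine_cvgP[_ /cvgrPdist_le/(_ _ d2) H2] := cG.
  near=> k; split.
    have : `|0 - \int[mu]_(x in B) ((eta k x - phi x) ^+ 2)| <= del ^+ 2 by near: k; exact: H1.
    rewrite sub0r normrN => /(le_trans (ler_norm _)); apply: le_trans.
    by rewrite le_eqVlt; apply/orP; left; apply/eqP/eq_Rintegral => x _; rewrite -sqrrN opprB.
  have : `|0 - \int[mu]_(x in B) (enorm (gradient (eta k) x - G x) ^+ 2)| <= del ^+ 2.
    by near: k; exact: H2.
  rewrite sub0r normrN => /(le_trans (ler_norm _)); apply: le_trans.
  apply: le_Rintegral => //; first by have [_] := L2' k.
  move=> x _; rewrite -sqrrN opprB -real_normK ?num_real//.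
  rewrite ler_pXn2r ?nnegrE ?enorm_ge0//.
  by have := coord_le_enorm (gradient (eta k) x - G x) i; rewrite !mxE.
have [k [Sk1 Sk2]] := filter_ex small.
have E := integration_by_parts_C1c i Cg (Ceta k).
have -> : \int[mu]_(x in B) (phi x * partial i g x) + \int[mu]_(x in B) (G x 0 i * g x) =
  \int[mu]_(x in B) ((phi x - eta k x) * partial i g x) +
  \int[mu]_(x in B) ((G x 0 i - partial i (eta k) x) * g x).
  have E1 : \int[mu]_(x in B) ((phi x - eta k x) * partial i g x) =
      \int[mu]_(x in B) (phi x * partial i g x) - \int[mu]_(x in B) (eta k x * partial i g x).
    rewrite -RintegralB//; [|exact: L2_mul_bounded gK2|exact: L2_mul_bounded gK2].
    by apply: eq_Rintegral => x _; rewrite mulrBl.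
  have E2 : \int[mu]_(x in B) ((G x 0 i - partial i (eta k) x) * g x) =
      \int[mu]_(x in B) (G x 0 i * g x) - \int[mu]_(x in B) (partial i (eta k) x * g x).
    rewrite -RintegralB//; [|exact: L2_mul_bounded gK1|apply: L2_mul_bounded gK1 => //; exact: continuous_L2].
    by apply: eq_Rintegral => x _; rewrite mulrBl.
  have E3 : \int[mu]_(x in B) (partial i (eta k) x * g x) = - \int[mu]_(x in B) (eta k x * partial i g x).
    rewrite (_ : \int[mu]_(x in B) (eta k x * partial i g x) =
      \int[mu]_(x in B) (partial i g x * eta k x)); last by apply: eq_Rintegral => x _; rewrite mulrC.
    by rewrite -E; apply: eq_Rintegral => x _; rewrite mulrC.
  by rewrite E1 E2 E3; ring.
apply: (le_trans (ler_normD _ _)).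
have b1 := L2_mul_bounded_le (L1 k) mdg gK2 del0.
have b2 := L2_mul_bounded_le (L2' k) mg gK1 del0.
have sq I : I <= del ^+ 2 -> del * om + del^-1 * I <= del * (om + 1).
  by move=> HI; rewrite mulrDr mulr1 lerD2l ler_pdivrMl// -expr2.
have delE : del * (om + 1) * (K1 + K2 + 1) = e by rewrite /del; field; rewrite !gt_eqF.
have {}b1 := le_trans b1 (ler_wpM2l K20 (sq _ Sk1)).
have {}b2 := le_trans b2 (ler_wpM2l K10 (sq _ Sk2)).
apply: (le_trans (lerD b1 b2)); rewrite -delE.
have : 0 <= del * (om + 1) by rewrite mulr_ge0// ltW.
by move: (del * (om + 1)) => z z0; nra.
Unshelve. all: by end_near. Qed.

End C1_functions.

(** * Smoothness of radial functions *)

Section radial_functions.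
Context {R : realType} {n : nat}.
Implicit Types (x : 'rV[R]_n) (g d : R -> R).

(** [enorm] is not differentiable at the origin, so differentiability of a radial function there is
    drawn from quadratic flatness, which forces the differential to be 0. *)
Lemma differentiable_at0 (f : 'rV[R]_n -> R) (M del : R) : 0 < del -> 0 <= M ->
  (forall x, `|x| < del -> `|f x - f 0| <= M * `|x| ^+ 2) ->
  differentiable f (0 : 'rV[R]_n) /\ forall v, 'D_v f 0 = 0.
Proof.
move=> del0 M0 H.
have E : f \o shift (0 : 'rV[R]_n) = cst (f 0) + \0 +o_ (0 : 'rV[R]_n) id.
  apply/eqaddoP => e e0; near=> x.
  have -> : (f \o shift 0 - (cst (f 0) + \0)) x = f x - f 0.
    by rewrite !fctE /= !addr0.
  apply: (le_trans (H x _)).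
    by near: x; apply/nbhs_ballP; exists del => //= y; rewrite -ball_normE/= sub0r normrN.
  rewrite expr2 mulrA ler_wpM2r//=.
  have xe : `|x| < e / (M + 1).
    near: x; apply/nbhs_ballP; exists (e / (M + 1)) => /=; first by rewrite divr_gt0// ltr_wpDl.
    by move=> y; rewrite -ball_normE/= sub0r normrN.
  apply: (@le_trans _ _ ((M + 1) * `|x|)); first by rewrite ler_wpM2r// lerDl.
  by rewrite mulrC -ler_pdivlMr ?ltr_wpDl// ltW.
have d0 : 'd f (0 : 'rV[R]_n) = \0 :> ('rV[R]_n -> R).
  by apply: diff_unique => //; exact: cst_continuous.
have df : differentiable f (0 : 'rV[R]_n).
  by apply/diff_locallyP; rewrite d0; split => //; exact: cst_continuous.
by split=> // v; rewrite deriveE// d0.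
Unshelve. all: by end_near. Qed.

Lemma is_derive_dotr x v : is_derive x v (fun y => dotr y y) (2 * dotr x v).
Proof.
have H (j : 'I_n) : is_derive x v (fun y : 'rV[R]_n => y 0 j * y 0 j) (2 * (x 0 j * v 0 j)).
  have dc : differentiable (fun y : 'rV[R]_n => y 0 j) x by exact: differentiable_coord.
  have D : is_derive x v (fun y : 'rV[R]_n => y 0 j) (v 0 j).
    split; first exact: diff_derivable.
    apply: cvg_lim => //; apply: cvg_near_cst; rewrite near_withinE; apply: nearW => h h0.
    by rewrite /= !mxE addrK /GRing.scale/= mulKf.
  have := is_deriveM D D; rewrite /GRing.scale/= => H.
  by rewrite mulr_natl mulr2n; exact: H.
rewrite /dotr mulr_sumr.
rewrite (_ : (fun y : 'rV[R]_n => _) = \sum_i (fun y : 'rV[R]_n => y 0 i * y 0 i)).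
  exact: is_derive_sum.
by apply/funext => y; rewrite fct_sumE.
Qed.

Lemma differentiable_dotr x : differentiable (fun y : 'rV[R]_n => dotr y y) x.
Proof.
rewrite /dotr (_ : (fun y : 'rV[R]_n => _) = \sum_i (fun y : 'rV[R]_n => y 0 i * y 0 i)).
  apply: differentiable_sum => j.
  by apply: differentiableM; exact: differentiable_coord.
by apply/funext => y; rewrite fct_sumE.
Qed.

Lemma differentiable_comp_dotr (k : R -> R) dk x v : is_derive (dotr x x) 1 k dk ->
  differentiable (fun y : 'rV[R]_n => k (dotr y y)) x /\
  'D_v (fun y : 'rV[R]_n => k (dotr y y)) x = dk * (2 * dotr x v).
Proof.
move=> [/derivable1_diffP dkx dkE].
have dd := differentiable_dotr x.
have dc : differentiable (k \o (fun y : 'rV[R]_n => dotr y y)) x by exact: differentiable_comp.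
split=> //.
rewrite deriveE// diff_comp//=.
have -> : 'd (fun y : 'rV[R]_n => dotr y y) x v = 2 * dotr x v.
  by rewrite -deriveE//; have [] := is_derive_dotr x v.
rewrite diff1E//= /GRing.scale/= mulrC; congr (_ * _).
by rewrite derive1E.
Qed.

(** Away from the origin this is the chain rule for the square root of the polynomial [dotr x x]. At
    the origin, [|d r| <= C * r] yields quadratic flatness and the continuity of the partial
    derivatives. *)
Lemma C1_radial g d (C del : R) : continuous g ->
  (forall r : R, 0 < r -> is_derive r 1 g (d r)) ->
  (forall r : R, 0 < r -> {for r, continuous d}) -> 0 < del -> 0 <= C ->
  (forall r : R, 0 < r < del -> `|d r| <= C * r) ->
  C1 (g \o enorm : 'rV[R]_n -> R) /\
  forall i x, partial i (g \o enorm) x = d (enorm x) * (x 0 i / enorm x).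
Proof.
move=> cg dg cd del0 C0 Cd.
have pos x : x != 0 -> 0 < enorm x.
  move=> x0; rewrite lt_neqAle enorm_ge0 andbT; apply/eqP => /esym/enorm_eq0/eqP.
  by rewrite (negbTE x0).
have Dpos x v : x != 0 -> differentiable (g \o enorm) x /\
    'D_v (g \o enorm) x = d (enorm x) * (dotr x v / enorm x).
  move=> x0; have e0 := pos x x0.
  have d0 : 0 < dotr x x by rewrite -enorm_sqr exprn_gt0.
  have H : is_derive (dotr x x) 1 (g \o Num.sqrt) (d (enorm x) * (2 * enorm x)^-1).
    apply: is_derive1_comp; first exact: dg.
    exact: is_derive1_sqrt.
  have [dF DF] := differentiable_comp_dotr v H; split => //.
  rewrite [LHS]DF.
  by field; rewrite gt_eqF.
(* The factor [n + 1] compares norms: [enorm x] is at most [n + 1] times the sup norm of [x]. *)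
have g0 x : `|x| < del / (n%:R + 1) ->
    `|(g \o enorm) x - (g \o enorm) (0 : 'rV[R]_n)| <= (C * n%:R) * `|x| ^+ 2.
  rewrite ltr_pdivlMr ?ltr_wpDl// => xdel.
  have edel : enorm x < del.
    apply: le_lt_trans xdel; rewrite -(@ler_pXn2r _ 2) ?nnegrE ?enorm_ge0 ?mulr_ge0// ?addr_ge0//.
    rewrite enorm_sqr (le_trans (dotr_le_norm x))// exprMn mulrC ler_wpM2l ?sqr_ge0//.
    have : 0 <= n%:R :> R by []. 
    by move: (n%:R : R) => t t0; rewrite expr2; nra.
  rewrite /= enorm0.
  have [x0|x0] := eqVneq x 0; first by rewrite x0 enorm0 subrr normr0 !mulr_ge0.
  have dg' r : r \in `]0, enorm x[ -> is_derive r 1 g (d r).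
    by rewrite in_itv/= => /andP[r0 _]; exact: dg.
  have [c] := @MVT R g d 0 (enorm x) (pos x x0) dg' (continuous_subspaceT cg).
  rewrite in_itv/= subr0 => /andP[c0 cx] ->; rewrite normrM (gtr0_norm (pos x x0)).
  apply: (@le_trans _ _ (C * enorm x * enorm x)).
    rewrite ler_wpM2r ?enorm_ge0// (le_trans (Cd c _)) ?c0 ?(lt_trans cx)//.
    by rewrite ler_wpM2l// ltW.
  by rewrite -!mulrA -expr2 enorm_sqr ler_wpM2l// dotr_le_norm.
have [D0 D0'] : differentiable (g \o enorm) (0 : 'rV[R]_n) /\ forall v, 'D_v (g \o enorm) (0 : 'rV[R]_n) = 0.
  apply: differentiable_at0 g0; first by rewrite divr_gt0// ltr_wpDl.
  by rewrite mulr_ge0.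
have P i x : partial i (g \o enorm) x = d (enorm x) * (x 0 i / enorm x).
  have [->|x0] := eqVneq x 0; first by rewrite /partial D0' mxE mul0r mulr0.
  have [_] := Dpos x (delta_mx 0 i) x0; rewrite /partial => ->; congr (_ * (_ / _)).
  rewrite /dotr (bigD1 i)//= big1 ?addr0 => [|j ji]; first by rewrite !mxE !eqxx mulr1.
  by rewrite !mxE (negbTE ji) andbF mulr0.
split=> //; split=> [x|i].
  by have [->//|x0] := eqVneq x 0; have [] := Dpos x 0 x0.
rewrite (_ : partial i (g \o enorm) = fun x => d (enorm x) * (x 0 i / enorm x)); last first.
  by apply/funext => x; exact: P.
move=> x; have [->|x0] := eqVneq x 0; last first.
  have e0 := pos x x0.
  have c1 : {for x, continuous (fun y : 'rV[R]_n => d (enorm y))}.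
    by apply: continuous_comp; [exact: continuous_enorm|exact: cd].
  have c2 : {for x, continuous (fun y : 'rV[R]_n => (enorm y)^-1)}.
    apply: continuous_comp; first exact: continuous_enorm.
    by apply: inv_continuous; rewrite gt_eqF.
  exact: (cvgM c1 (cvgM (@coord_continuous R 1 n 0 i x) c2)).
rewrite /continuous_at mxE mul0r mulr0; apply/(@cvgrPdist_le _ _ _ (nbhs (0 : 'rV[R]_n))) => e e0.
have m0 : 0 < Num.min del (e / (C + 1)) by rewrite lt_min del0 divr_gt0// ltr_wpDl.
have := open_nbhs_nbhs (conj (@open_eball R n (Num.min del (e / (C + 1)))) (_ : eball _ 0)).
rewrite /eball/= enorm0 => /(_ m0); apply: filterS => y /=; rewrite lt_min => /andP[ydel ye].
rewrite sub0r normrN; have [->|y0] := eqVneq y 0; first by rewrite mxE mul0r mulr0 normr0 ltW.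
have e0' := pos y y0.
have dy : `|d (enorm y)| <= C * enorm y by apply: Cd; rewrite e0'.
rewrite normrM normrM normfV (gtr0_norm e0').
apply: (@le_trans _ _ (C * enorm y * 1)).
  apply: ler_pM => //; first by rewrite mulr_ge0// invr_ge0 ltW.
  by rewrite ler_pdivrMr// mul1r coord_le_enorm.
rewrite mulr1 (@le_trans _ _ ((C + 1) * enorm y)) ?ler_wpM2r ?enorm_ge0 ?lerDl//.
by rewrite mulrC -ler_pdivlMr ?ltr_wpDl// ltW.
Qed.

End radial_functions.

(** * Antiderivatives on the line *)

Section antiderivative.
Context {R : realType}.
Implicit Types (f g k : R -> R) (x d : R).

(** Integration starts at -1, so every [x > -1] is interior to an interval of integrability; since
    [k] and [K] vanish up to 0, no one-sided derivative arises there. *)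
Lemma antiderivative k : continuous k -> (forall s, s <= 0 -> k s = 0) ->
  exists K : R -> R, (forall s, s <= 0 -> K s = 0) /\ forall x : R, is_derive x 1 K (k x).
Proof.
move=> ck k0; pose K x := \int[lebesgue_measure]_(t in `[(-1), x]) k t.
have K0 s : s <= 0 -> K s = 0.
  move=> s0; rewrite /K /Rintegral integral0_eq// => t.
  by rewrite /= in_itv/= => /andP[_ ts]; rewrite k0// (le_trans ts).
exists K; split=> // x; have [x1|x1] := ltP (-1) x; last first.
  have x0 : x < 0 by apply: le_lt_trans x1 _; rewrite ltrN10.
  rewrite k0 ?ltW//; have H0 := is_derive_cst (0 : R) x 1.
  apply: (is_derive_near (_ : 0 < - x) _ H0); first by rewrite oppr_gt0.
  move=> y; rewrite ltr_norml => /andP[_]; rewrite ltrBlDr addNr => y0.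
  by rewrite K0// ltW.
have ik : lebesgue_measure.-integrable `[(-1), x + 1] (EFin \o k).
  apply: continuous_compact_integrable; first exact: segment_compact.
  exact: continuous_subspaceT.
have xx1 : x < x + 1 by rewrite ltrDl.
have [dK KE] := @continuous_FTC1_closed R k (-1) x (x + 1) xx1 ik x1 (ck x).
by apply: (DeriveDef dK); rewrite -KE derive1E.
Qed.

Lemma continuous_clamp (a b : R) : continuous (fun s : R => Num.max a (Num.min b s)).
Proof.
move=> s; apply: (@continuous_max R R (fun=> a) (fun s => Num.min b s)).
  exact: cvg_cst.
by apply: (@continuous_min R R (fun=> b) id); [exact: cvg_cst|exact: cvg_id].
Qed.

Lemma is_derive_eq0_const f (a b : R) : a <= b ->
  (forall x, a < x < b -> is_derive x 1 f 0) -> {within `[a, b], continuous f} -> f a = f b.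
Proof.
move=> ab df cf; apply/eqP; rewrite eq_le (is_derive_ge0_le ab df)//=.
rewrite -lerN2; apply: (@is_derive_ge0_le _ (fun x => - f x) (fun=> 0) a b ab) => //.
  by move=> x /df H; rewrite -oppr0; exact: is_deriveN.
by move=> x; apply: cvgN; exact: cf.
Qed.

Lemma is_derive_locally0 f x del : 0 < del -> (forall y, y < x + del -> f y = 0) -> is_derive x 1 f 0.
Proof.
move=> del0 H; have H0 := is_derive_cst (0 : R) x 1.
by apply: (is_derive_near del0 _ H0) => y; rewrite ltr_norml => /andP[_]; rewrite ltrBlDl => /H.
Qed.

Lemma is_deriveM_eq f g x df dg d : is_derive x 1 f df -> is_derive x 1 g dg ->
  d = df * g x + f x * dg -> is_derive x 1 (fun y => f y * g y) d.
Proof.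
move=> Hf Hg ->; have := is_deriveM Hf Hg.
by rewrite /GRing.scale/= addrC [g x * df]mulrC.
Qed.

Lemma is_derive_exprVn (n : nat) x : 0 < x ->
  is_derive x 1 (fun y => (y ^+ n)^-1) (- (n%:R * (x ^+ n.+1)^-1)).
Proof.
move=> x0; have xn : x ^+ n != 0 by rewrite expf_neq0// gt_eqF.
have := @is_deriveV R (fun y => y ^+ n) x _ 1 xn (is_derive_exprn n x).
rewrite /GRing.scale/= => H.
rewrite (_ : - (n%:R * _) = - (x ^+ n) ^- 2 * (n%:R * x ^+ n.-1)); first exact: H.
case: n {H} xn => [|n] xn; first by rewrite !mul0r mulr0 oppr0.
by rewrite !exprS/=; field; rewrite expf_neq0 ?gt_eqF.
Qed.

End antiderivative.

(** * Radial vector fields and their divergence *)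

Section radial_vector_fields.
Context {R : realType} {n : nat}.
Hypothesis n_gt0 : (0 < n)%N.
Local Notation mu := (lebesgue_rV R n).
Local Notation B := (eball 1 : set 'rV[R]_n).
Local Notation omega := (@unit_volume R n).
Variables (H dH : R -> R) (p : R).
Hypotheses (p_gt0 : 0 < p) (cdH : continuous dH) (derH : forall s : R, is_derive s 1 H (dH s)).
Hypotheses (H_eq0 : forall s, s <= p -> H s = 0) (dH_eq0 : forall s, s <= p -> dH s = 0).

(* The power n makes the divergence of the field |x|^(1-n) H'(|x|), free of H. *)
Definition radial_coef s := H s * (s ^+ n)^-1.
Definition radial_field (i : 'I_n) (x : 'rV[R]_n) := radial_coef (enorm x) * x 0 i.

Lemma continuous_H : continuous H.
Proof. by move=> s; exact: is_derive_continuous (derH s). Qed.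

(** This is s^(1-n) frozen below [p], hence continuous and positive on the whole line. It is
    multiplied by functions that vanish up to [p], where the freezing is therefore invisible. *)
Definition cutpow (s : R) : R := (Num.max p s ^+ n.-1)^-1.

Lemma cutpow_gt0 s : 0 < cutpow s.
Proof. by rewrite invr_gt0 exprn_gt0// lt_max p_gt0. Qed.

Lemma continuous_cutpow : continuous cutpow.
Proof.
move=> s; apply: cvgV; first by rewrite gt_eqF// exprn_gt0// lt_max p_gt0.
apply: (@continuous_comp _ _ _ (fun s : R => Num.max p s) (fun t : R => t ^+ n.-1));
  last exact: exprn_continuous.
by apply: continuous_max; [exact: cvg_cst|exact: cvg_id].
Qed.

Definition radial_dcoef s := dH s * (s ^+ n)^-1 - H s * (n%:R * (s ^+ n.+1)^-1).

Lemma is_derive_radial_coef (s : R) : is_derive s 1 radial_coef (radial_dcoef s).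
Proof.
have [sp|ps] := ltP s p.
  rewrite /radial_dcoef H_eq0 ?dH_eq0 ?ltW// !mul0r subrr.
  apply: (@is_derive_locally0 _ _ _ (p - s)); first by rewrite subr_gt0.
  by move=> y; rewrite addrC subrK /radial_coef => yp; rewrite H_eq0 ?mul0r// ltW.
apply: (is_deriveM_eq (derH s) (is_derive_exprVn n (lt_le_trans p_gt0 ps))).
by rewrite /radial_dcoef mulrN.
Qed.

Lemma C1_coord (i : 'I_n) : C1 (fun x : 'rV[R]_n => x 0 i) /\
  forall j x, partial j (fun x : 'rV[R]_n => x 0 i) x = (i == j)%:R.
Proof.
have P j x : partial j (fun x : 'rV[R]_n => x 0 i) x = (i == j)%:R.
  apply: cvg_lim => //; apply: cvg_near_cst; rewrite near_withinE; apply: nearW => h h0.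
  by rewrite /= !mxE addrK /GRing.scale/= mulKf// eqxx.
split=> //; split=> [x|j]; first exact: differentiable_coord.
rewrite (_ : partial j _ = cst (i == j)%:R); first exact: cst_continuous.
by apply/funext => x; rewrite P.
Qed.

Lemma C1_radial_coef : C1 (radial_coef \o enorm : 'rV[R]_n -> R) /\
  forall i (x : 'rV[R]_n), partial i (radial_coef \o enorm) x = radial_dcoef (enorm x) * (x 0 i / enorm x).
Proof.
apply: (@C1_radial _ _ _ _ 0 p) => [s|r r0|r r0|//|//|r /andP[r0 rp]].
- exact: is_derive_continuous (is_derive_radial_coef s).
- exact: is_derive_radial_coef.
- have rn k : {for r, continuous (fun s : R => (s ^+ k)^-1)}.
    apply: cvgV; first by rewrite expf_neq0// gt_eqF.
    exact: exprn_continuous.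
  have c1 := cvgM (@cdH r) (rn n).
  have c2 : {for r, continuous (fun s : R => n%:R * (s ^+ n.+1)^-1)}.
    by apply: cvgM; [exact: cvg_cst|exact: rn].
  exact: (cvgB (c1 _) (cvgM (@continuous_H r) c2)).
- by rewrite /radial_dcoef (H_eq0 (ltW rp)) (dH_eq0 (ltW rp)) !mul0r subrr normr0.
Qed.

Lemma C1_radial_field i : C1 (radial_field i).
Proof. by apply: C1M; [case: C1_radial_coef|case: (C1_coord i)]. Qed.

Lemma divergence_radial_field x :
  \sum_i partial i (radial_field i) x = dH (enorm x) * cutpow (enorm x).
Proof.
have [CK PK] := C1_radial_coef.
under eq_bigr => i _.
  have [Cc Pc] := C1_coord i.
  rewrite (partialM _ _ CK Cc) Pc eqxx mulr1 PK -mulrA -[_ / _ * _]mulrAC -[x 0 i * x 0 i]/(x 0 i * x 0 i).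
  over.
rewrite big_split/= sumr_const card_ord -mulr_sumr -mulr_suml -/(dotr x x) -enorm_sqr.
have [xp|px] := leP (enorm x) p.
  by rewrite /radial_coef /radial_dcoef H_eq0 ?dH_eq0// !mul0r mul0rn subrr mul0r addr0.
have e0 := lt_trans p_gt0 px.
rewrite /cutpow max_r ?ltW// /radial_coef /radial_dcoef -mulr_natl.
move: (enorm x) e0 => t t0.
have En : t ^+ n = t * t ^+ n.-1 by rewrite -exprS prednK.
rewrite exprS En; field.
by rewrite expf_neq0 gt_eqF.
Qed.

Lemma H10_radial_divergence phi G : H10 B phi G ->
  \int[mu]_(x in B) (phi x * (dH (enorm x) * cutpow (enorm x))) =
  - \sum_i \int[mu]_(x in B) (G x 0 i * radial_field i x).
Proof.
move=> HG; have mB := @measurable_eball R n 1.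
have [[Lphi _ _] _] := HG.
rewrite -sumrN; under eq_bigr do rewrite -(H10_by_parts _ HG (C1_radial_field _)).
have I i : mu.-integrable B (EFin \o (fun x => phi x * partial i (radial_field i) x)).
  have c : continuous (partial i (radial_field i)) by case: (C1_radial_field i).
  have [K _ HK] := continuous_bounded_eball c.
  by apply: L2_mul_bounded HK => //; exact: measurable_continuous.
transitivity (fine (\sum_i \int[mu]_(x in B) (phi x * partial i (radial_field i) x)%:E)%E).
  rewrite -integral_sum//; congr fine; apply: eq_integral => x _.
  by rewrite sumEFin -divergence_radial_field mulr_sumr.
rewrite /Rintegral (eq_bigr (fun i =>
    (fine (\int[mu]_(x in B) (phi x * partial i (radial_field i) x)%:E)%E)%:E)) ?sumEFin//.
by move=> i _; rewrite fineK//; exact: (integrable_fin_num mB (I i)).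
Qed.

(** The field whose divergence is explicit is also a gradient. Its integral against [G] therefore
    occurs both in the divergence identity for [phi] and in the weak equation tested with
    [k (enorm x)]. *)
Lemma radial_field_gradient (k : R -> R) : continuous k ->
  (forall s : R, is_derive s 1 k (H s * cutpow s)) ->
  C1 (k \o enorm : 'rV[R]_n -> R) /\ forall i (x : 'rV[R]_n), partial i (k \o enorm) x = radial_field i x.
Proof.
move=> ck dk.
have [Ck Pk] : C1 (k \o enorm : 'rV[R]_n -> R) /\
    forall i (x : 'rV[R]_n), partial i (k \o enorm) x = H (enorm x) * cutpow (enorm x) * (x 0 i / enorm x).
  apply: (@C1_radial _ _ k (fun s => H s * cutpow s) 0 p) => [//|r _|//|//|r /andP[_ rp]].
  - exact: (cvgM (@continuous_H r) (@continuous_cutpow r)).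
  - have -> : H r = 0 by apply: H_eq0; exact: ltW.
    by rewrite !mul0r normr0.
split=> // i x; rewrite Pk /radial_field /radial_coef.
have [xp|px] := leP (enorm x) p; first by rewrite H_eq0// !mul0r.
rewrite /cutpow max_r ?ltW//; have := lt_trans p_gt0 px.
move: (enorm x) => t t0.
have En : t ^+ n = t * t ^+ n.-1 by rewrite -exprS prednK.
rewrite En; field.
by rewrite expf_neq0 gt_eqF.
Qed.

Lemma cutpow_cancel r : 0 < r -> r ^+ n.-1 * (dH r * cutpow r) = dH r.
Proof.
move=> r0; have [rp|pr] := leP r p; first by rewrite dH_eq0// mul0r mulr0.
by rewrite /cutpow max_r ?ltW//; field; rewrite expf_neq0 ?gt_eqF.
Qed.

End radial_vector_fields.

(** * The equation satisfied by a radial profile *)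

Section radial_equation.
Context {R : realType} {n : nat}.
Hypothesis n_gt0 : (0 < n)%N.
Local Notation mu := (lebesgue_rV R n).
Local Notation B := (eball 1 : set 'rV[R]_n).
Local Notation omega := (@unit_volume R n).
Variables (V : 'rV[R]_n -> R) (v0 v1 : R).
Hypotheses (mV : measurable_fun B V) (v0_gt0 : 0 < v0).
Hypothesis V_bounds : forall x, B x -> v0 <= V x <= v1.

Definition source (u : R -> R) (m : R) (x : 'rV[R]_n) := V x * (u (enorm x) - m).
Definition flux u m r := ball_integral (source u m) r.

Lemma weighted_radial_bounded k : continuous k ->
  measurable_fun B (fun x => V x * k (enorm x)) /\
  exists C, forall x, B x -> `|V x * k (enorm x)| <= C.
Proof.
move=> ck; split; first by apply: measurable_funM => //; exact: measurable_radial.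
have [K K0 hK] := continuous_bounded_segment ler01 ck.
exists (v1 * K) => x Bx; have /andP[Vx0 Vx1] := V_bounds Bx.
rewrite normrM ger0_norm; last exact: le_trans (ltW v0_gt0) Vx0.
apply: ler_pM => //; first exact: le_trans (ltW v0_gt0) Vx0.
by apply: hK; rewrite enorm_ge0/= ltW.
Qed.

Lemma source_bounded u m : continuous u ->
  measurable_fun B (source u m) /\ exists C, forall x, B x -> `|source u m x| <= C.
Proof.
move=> cu; apply: (@weighted_radial_bounded (fun s => u s - m)).
by move=> s; apply: cvgB; [exact: cu|exact: cvg_cst].
Qed.

Lemma continuous_flux u m : continuous u -> forall r, 0 < r < 1 -> {for r, continuous (flux u m)}.
Proof.
move=> cu r r01; have [mh [C hC]] := source_bounded m cu.
have /continuous_within_itvP := continuous_ball_integral n_gt0 mh hC.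
by move=> /(_ ltr01)[+ _ _]; apply; rewrite in_itv.
Qed.

Lemma flux_le u m : continuous u -> exists2 C, 0 <= C & forall r, 0 <= r <= 1 -> `|flux u m r| <= C * r ^+ n.
Proof.
move=> cu; have [mh [C hC]] := source_bounded m cu.
have C0 := bound_ge0 hC; exists (C * omega) => [|r /andP[r0 r1]].
  by rewrite mulr_ge0// ltW// unit_volume_gt0.
have := @shell_integral_le _ _ n_gt0 (source u m) C 0 r mh (lexx 0) r0 r1.
rewrite expr0n (gtn_eqF n_gt0) subr0 (@eball_le0 R n 0 (lexx 0)) setD0 mulrA; apply.
by move=> x /(eball_sub r1) /hC.
Qed.

Lemma ball_integral0 (h : 'rV[R]_n -> R) : ball_integral h 0 = 0.
Proof. by rewrite /ball_integral eball_le0// Rintegral_set0. Qed.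

(* First integral of the radial equation: the flux of the gradient through the
   sphere of radius r is c r^(n-1) u'(r), with c = n omega the area of the unit
   sphere. *)
Definition radial_solution (u : R -> R) (m la : R) :=
  [/\ continuous u, u 1 = 0, flux u m 1 = 0 &
   forall r : R, 0 < r < 1 -> is_derive r 1 u (- (la / (omega * n%:R)) * (flux u m r * (r ^+ n.-1)^-1))].

Lemma clamped_flux u m p q : continuous u -> 0 < p -> p < q -> q < 1 ->
  exists z : R -> R, [/\ continuous z, forall s, s <= 0 -> z s = 0 &
    forall s, p <= s <= q -> z s = flux u m s * (s ^+ n.-1)^-1].
Proof.
move=> cu p0 pq q1.
pose cl (s : R) := Num.max p (Num.min q s).
have cl01 s : 0 < cl s < 1.
  by rewrite lt_max p0/= gt_max (lt_trans pq)//= gt_min q1.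
have ccl : continuous cl := @continuous_clamp R p q.
pose rho (s : R) := Num.max 0 (Num.min 1 (s / p)).
have crho : continuous rho.
  move=> s; apply: (@continuous_comp _ _ _ (fun s : R => s / p) (fun t : R => Num.max 0 (Num.min 1 t))).
    by apply: cvgM; [exact: cvg_id|exact: cvg_cst].
  exact: continuous_clamp.
exists (fun s => flux u m (cl s) * (cl s ^+ n.-1)^-1 * rho s); split.
- move=> s; have /andP[cl0 _] := cl01 s; apply: cvgM; last exact: crho.
  apply: cvgM.
    apply: (@continuous_comp _ _ _ cl (flux u m)); first exact: ccl.
    exact: continuous_flux.
  apply: cvgV; first by rewrite expf_neq0// gt_eqF.
  apply: (@continuous_comp _ _ _ cl (fun t : R => t ^+ n.-1)); first exact: ccl.
  exact: exprn_continuous.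
- move=> s s0; rewrite /rho max_l ?mulr0//.
  by rewrite ge_min orbC pmulr_lle0 ?invr_gt0// s0.
- move=> s /andP[ps sq]; rewrite /rho /cl min_r// max_r//.
  rewrite min_l; last by rewrite ler_pdivlMr// mul1r.
  by rewrite max_r// mulr1.
Qed.

Section profile.
Variables (phi : 'rV[R]_n -> R) (G : 'rV[R]_n -> 'rV[R]_n) (u : R -> R) (m la : R).
Hypotheses (HG : H10 B phi G) (cu : continuous u).
Hypothesis phi_u : {ae mu, forall x, B x -> phi x = u (enorm x)}.
Hypothesis weak_eq : forall eta, C1c B eta ->
  \int[mu]_(x in B) dotr (G x) (gradient eta x) =
  la * \int[mu]_(x in B) (source u m x * eta x).
Hypothesis flux1 : flux u m 1 = 0.

Lemma ae_eq_Rintegral (f g : 'rV[R]_n -> R) : measurable_fun B f -> measurable_fun B g ->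
  {ae mu, forall x, B x -> f x = g x} -> \int[mu]_(x in B) f x = \int[mu]_(x in B) g x.
Proof.
move=> mf mg fg; congr fine; apply: ae_eq_integral.
- exact: measurable_eball.
- exact/measurable_EFinP.
- exact/measurable_EFinP.
- by apply: filterS fg => x H Bx; rewrite H.
Qed.

Lemma radial_divergence (H dH : R -> R) (p : R) : 0 < p -> continuous dH ->
  (forall s : R, is_derive s 1 H (dH s)) ->
  (forall s, s <= p -> H s = 0) -> (forall s, s <= p -> dH s = 0) ->
  \int[mu]_(x in B) (u (enorm x) * (dH (enorm x) * @cutpow R n p (enorm x))) =
  - \sum_i \int[mu]_(x in B) (G x 0 i * radial_field H i x).
Proof.
move=> p0 cdH dH1 H0 dH0.
rewrite -(H10_radial_divergence n_gt0 p0 cdH dH1 H0 dH0 HG).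
have [[[mphi _] _ _] _] := HG.
have ck : continuous (fun s => dH s * @cutpow R n p s).
  by apply: continuous_mul => //; exact: continuous_cutpow.
apply: ae_eq_Rintegral.
- by apply: measurable_funM; [exact: (@measurable_radial R n B _ cu)|exact: (@measurable_radial R n B _ ck)].
- by apply: measurable_funM => //; exact: (@measurable_radial R n B _ ck).
- by apply: filterS phi_u => x H1 Bx; rewrite H1.
Qed.

(** The weak equation tested with a radial function, rewritten so that the weak gradient [G] no
    longer occurs and only the profile [u] remains. *)
Lemma weak_radial (H dH : R -> R) (p q : R) : 0 < p -> p < q -> q < 1 -> continuous dH ->
  (forall s : R, is_derive s 1 H (dH s)) ->
  (forall s, s <= p -> H s = 0) -> (forall s, s <= p -> dH s = 0) ->
  (forall s, q <= s -> H s = 0) ->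
  exists k : R -> R, [/\ continuous k, forall s : R, is_derive s 1 k (H s * @cutpow R n p s),
    k 1 = 0 &
  \int[mu]_(x in B) (u (enorm x) * (dH (enorm x) * @cutpow R n p (enorm x))) =
  - (la * \int[mu]_(x in B) (source u m x * k (enorm x)))].
Proof.
move=> p0 pq q1 cdH dH1 H0 dH0 H1.
have cH : continuous H by move=> s; exact: is_derive_continuous (dH1 s).
have cHc : continuous (fun s => H s * @cutpow R n p s).
  by apply: continuous_mul => //; exact: continuous_cutpow.
have [|k0 [k00 dk0]] := antiderivative cHc.
  by move=> s s0; rewrite H0 ?mul0r// (le_trans s0)// ltW.
have ck0 : continuous k0 by move=> s; exact: is_derive_continuous (dk0 s).
(* [H] vanishes beyond [q], so [k0] is constant there; removing this constant leaves a test function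
   supported in [enorm x <= q]. *)
pose k s := k0 s - k0 q.
have dk (s : R) : is_derive s 1 k (H s * @cutpow R n p s).
  by rewrite -[X in is_derive _ _ _ X]subr0; apply: is_deriveB.
have ck : continuous k by move=> s; exact: is_derive_continuous (dk s).
have kq s : q <= s -> k s = 0.
  move=> qs; rewrite /k; apply/eqP; rewrite subr_eq0 eq_sym; apply/eqP.
  apply: (is_derive_eq0_const qs) => [x /andP[qx xs]|]; last exact: continuous_subspaceT.
  by have := dk0 x; rewrite H1 ?mul0r// ltW.
exists k; split => //; first by apply: kq; exact: ltW.
rewrite (radial_divergence p0 cdH dH1 H0 dH0); congr (- _).
have [Ck Pk] := radial_field_gradient n_gt0 p0 dH1 H0 ck dk.
have Ckc : C1c B (k \o enorm).
  case: Ck => Ck1 Ck2; split=> //; exists [set x | enorm x <= q]; split.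
  - apply: (@subclosed_compact _ _ [set x : 'rV[R]_n | enorm x <= 1]).
    + rewrite (_ : mkset _ = enorm @^-1` [set t | t <= q])//.
      by apply: closed_comp => [x _|]; [exact: continuous_enorm|exact: closed_le].
    + exact: compact_eball_closure.
    + by move=> x /= xq; rewrite (le_trans xq)// ltW.
  - by move=> x /= xq; rewrite /eball/= (le_lt_trans xq).
  - by move=> x /= /negP; rewrite -ltNge => /ltW; exact: kq.
rewrite -(weak_eq Ckc).
have mB := @measurable_eball R n 1.
have [[_ LG _] _] := HG.
have I i : mu.-integrable B (EFin \o (fun x => G x 0 i * radial_field H i x)).
  have c : continuous (@radial_field R n H i).
    by apply/C1_continuous; exact: C1_radial_field p0 cdH dH1 H0 dH0 i.
  have [K _ HK] := continuous_bounded_eball c.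
  by apply: L2_mul_bounded HK => //; exact: measurable_continuous.
transitivity (fine (\sum_i \int[mu]_(x in B) (G x 0 i * radial_field H i x)%:E)%E).
  rewrite /Rintegral (eq_bigr (fun i =>
    (fine (\int[mu]_(x in B) (G x 0 i * radial_field H i x)%:E)%E)%:E)) ?sumEFin//.
  by move=> i _; rewrite fineK//; exact: (integrable_fin_num mB (I i)).
rewrite -integral_sum//; congr fine; apply: eq_integral => x _.
rewrite sumEFin /dotr; congr EFin; apply: eq_bigr => i _.
by rewrite mxE Pk.
Qed.

Local Notation c := (omega * n%:R).

Lemma polar_constant_gt0 : 0 < c.
Proof. by rewrite mulr_gt0 ?unit_volume_gt0// ltr0n. Qed.

(* du Bois-Reymond: let U be a primitive of the expected derivative, b a bump on
   ]p, q[ and cbar the b-weighted mean of u - U. Testing with the primitive H of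
   (u - U - cbar) b makes the integral of (u - U - cbar)^2 b vanish. *)
Lemma profile_interior (r : R) : 0 < r < 1 ->
  is_derive r 1 u (- (la / c) * (flux u m r * (r ^+ n.-1)^-1)).
Proof.
move=> /andP[r0 r1]; pose p := r / 2; pose q := (r + 1) / 2.
have p0 : 0 < p by rewrite divr_gt0.
have [pr rq] : p < r /\ r < q by rewrite /p /q; split; lra.
have pq := lt_trans pr rq; have q1 : q < 1 by rewrite /q; lra.
have [z [cz z0 zE]] := clamped_flux m cu p0 pq q1.
have [||U [U0 dU]] := @antiderivative R (fun s => - (la / c) * z s).
- by move=> s; apply: cvgM; [exact: cvg_cst|exact: cz].
- by move=> s s0; rewrite z0// mulr0.
have cU : continuous U by move=> s; exact: is_derive_continuous (dU s).
pose b (s : R) := Num.max 0 ((s - p) * (q - s)).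
have cb : continuous b.
  move=> s; apply: (@continuous_max R R (fun=> 0) (fun s => (s - p) * (q - s))); first exact: cvg_cst.
  by apply: cvgM; apply: cvgB; [exact: cvg_id|exact: cvg_cst|exact: cvg_cst|exact: cvg_id].
have b_ge0 s : 0 <= b s by rewrite le_max lexx.
have b_gt0 s : p < s < q -> 0 < b s.
  by move=> /andP[ps sq]; rewrite lt_max mulr_gt0 ?orbT// subr_gt0.
have b_eq0 s : s <= p \/ q <= s -> b s = 0.
  by move=> H; rewrite /b max_l//; case: H => H; nra.
pose D s := u s - U s.
have cD : continuous D by move=> s; apply: cvgB; [exact: cu|exact: cU].
have b_neg s : s <= 0 -> b s = 0 by move=> s0; rewrite b_eq0//; left; rewrite (le_trans s0)// ltW.
have [|A1 [A10 dA1]] := @antiderivative R (fun s => D s * b s) (continuous_mul cD cb).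
  by move=> s /b_neg ->; rewrite mulr0.
have [A2 [A20 dA2]] := antiderivative cb b_neg.
have cA1 : continuous A1 by move=> s; exact: is_derive_continuous (dA1 s).
have cA2 : continuous A2 by move=> s; exact: is_derive_continuous (dA2 s).
have A2q : 0 < A2 q.
  have A2p : A2 0 = A2 p.
    apply: (is_derive_eq0_const (ltW p0)); last exact: continuous_subspaceT.
    by move=> s /andP[_ sp]; have := dA2 s; rewrite b_eq0//; left; exact: ltW.
  rewrite A20// in A2p.
  have [s spq E] := @MVT R A2 b p q pq (fun s _ => dA2 s) (continuous_subspaceT cA2).
  rewrite -A2p subr0 in E; rewrite E mulr_gt0 ?subr_gt0// b_gt0//.
(* This value of [cbar] makes [H q = 0], so that [H] is supported in [p, q], as the test function
   requires. *)
pose cbar := A1 q / A2 q; pose H s := A1 s - cbar * A2 s; pose dH s := (D s - cbar) * b s.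
have dH1 (s : R) : is_derive s 1 H (dH s).
  rewrite /dH mulrBl; apply: is_deriveB; exact: is_deriveZ.
have cH : continuous H by move=> s; exact: is_derive_continuous (dH1 s).
have cdH : continuous dH.
  by apply: continuous_mul => // s; apply: cvgB; [exact: cD|exact: cvg_cst].
have dH0 s : s <= p -> dH s = 0 by move=> sp; rewrite /dH b_eq0 ?mulr0//; left.
have H0' s : s <= 0 -> H s = 0 by move=> s0; rewrite /H A10// A20// mulr0 subrr.
have H0 s : s <= p -> H s = 0.
  move=> sp; have [s0|/ltW s0] := leP s 0; first exact: H0'.
  rewrite -(H0' 0 (lexx 0)); apply/esym/(is_derive_eq0_const s0); last exact: continuous_subspaceT.
  by move=> t /andP[_ ts]; have := dH1 t; rewrite dH0// (le_trans (ltW ts)).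
have Hq : H q = 0 by rewrite /H /cbar divfK ?subrr// gt_eqF.
have H1 s : q <= s -> H s = 0.
  move=> qs; rewrite -Hq; apply/esym/(is_derive_eq0_const qs); last exact: continuous_subspaceT.
  by move=> t /andP[qt _]; have := dH1 t; rewrite /dH b_eq0 ?mulr0//; right; exact: ltW.
have [k [ck dk k1 E]] := weak_radial p0 pq q1 cdH dH1 H0 dH0 H1.
have [mh [C hC]] := source_bounded m cu.
pose K s := u s * (dH s * @cutpow R n p s).
have cK : continuous K.
  by apply: continuous_mul => //; apply: continuous_mul => //; exact: continuous_cutpow.
pose L s := ball_integral (fun x => source u m x * k (enorm x)) s - k s * flux u m s.
(* [T] is built to have derivative [c * ((D s - cbar) ^+ 2 * b s) >= 0]. At [s = 1] its first two
   terms cancel by the tested equation [E], and the other two vanish with [H] at both ends; so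
   [T 0 = T 1 = 0]. *)
pose T s := ball_integral (K \o enorm : 'rV[R]_n -> R) s + la * L s - c * (H s * U s) - c * cbar * H s.
have dT (s : R) : 0 < s < 1 -> is_derive s 1 T (c * ((D s - cbar) ^+ 2 * b s)).
  move=> /[dup] s01 /andP[s0 s1].
  have e1 := is_derive_radial n_gt0 cK s01.
  have e2 := is_deriveZ la (is_derive_layer_cake n_gt0 mh hC ck s01 (dk s)).
  have e3 := is_deriveZ c (is_deriveM_eq (dH1 s) (dU s) erefl).
  have e4 := is_deriveZ (c * cbar) (dH1 s).
  have [d5 v5] := is_deriveB (is_deriveB (is_deriveD e1 e2) e3) e4.
  apply: (DeriveDef (d5 : derivable T s 1)); apply: (etrans (v5 : 'D_1 T s = _)).
  rewrite /GRing.scale/= /K.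
  have F1 : s ^+ n.-1 * (dH s * @cutpow R n p s) = dH s  by apply: cutpow_cancel.
  have F2 : H s * z s = H s * @cutpow R n p s * flux u m s.
    have [sp|ps] := leP s p; first by rewrite H0// !mul0r.
    have [qs|sq] := leP q s; first by rewrite H1// !mul0r.
    by rewrite zE ?ltW// /cutpow max_r ?ltW//; ring.
  rewrite -[ball_integral _ s]/(flux u m s).
  have -> : omega * n%:R * s ^+ n.-1 * (u s * (dH s * @cutpow R n p s)) =
     c * u s * (s ^+ n.-1 * (dH s * @cutpow R n p s)) by ring.
  have -> : c * (dH s * U s + H s * (- (la / c) * z s)) = c * (dH s * U s) - la * (H s * z s).
    by field; have := polar_constant_gt0; rewrite lt0r mulf_eq0 negb_or => /andP[/andP[-> ->]].
  by rewrite F1 F2 /dH /D; ring.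
have cT : {within `[0, 1], continuous T}.
  have bK : exists C, forall x : 'rV[R]_n, B x -> `|(K \o enorm) x| <= C.
    have [M _ HM] := continuous_bounded_segment ler01 cK.
    by exists M => x Bx; apply: HM; rewrite enorm_ge0/= ltW.
  have [M HM] := bK.
  have c1 := continuous_ball_integral n_gt0 (@measurable_radial R n B _ cK) HM.
  have c2 := continuous_layer_cake n_gt0 mh hC ck.
  move=> s; apply: cvgB; [apply: cvgB; [apply: cvgD|]|].
  - exact: c1.
  - by apply: cvgM; [exact: cvg_cst|exact: c2].
  - by apply: cvgM; [exact: cvg_cst|exact: (continuous_subspaceT (continuous_mul cH cU))].
  - by apply: cvgM; [exact: cvg_cst|exact: (continuous_subspaceT cH)].
have T0 : T 0 = 0.
  rewrite /T /L /flux !ball_integral0 H0'// !(mulr0, mul0r, subr0, addr0)//.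
have T1 : T 1 = 0.
  rewrite /T /L flux1 H1 ?ltW// k1 !(mulr0, mul0r, subr0)//.
  rewrite /ball_integral.
  rewrite -[X in X + _]/(\int[mu]_(x in B) (u (enorm x) * (dH (enorm x) * @cutpow R n p (enorm x)))).
  by rewrite E addNr.
have Tmon x y : 0 <= x -> x <= y -> y <= 1 -> T x <= T y.
  move=> x0 xy y1; apply: (is_derive_ge0_le xy (df := fun s => c * ((D s - cbar) ^+ 2 * b s))).
  - by move=> s /andP[xs sy]; apply: dT; rewrite (le_lt_trans x0)// (lt_le_trans sy).
  - by move=> s _; apply: mulr_ge0; [exact: ltW polar_constant_gt0|rewrite mulr_ge0// sqr_ge0].
  - apply: continuous_subspaceW cT => s /=; rewrite !in_itv/= => /andP[xs sy].
    by rewrite (le_trans x0)// (le_trans sy).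
(* A nondecreasing function with equal end values is constant; its derivative then vanishes, which
   forces [D = cbar] wherever [b > 0]. *)
have TE s : 0 <= s <= 1 -> T s = 0.
  move=> /andP[s0 s1]; apply/eqP; rewrite eq_le.
  by have := Tmon s 1 s0 s1 (lexx 1); have := Tmon 0 s (lexx 0) s0 s1; rewrite T0 T1 => -> ->.
have DE s : p < s < q -> D s = cbar.
  move=> /[dup] spq /andP[ps sq].
  have s0 := lt_trans p0 ps; have s1 := lt_trans sq q1.
  have d0 : is_derive s 1 T 0.
    have H2 := is_derive_cst (0 : R) s 1.
    have del0 : 0 < Num.min s (1 - s) by rewrite lt_min s0 subr_gt0.
    apply: (is_derive_near del0 _ H2) => y; rewrite lt_min !ltr_norml => /andP[/andP[y0 _] /andP[_ y1]].
    by rewrite TE//; apply/andP; split; lra.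
  have := dT s; rewrite s0 s1 => /(_ isT) [_]; have [_ ->] := d0 => /esym/eqP.
  by rewrite mulf_eq0 gt_eqF ?polar_constant_gt0//= mulf_eq0 [b s == 0]gt_eqF ?b_gt0// orbF sqrf_eq0 subr_eq0 => /eqP.
have del0 : 0 < Num.min (r - p) (q - r) by rewrite lt_min !subr_gt0 pr.
rewrite -zE; last by rewrite !ltW.
have dUc : is_derive r 1 (fun s => U s + cbar) (- (la / c) * z r).
  by rewrite -[X in is_derive _ _ _ X]addr0; apply: is_deriveD.
apply: (is_derive_near del0 _ dUc) => y; rewrite lt_min !ltr_norml => /andP[/andP[y0 _] /andP[_ y1]].
have pyq : p < y < q.
  by move: (p) (q) y0 y1 => p' q' y0 y1; apply/andP; split; lra.
by rewrite -(DE y pyq) /D addrC subrK.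
Qed.

(* Test with a radial field supported in the shell a < |x| < 1, where a = 1 - e:
   the side carrying u has order u(1) e^2, the side carrying G is o(e^2) as e -> 0. *)
Lemma profile_boundary : u 1 = 0.
Proof.
apply/eqP; apply: contraT => k0; set ka := u 1 in k0.
have mB := @measurable_eball R n 1; have c0 := polar_constant_gt0.
have [[_ LG _] _] := HG.
pose I i := \int[mu]_(x in B) (G x 0 i ^+ 2); pose S := \sum_i I i.
have I0 i : 0 <= I i by apply: Rintegral_ge0 => x _; exact: sqr_ge0.
have S0 : 0 <= S by exact: sumr_ge0.
(* The estimate will end in [|ka| * c / 2 <= t * S + N * e]. The choice of [t] and the last bound in
   [e] keep each term on the right at most [|ka| * c / 8]. *)
pose t : R := `|ka| * c / (8 * (S + 1)).
have ka0 : 0 < `|ka| by rewrite normr_gt0.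
have S1 : 0 < S + 1 by rewrite ltr_wpDl.
have kc0 : 0 < `|ka| * c by rewrite mulr_gt0.
have t0 : 0 < t by rewrite divr_gt0// mulr_gt0.
pose N : R := n%:R * 4 ^+ n * c / (2 * t).
have N0 : 0 <= N.
  apply: divr_ge0; last by rewrite mulr_ge0// ltW.
  by apply: mulr_ge0; [rewrite mulr_ge0// exprn_ge0|exact: ltW].
have [del del0 Hdel] : exists2 del : R, 0 < del & forall s, 1 - del < s <= 1 -> ka ^+ 2 / 2 <= ka * u s.
  have /cvgrPdist_le/(_ (`|ka| / 2)) := @cu 1.
  rewrite divr_gt0// => /(_ isT)/nbhs_ballP[del /= del0 H]; exists del => // s /andP[s0 s1].
  have := H s; rewrite /ball/= ger0_norm ?subr_ge0// ltrBlDr -ltrBlDl => /(_ s0).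
  rewrite -/ka -(ler_pM2l ka0) -normrM mulrA -expr2 real_normK ?num_real// mulrBr => H2.
  by have := le_trans (ler_norm _) H2; rewrite -expr2; lra.
pose e : R := Num.min (2^-1) (Num.min del (`|ka| * c / (8 * (N + 1)))).
have N1 : 0 < N + 1 by rewrite ltr_wpDl.
have e0 : 0 < e by rewrite !lt_min invr_gt0 ltr0n del0 divr_gt0// mulr_gt0.
have e12 : e <= 2^-1 by rewrite ge_min lexx.
have edel : e <= del by rewrite /e !ge_min lexx ?orbT.
have eN : e <= `|ka| * c / (8 * (N + 1)) by rewrite /e !ge_min lexx ?orbT.
pose a := 1 - e; have a0 : 0 < a by rewrite /a; lra.
pose H (s : R) := Num.max 0 (s - a) ^+ 2; pose dH (s : R) := 2 * Num.max 0 (s - a).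
have cdH : continuous dH.
  move=> s; apply: cvgM; first exact: cvg_cst.
  apply: (@continuous_max R R (fun=> 0) (fun s => s - a)); first exact: cvg_cst.
  by apply: cvgB; [exact: cvg_id|exact: cvg_cst].
have dH1 (s : R) : is_derive s 1 H (dH s).
  apply/is_deriveP => d d0; exists (d / 2) => [|y ys]; first by rewrite divr_gt0.
  apply: (@le_trans _ _ (2 * `|y - s| * `|y - s|)); last by rewrite ler_wpM2r// mulrC -ler_pdivlMr// ltW.
  rewrite -mulrA -expr2 real_normK ?num_real// /H /dH ler_norml.
  rewrite (_ : y - s = (y - a) - (s - a)); last by ring.
  move: (y - a) (s - a) => v x; have h1 := sqr_ge0 (v - x); have h2 := sqr_ge0 x; have h3 := sqr_ge0 v.
  have [x0|x0] := leP 0 x; have [v0'|v0'] := leP 0 v.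
  - by apply/andP; split; nra.
  - have : 0 <= x * - v by rewrite mulr_ge0// oppr_ge0 ltW.
    by move=> h; apply/andP; split; nra.
  - have : 0 <= - x * v by rewrite mulr_ge0// oppr_ge0 ltW.
    by move=> h; apply/andP; split; nra.
  - by apply/andP; split; nra.
have H0 s : s <= a -> H s = 0 by move=> sa; rewrite /H max_l ?expr0n// subr_le0.
have dH0 s : s <= a -> dH s = 0 by move=> sa; rewrite /dH max_l ?mulr0// subr_le0.
have dH_ge0 s : 0 <= dH s by rewrite mulr_ge0// le_max lexx.
have E := radial_divergence a0 cdH dH1 H0 dH0.
pose w s := dH s * @cutpow R n a s.
have cw : continuous w by apply: continuous_mul => //; exact: continuous_cutpow.
have w_ge0 s : 0 <= w s by rewrite mulr_ge0// ltW// cutpow_gt0.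
have [M _ HM] := continuous_bounded_segment ler01 cw.
have wM x : B x -> `|(w \o enorm) x| <= M by move=> Bx; apply: HM; rewrite enorm_ge0/= ltW.
have iw : mu.-integrable B (EFin \o (w \o enorm)).
  by apply: (@bounded_integrable _ _ _ _ M) => //; exact: measurable_radial.
(* The factor [cutpow] in [w] cancels the power of [s] in the area of the sphere, so the ball
   integral of [w] has derivative [c * dH]; and [H 1 = e ^+ 2]. *)
have W : \int[mu]_(x in B) w (enorm x) = c * e ^+ 2.
  pose T s := ball_integral (w \o enorm : 'rV[R]_n -> R) s - c * H s.
  have dT (s : R) : 0 < s < 1 -> is_derive s 1 T 0.
    move=> /[dup] s01 /andP[s0 s1].
    have [d5 v5] := is_deriveB (is_derive_radial n_gt0 cw s01) (is_deriveZ c (dH1 s)).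
    apply: (DeriveDef (d5 : derivable T s 1)); apply: (etrans (v5 : 'D_1 T s = _)).
    rewrite /GRing.scale/= /w.
    have F1 : s ^+ n.-1 * (dH s * @cutpow R n a s) = dH s  by apply: cutpow_cancel.
    by rewrite -mulrA F1 subrr.
  have cT : {within `[0, 1], continuous T}.
    move=> s; apply: cvgB.
      exact: (continuous_ball_integral n_gt0 (@measurable_radial R n B _ cw) wM).
    apply: cvgM; first exact: cvg_cst.
    apply: continuous_subspaceT => r; exact: is_derive_continuous (dH1 r).
  have := is_derive_eq0_const ler01 dT cT.
  rewrite /T ball_integral0 (H0 0 (ltW a0)) mulr0 subrr => /esym/eqP; rewrite subr_eq0 => /eqP.
  rewrite /ball_integral /= => ->; congr (_ * _).
  by rewrite /H /a max_r; [congr (_ ^+ _)|]; lra.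
have iuw : mu.-integrable B (EFin \o (fun x => u (enorm x) * w (enorm x))).
  have [M2 _ HM2] := continuous_bounded_segment ler01 (continuous_mul cu cw).
  apply: (@bounded_integrable _ _ _ _ M2) => //; first exact: (@measurable_radial R n B _ (continuous_mul cu cw)).
  by move=> x Bx; apply: HM2; rewrite enorm_ge0/= ltW.
have lower : ka ^+ 2 / 2 * (c * e ^+ 2) <= ka * \int[mu]_(x in B) (u (enorm x) * w (enorm x)).
  rewrite -W -!RintegralZl//.
  apply: le_Rintegral => //; [exact: (integrableZl mB _ iw)|exact: (integrableZl mB _ iuw)|].
  move=> x Bx; rewrite mulrA.
  have [xa|xa] := leP (enorm x) a; first by rewrite /w dH0// mul0r !mulr0.
  apply: ler_wpM2r => //; apply: Hdel; rewrite (ltW Bx) andbT.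
  by apply: le_lt_trans xa; rewrite /a lerD2l lerN2.
pose F i (x : 'rV[R]_n) := radial_field H i x.
have CF i : continuous (F i) by apply/C1_continuous; exact: (C1_radial_field a0 cdH dH1 H0 dH0).
(* As [a >= 1/2], [|F i x| <= 2^n d^2] with [d = enorm x - a <= e], while [w >= 2 d]. From
   [d^4 <= e^3 d], the square of the field is smaller than [w] by a factor of order e^3. *)
have F2 i x : B x -> F i x ^+ 2 <= 4 ^+ n * e ^+ 3 / 2 * w (enorm x).
  have K0 : 0 <= 4 ^+ n * e ^+ 3 / 2 :> R.
    by rewrite divr_ge0// mulr_ge0 ?exprn_ge0// ltW.
  rewrite /eball/= => x1; have [xa|xa] := leP (enorm x) a.
    by rewrite /F /radial_field /radial_coef H0// !mul0r expr0n/= mulr_ge0.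
  have xi := coord_le_enorm x i.
  have Fx : `|F i x| <= (enorm x - a) ^+ 2 * 2 ^+ n.
    rewrite /F /radial_field /radial_coef -[leRHS]mulr1 normrM; apply: ler_pM => //.
      rewrite normrM; apply: ler_pM => //.
        by rewrite /H max_r ?subr_ge0 ?(ltW xa)// ger0_norm// sqr_ge0.
      have xn : 0 < enorm x ^+ n by rewrite exprn_gt0// (lt_trans a0).
      rewrite normfV gtr0_norm// -[leRHS]invrK lef_pV2 ?posrE ?invr_gt0 ?exprn_gt0//.
      rewrite -exprVn; apply: lerXn2r; rewrite ?nnegrE ?invr_ge0 ?enorm_ge0//.
        by apply: le_trans (ltW xa); rewrite /a; lra.
      exact: lt_trans xa.
    exact: le_trans xi (ltW x1).
  apply: (@le_trans _ _ (((enorm x - a) ^+ 2 * 2 ^+ n) ^+ 2)).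
    rewrite -(real_normK (num_real (F i x))); apply: lerXn2r; rewrite ?nnegrE//.
    by rewrite mulr_ge0 ?sqr_ge0 ?exprn_ge0.
  have cut1 : 1 <= @cutpow R n a (enorm x).
    rewrite /cutpow max_r ?(ltW xa)// invf_ge1 ?exprn_gt0 ?(lt_trans a0)//.
    by rewrite exprn_ile1 ?enorm_ge0// ltW.
  rewrite /w /dH max_r ?subr_ge0 ?(ltW xa)//.
  have de : enorm x - a <= e by rewrite /a; lra.
  have d0 : 0 <= enorm x - a by rewrite subr_ge0 ltW.
  move: (enorm x - a) (@cutpow R n a (enorm x)) d0 de cut1 => d k d0 de k1.
  have -> : (d ^+ 2 * 2 ^+ n) ^+ 2 = 4 ^+ n * (d ^+ 3 * d).
    have -> : 4 ^+ n = (2 ^+ n) ^+ 2 :> R by rewrite -exprM mulnC exprM; congr (_ ^+ n); rewrite -natrX.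
    by move: (2 ^+ n : R) => v; ring.
  have -> : 4 ^+ n * e ^+ 3 / 2 * (2 * d * k) = 4 ^+ n * (e ^+ 3 * (d * k)).
    by move: (4 ^+ n : R) (e) => v y; field.
  apply: ler_wpM2l; first exact: exprn_ge0.
  apply: ler_pM => //; first exact: exprn_ge0.
    by apply: lerXn2r => //; rewrite nnegrE// ltW.
  by rewrite -[leLHS]mulr1; apply: ler_wpM2l.
have iF2 i : mu.-integrable B (EFin \o (fun x => F i x ^+ 2)) by have [] := continuous_L2 (CF i).
have IF2 i : \int[mu]_(x in B) (F i x ^+ 2) <= 4 ^+ n * e ^+ 3 / 2 * (c * e ^+ 2).
  rewrite -W -RintegralZl//; apply: le_Rintegral => //.
  - exact: (integrableZl mB _ iw).
  - by move=> x Bx; exact: F2.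
have te0 : 0 < t * e ^+ 2 by rewrite mulr_gt0// exprn_gt0.
(* Young's inequality with weight [t * e ^+ 2]: the part in [G] is [t] times an energy at order e^2,
   and the part in [F] has order e^3 because the integral of its square is O(e^5). *)
have upper i : `|\int[mu]_(x in B) (G x 0 i * F i x)| <=
    e ^+ 2 * (t * I i + 4 ^+ n * c / (2 * t) * e).
  have iGF : mu.-integrable B (EFin \o (fun x => G x 0 i * F i x)).
    have [K _ HK] := continuous_bounded_eball (CF i).
    by apply: L2_mul_bounded HK => //; exact: measurable_continuous.
  have i1 := integrableZl mB (t * e ^+ 2) (LG i).2.
  have i2 := integrableZl mB (t * e ^+ 2)^-1 (iF2 i).
  have i3 : mu.-integrable B (EFin \o (fun x => t * e ^+ 2 * G x 0 i ^+ 2 + (t * e ^+ 2)^-1 * F i x ^+ 2)).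
    exact: (integrableD mB i1 i2).
  apply: (le_trans (le_normr_Rintegral mB iGF)).
  apply: (@le_trans _ _ (\int[mu]_(x in B) (t * e ^+ 2 * G x 0 i ^+ 2 + (t * e ^+ 2)^-1 * F i x ^+ 2))).
    apply: le_Rintegral => //; first by have := integrable_norm iGF.
    move=> x _; rewrite -(ler_pM2l te0) mulrDr mulVKf ?gt_eqF// normrM.
    rewrite -(real_normK (num_real (G x 0 i))) -(real_normK (num_real (F i x))).
    move: (t * e ^+ 2) te0 `|G x 0 i| `|F i x| => s s0 g f; nra.
  rewrite RintegralD// RintegralZl//; last by have [] := LG i.
  rewrite RintegralZl// mulrDr; apply: lerD; first by rewrite -/(I i); nra.
  apply: (@le_trans _ _ ((t * e ^+ 2)^-1 * (4 ^+ n * e ^+ 3 / 2 * (c * e ^+ 2)))).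
    by rewrite ler_wpM2l// invr_ge0 ltW.
  by rewrite le_eqVlt; apply/orP; left; apply/eqP; field; rewrite !gt_eqF.
have {}lower : ka ^+ 2 / 2 * (c * e ^+ 2) <= `|ka| * (e ^+ 2 * (t * S + N * e)).
  apply: (le_trans lower); rewrite E mulrN -mulNr; apply: (le_trans (ler_norm _)).
  rewrite normrM normrN; apply: ler_wpM2l => //.
  apply: (le_trans (ler_norm_sum _ _ _)).
  apply: (@le_trans _ _ (\sum_(i < n) e ^+ 2 * (t * I i + 4 ^+ n * c / (2 * t) * e))).
    by apply: ler_sum => i _; exact: upper.
  rewrite -mulr_sumr big_split/= sumr_const card_ord -mulr_sumr -/S.
  by rewrite le_eqVlt; apply/orP; left; apply/eqP; rewrite /N -mulr_natl; field; rewrite gt_eqF.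
have : `|ka| * c / 2 <= t * S + N * e.
  have e20 : 0 < `|ka| * e ^+ 2 by rewrite mulr_gt0// exprn_gt0.
  rewrite -(ler_pM2l e20); apply: le_trans (le_trans lower _); rewrite -?(real_normK (num_real ka));
    by rewrite le_eqVlt; apply/orP; left; apply/eqP; ring.
have tS : t * S <= `|ka| * c / 8.
  rewrite /t mulrAC ler_pdivrMr; last by rewrite mulr_gt0.
  have : 0 <= `|ka| * c by rewrite mulr_ge0// ltW.
  by move: (`|ka| * c) => z z0; nra.
have Ne : N * e <= `|ka| * c / 8.
  apply: (le_trans (ler_wpM2l N0 eN)).
  rewrite mulrA ler_pdivrMr; last by rewrite mulr_gt0.
  have : 0 <= `|ka| * c by rewrite mulr_ge0// ltW.
  by move: (`|ka| * c) => z z0; nra.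
have : 0 < `|ka| * c by rewrite mulr_gt0.
by lra.
Qed.

End profile.

End radial_equation.

(** * Sign structure of the profile *)

Section truncation.
Context {R : realType}.
Implicit Types (f g w : R -> R) (x y a b r : R).

Lemma continuous_near f g x (del : R) : 0 < del ->
  (forall y, `|y - x| < del -> f y = g y) -> {for x, continuous f} -> {for x, continuous g}.
Proof.
move=> del0 fg cf; have E : \forall y \near x, f y = g y.
  by apply/nbhs_ballP; exists del => // y; rewrite /ball/= distrC; exact: fg.
have := cf; rewrite /prop_for /continuous_at -(fg x) ?subrr ?normr0//.
exact: cvg_trans (near_eq_cvg E).
Qed.

Definition step a b r0 r : R := if r < r0 then a else b.

(** Since [w] vanishes around the jump, the step may be frozen at its value at [r] without changing
    the product near [r]; continuity and derivatives of [w] thus pass to the product. *)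
Lemma step_near a b r0 w (del : R) r : 0 < del -> (forall y, `|y - r0| < del -> w y = 0) ->
  exists2 d, 0 < d & forall y, `|y - r| < d -> step a b r0 r * w y = step a b r0 y * w y.
Proof.
move=> del0 w0; have [rr|rr|->] := ltgtP r r0.
- exists (r0 - r) => [|y]; first by rewrite subr_gt0.
  by rewrite ltr_norml ltrD2r /step rr => /andP[_ ->].
- exists (r - r0) => [|y]; first by rewrite subr_gt0.
  rewrite ltr_norml opprB ltrD2r => /andP[H _]; have yr := ltW H.
  by rewrite /step !ltNge yr (ltW rr).
- by exists del => // y /w0 ->; rewrite !mulr0.
Qed.

Lemma continuous_step a b r0 w (del : R) : 0 < del -> (forall y, `|y - r0| < del -> w y = 0) ->
  continuous w -> continuous (fun s => step a b r0 s * w s).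
Proof.
move=> del0 w0 cw r; have [d d0 H] := step_near a b r del0 w0.
by apply: (continuous_near d0 H); apply: cvgM; [exact: cvg_cst|exact: cw].
Qed.

Lemma is_derive_step a b r0 w dw (del r : R) : 0 < del -> (forall y, `|y - r0| < del -> w y = 0) ->
  is_derive r 1 w dw -> is_derive r 1 (fun s => step a b r0 s * w s) (step a b r0 r * dw).
Proof.
move=> del0 w0 cw; have [d d0 H] := step_near a b r del0 w0.
by apply: (is_derive_near d0 H); exact: (is_deriveZ (step a b r0 r) cw).
Qed.

(** [k] rises linearly from 0 at [e] to 1 at [2 * e], and [F] is its primitive. Beyond [2 * e] the
    slope is 1, so [F y - y] is constant there, which yields the lower bound. *)
Lemma truncation (e : R) : 0 < e -> exists F k : R -> R,
  [/\ [/\ continuous F, continuous k & forall y, is_derive y 1 F (k y)],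
      forall y, 0 <= k y <= 1, forall y, y <= e -> k y = 0 /\ F y = 0,
      forall y, 0 <= F y & forall y, y - 2 * e <= F y].
Proof.
move=> e0; pose k y : R := Num.max 0 (Num.min 1 ((y - e) / e)).
have ck : continuous k.
  move=> y; apply: (@continuous_comp _ _ _ (fun y : R => (y - e) / e) (fun t : R => Num.max 0 (Num.min 1 t))).
    by apply: cvgM; [apply: cvgB; [exact: cvg_id|exact: cvg_cst]|exact: cvg_cst].
  exact: continuous_clamp.
have k01 y : 0 <= k y <= 1 by rewrite le_max lexx/= ge_max ler01 ge_min lexx.
have k0 y : y <= e -> k y = 0.
  by move=> ye; rewrite /k max_l// ge_min orbC pmulr_lle0 ?invr_gt0// subr_le0 ye.
have k1 y : 2 * e <= y -> k y = 1.
  move=> ye; rewrite /k min_l; first by rewrite max_r.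
  by rewrite ler_pdivlMr// mul1r; lra.
have [|F [F0 dF]] := antiderivative ck.
  by move=> s s0; rewrite k0// (le_trans s0)// ltW.
have cF : continuous F by move=> s; exact: is_derive_continuous (dF s).
have mF x y : x <= y -> F x <= F y.
  move=> xy; apply: (is_derive_ge0_le xy (df := k)) => //; last exact: continuous_subspaceT.
  by move=> z _; have /andP[] := k01 z.
have Fe y : y <= e -> F y = 0.
  move=> ye; have [y0|/ltW y0] := leP y 0; first exact: F0.
  rewrite -(F0 0 (lexx 0)); apply/esym/(is_derive_eq0_const y0); last exact: continuous_subspaceT.
  by move=> z /andP[_ zy]; have := dF z; rewrite k0// (le_trans (ltW zy)).
have F_ge0 y : 0 <= F y.
  have [y0|/ltW y0] := leP y 0; first by rewrite F0.
  by rewrite -(F0 0 (lexx 0)); exact: mF.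
exists F, k; split=> // [y ye|y]; first by rewrite k0// Fe.
have [ye|/ltW ye] := leP y (2 * e); first by apply: le_trans (F_ge0 y); rewrite subr_le0.
have D (x : R) : is_derive x 1 (fun z => F z - z) (k x - 1) by apply: is_deriveB.
have : F (2 * e) - 2 * e = F y - y.
  apply: (is_derive_eq0_const (f := fun z => F z - z) ye).
    by move=> z /andP[/ltW zy _]; have := D z; rewrite (k1 z zy) subrr.
  by apply: continuous_subspaceT => z; exact: is_derive_continuous (D z).
by have := F_ge0 (2 * e); lra.
Qed.

End truncation.

Section positivity.
Context {R : realType} {n : nat}.
Hypothesis n_gt0 : (0 < n)%N.
Local Notation mu := (lebesgue_rV R n).
Local Notation B := (eball 1 : set 'rV[R]_n).
Local Notation c := (@unit_volume R n * n%:R).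

Lemma radial_bounded (k : R -> R) : continuous k ->
  exists C, forall x : 'rV[R]_n, B x -> `|(k \o enorm) x| <= C.
Proof.
move=> ck; have [M _ HM] := continuous_bounded_segment ler01 ck.
by exists M => x Bx; apply: HM; rewrite enorm_ge0/= ltW.
Qed.

Lemma continuous_radial_integral (k : R -> R) : continuous k ->
  {within `[0, 1], continuous (ball_integral (k \o enorm : 'rV[R]_n -> R))}.
Proof.
move=> ck; have [M HM] := radial_bounded ck.
exact: (continuous_ball_integral n_gt0 (@measurable_radial R n B _ ck) HM).
Qed.

Lemma radial_integral_gt0 (k : R -> R) (r : R) : continuous k -> (forall s, 0 <= k s) ->
  0 <= r < 1 -> 0 < k r -> 0 < \int[mu]_(x in B) k (enorm x).
Proof.
move=> ck k0 /andP[r0 r1] kr.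
pose J := ball_integral (k \o enorm : 'rV[R]_n -> R).
have cJ := continuous_radial_integral ck.
have dJ (s : R) : 0 < s < 1 -> is_derive s 1 J (c * s ^+ n.-1 * k s).
  by move=> s01; exact: is_derive_radial.
have J_le x y : 0 <= x -> x <= y -> y <= 1 -> J x <= J y.
  move=> x0 xy y1; apply: (is_derive_ge0_le xy (df := fun s => c * s ^+ n.-1 * k s)).
  - by move=> s /andP[xs sy]; apply: dJ; rewrite (le_lt_trans x0)// (lt_le_trans sy).
  - move=> s /andP[xs sy]; rewrite mulr_ge0// mulr_ge0 ?(ltW (polar_constant_gt0 n_gt0))// exprn_ge0//.
    by rewrite (le_trans x0)// ltW.
  - apply: continuous_subspaceW cJ => s /=; rewrite !in_itv/= => /andP[xs sy].
    by rewrite (le_trans x0)// (le_trans sy).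
have /cvgrPdist_lt/(_ _ kr)/nbhs_ballP[d /= d0 Hd] := @ck r.
have pos s : r <= s -> s < r + d -> 0 < k s.
  move=> rs sd; have := Hd s; rewrite /ball/= distrC ger0_norm ?subr_ge0// ltrBlDl => /(_ sd).
  by move=> /(le_lt_trans (ler_norm _)); rewrite ltrBlDr ltrDl.
(* The interval lies to the right of [r], since [r] may be 0, and is cut at 1. *)
pose q := Num.min (r + d / 2) 1.
have rq : r < q by rewrite lt_min ltrDl divr_gt0.
have q1 : q <= 1 by rewrite ge_min lexx orbT.
have qd : q <= r + d / 2 by rewrite ge_min lexx.
have [||s + E] := @MVT R J (fun s => c * s ^+ n.-1 * k s) r q rq.
- by move=> s; rewrite in_itv/= => /andP[rs sq]; apply: dJ; rewrite (le_lt_trans r0)// (lt_le_trans sq).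
- apply: continuous_subspaceW cJ => s /=; rewrite !in_itv/= => /andP[xs sy].
  by rewrite (le_trans r0)// (le_trans sy).
rewrite in_itv/= => /andP[rs sq]; have J0 : J 0 = 0 by exact: ball_integral0.
have := J_le _ _ (lexx 0) r0 (ltW r1); have := J_le _ _ (le_trans r0 (ltW rq)) q1 (lexx 1).
suff : 0 < J q - J r by rewrite -/(ball_integral (k \o enorm) 1) -/J; lra.
have ks : 0 < k s by apply: pos; [exact: ltW|lra].
have sn : 0 < s ^+ n.-1 by rewrite exprn_gt0// (le_lt_trans r0).
by rewrite E; apply: mulr_gt0; [rewrite mulr_gt0// mulr_gt0// polar_constant_gt0|rewrite subr_gt0].
Qed.

End positivity.

(** * Comparison with the first eigenvalue *)

Section no_dip.
Context {R : realType} {n : nat}.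
Hypothesis n_gt0 : (0 < n)%N.
Local Notation mu := (lebesgue_rV R n).
Local Notation B := (eball 1 : set 'rV[R]_n).
Local Notation c := (@unit_volume R n * n%:R).
Variables (V : 'rV[R]_n -> R) (v0 v1 : R).
Hypotheses (mV : measurable_fun B V) (v0_gt0 : 0 < v0).
Hypothesis V_bounds : forall x, B x -> v0 <= V x <= v1.
Variables (u : R -> R) (m la : R).
Hypotheses (m_gt0 : 0 < m) (la_gt0 : 0 < la).
Hypothesis u_sol : radial_solution V u m la.
Hypothesis u_out : forall s, 1 <= s -> u s = 0.
Hypothesis first : forall eta, C1c B eta -> \int[mu]_(x in B) (V x * eta x) = 0 ->
  la * \int[mu]_(x in B) (V x * eta x ^+ 2) <=
  \int[mu]_(x in B) enorm (gradient eta x) ^+ 2.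

Local Notation fl := (flux V u m).

(** The derivative of [u] inside ]0, 1[. From radius 1 on, the value 0 is harmless: the truncation
    of [u] vanishes there. *)
Definition slope (r : R) : R :=
  if 0 < r < 1 then - (la / c) * (fl r * (r ^+ n.-1)^-1) else 0.

(** The flux is O(r^n) by the volume of the ball, and dividing by r^(n-1) leaves O(r): exactly the
    flatness that makes a radial function C^1 at the origin. *)
Lemma slope_le : exists2 C, 0 <= C & forall r, 0 < r -> `|slope r| <= C * r.
Proof.
have [cu _ _ _] := u_sol.
have [C C0 HC] := flux_le n_gt0 mV v0_gt0 V_bounds m cu.
exists (la / c * C) => [|r r0]; first by rewrite mulr_ge0// ltW// divr_gt0// polar_constant_gt0.
have L0 : 0 < la / c by rewrite divr_gt0// polar_constant_gt0.
rewrite /slope r0/=; case: ltP => r1; last by rewrite normr0 mulr_ge0 ?(ltW r0)// mulr_ge0// ltW.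
rewrite normrM normrN (gtr0_norm L0) -[leRHS]mulrA; apply: ler_wpM2l; first exact: ltW.
have rn : 0 < r ^+ n.-1 by rewrite exprn_gt0.
rewrite normrM normfV (gtr0_norm rn) ler_pdivrMr// -mulrA -exprS prednK//.
by apply: HC; rewrite !ltW.
Qed.

Lemma continuous_slope r : 0 < r < 1 -> {for r, continuous slope}.
Proof.
move=> /[dup] r01 /andP[r0 r1]; have [cu _ _ _] := u_sol.
apply: (@continuous_near _ (fun r => - (la / c) * (fl r * (r ^+ n.-1)^-1)) _ _ (Num.min r (1 - r))).
- by rewrite lt_min r0 subr_gt0.
- move=> y; rewrite lt_min !ltr_norml => /andP[/andP[y0 _] /andP[_ y1]].
  by rewrite /slope ifT//; apply/andP; split; lra.
- apply: cvgM; first exact: cvg_cst.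
  have cf := @continuous_flux R n n_gt0 V v0 v1 mV v0_gt0 V_bounds u m cu r r01.
  apply: (cvgM cf).
  by apply: cvgV; [rewrite expf_neq0// gt_eqF|exact: exprn_continuous].
Qed.

Lemma profile_small_near1 (e : R) : 0 < e -> exists2 del, 0 < del & forall y, 1 - del < y -> u y < e.
Proof.
move=> e0; have [cu u1 _ _] := u_sol.
have /cvgrPdist_lt/(_ e e0)/nbhs_ballP[d /= d0 H] := @cu 1.
exists d => // y yd; have [y1|y1] := leP 1 y; first by rewrite u_out.
have := H y; rewrite /ball/= u1 sub0r normrN gtr0_norm ?subr_gt0// => /(_ _).
by move=> /(_ ltac:(lra)) /(le_lt_trans (ler_norm _)).
Qed.

(* [F] is a C^1 substitute for y |-> max(y - e, 0), and [k] its derivative. The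
   test function is a multiple of F(u) on each side of r0, where F(u) vanishes
   near r0. *)
Section test_functions.
Variables (F k : R -> R) (e r0 : R).
Hypotheses (e_gt0 : 0 < e) (e_le : 2 * e < m).
Hypotheses (cF : continuous F) (ck : continuous k) (dF : forall y : R, is_derive y 1 F (k y)).
Hypotheses (k01 : forall y, 0 <= k y <= 1) (kF0 : forall y, y <= e -> k y = 0 /\ F y = 0).
Hypotheses (F_ge0 : forall y, 0 <= F y) (F_ge : forall y, y - 2 * e <= F y).
Hypotheses (r0_01 : 0 < r0 < 1) (ur0 : u r0 <= 0).

Let w s := F (u s).
Let dw s := k (u s) * slope s.

Let cu : continuous u. Proof. by case: u_sol. Qed.

Let cw : continuous w.
Proof. by move=> s; apply: (@continuous_comp _ _ _ u F); [exact: cu|exact: cF]. Qed.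

Let cku : continuous (fun s => k (u s)).
Proof. by move=> s; apply: (@continuous_comp _ _ _ u k); [exact: cu|exact: ck]. Qed.

Let small (r : R) : u r < e ->
  exists2 del, 0 < del & forall y, `|y - r| < del -> w y = 0 /\ dw y = 0.
Proof.
move=> ur; have h : 0 < e - u r by rewrite subr_gt0.
have /cvgrPdist_lt/(_ _ h)/nbhs_ballP[d /= d0 H] := @cu r.
exists d => // y; rewrite distrC => /H /=; rewrite distrC => /(le_lt_trans (ler_norm _)).
rewrite ltrD2r => /ltW /kF0 [E1 E2].
by rewrite /w /dw E1 E2 mul0r.
Qed.

Let near_r0 : exists2 del, 0 < del & forall y, `|y - r0| < del -> w y = 0 /\ dw y = 0.
Proof. by apply: small; exact: le_lt_trans ur0 e_gt0. Qed.

Let dw_derive (r : R) : 0 < r -> is_derive r 1 w (dw r).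
Proof.
move=> rpos; have [cu' u1 _ eq] := u_sol.
have [r1|r1] := ltP r 1.
  have := eq r; rewrite rpos r1 => /(_ isT) H.
  have := @is_derive1_comp R F u r _ _ (dF (u r)) H.
  by rewrite /dw /slope rpos r1.
have [|d d0 H] := @small r; first by rewrite u_out.
have [_ ->] : w r = 0 /\ dw r = 0 by apply: H; rewrite subrr normr0.
by apply: (is_derive_near d0 _ (is_derive_cst (0 : R) r 1)) => y /H[].
Qed.

Let cdw : continuous dw.
Proof.
move=> r; have [ru|ru] := leP 1 r.
  have [|d d0 H] := @small r; first by rewrite u_out.
  by apply: (continuous_near d0 (f := cst 0)) => [y /H[_ ->]//|]; exact: cvg_cst.
have [rpos|rneg] := ltP 0 r.
  by apply: cvgM; [exact: cku|apply: continuous_slope; rewrite rpos].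
have [C C0 HC] := slope_le.
have dwle y : `|dw y| <= C * `|y|.
  have [y0|y0] := ltP 0 y.
    have /andP[h0 h1] := k01 (u y).
    rewrite /dw normrM ger0_norm// (gtr0_norm y0) -[leRHS]mul1r; apply: ler_pM => //.
    exact: HC.
  by rewrite /dw /slope ltNge y0 /= mulr0 normr0 mulr_ge0.
have dwneg y : y <= 0 -> dw y = 0 by move=> y0; rewrite /dw /slope ltNge y0/= mulr0.
move: rneg; rewrite le_eqVlt => /predU1P[->|rneg].
  apply/cvgrPdist_le => d d0; apply/nbhs_ballP; exists (d / (C + 1)) => /=.
    by rewrite divr_gt0// ltr_wpDl.
  move=> y; rewrite /ball/= dwneg// !sub0r !normrN ltr_pdivlMr ?ltr_wpDl// => yd.
  apply: (le_trans (dwle y)); apply: le_trans (ltW yd).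
  by rewrite mulrC ler_wpM2l// lerDl.
apply: (@continuous_near _ (cst 0) _ _ (- r)); first by rewrite oppr_gt0.
  by move=> y; rewrite ltr_norml => /andP[_]; rewrite ltrBlDr addNr => /ltW/dwneg ->.
exact: cvg_cst.
Qed.

Lemma C1c_test a b :
  C1c B (fun x : 'rV[R]_n => step a b r0 (enorm x) * F (u (enorm x))) /\
  forall x : 'rV[R]_n, enorm (gradient (fun x : 'rV[R]_n => step a b r0 (enorm x) * F (u (enorm x))) x) ^+ 2 =
    (step a b r0 (enorm x) * dw (enorm x)) ^+ 2.
Proof.
have [del del0 H] := near_r0.
have w0 y : `|y - r0| < del -> w y = 0 by move=> /H[].
have dw0 y : `|y - r0| < del -> dw y = 0 by move=> /H[].
pose g s := step a b r0 s * w s; pose d s := step a b r0 s * dw s.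
have cg : continuous g by exact: (@continuous_step _ _ _ _ _ _ del0 w0 cw).
have cd : continuous d by exact: (@continuous_step _ _ _ _ _ _ del0 dw0 cdw).
have dg (r : R) : 0 < r -> is_derive r 1 g (d r).
  by move=> rpos; apply: (is_derive_step a b del0 w0); exact: dw_derive.
have [C C0 HC] := slope_le.
have K0 : 0 <= (`|a| + `|b|) * C by rewrite mulr_ge0// addr_ge0.
have dle (r : R) : 0 < r < 1 -> `|d r| <= (`|a| + `|b|) * C * r.
  move=> /andP[rpos _]; rewrite /d normrM -mulrA; apply: ler_pM => //.
    by rewrite /step; case: ifP => _; rewrite ?lerDl ?lerDr.
  have /andP[h0 h1] := k01 (u r).
  by rewrite /dw normrM ger0_norm// -[leRHS]mul1r; apply: ler_pM => //; exact: HC.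
have [[Cg1 Cg2] Pg] := C1_radial (n := n) cg dg (fun r _ => @cd r) ltr01 K0 dle.
(* [u < e] close to the sphere of radius 1 and beyond, so [F (u (enorm x))] vanishes there; this
   gives the compact support. *)
have [del1 del10 Hdel1] := profile_small_near1 e_gt0.
split.
  split => //; exists [set x | enorm x <= 1 - del1]; split.
  - apply: (@subclosed_compact _ _ [set x : 'rV[R]_n | enorm x <= 1]).
    + rewrite (_ : mkset _ = enorm @^-1` [set t | t <= 1 - del1])//.
      by apply: closed_comp => [x _|]; [exact: continuous_enorm|exact: closed_le].
    + exact: compact_eball_closure.
    + by move=> x /= xq; rewrite (le_trans xq)// lerBlDr lerDl ltW.
  - by move=> x /= xq; rewrite /eball/= (le_lt_trans xq)// ltrBlDr ltrDl.
  - by move=> x /= /negP; rewrite -ltNge => /Hdel1/ltW/kF0[_ ->]; rewrite mulr0.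
move=> x; rewrite enorm_sqr /dotr.
rewrite (eq_bigr (fun i => d (enorm x) ^+ 2 * (x 0 i / enorm x) ^+ 2)); last first.
  by move=> i _; rewrite mxE Pg -expr2 exprMn.
rewrite -mulr_sumr -/(d (enorm x)).
have [x0|x0] := eqVneq (enorm x) 0.
  by rewrite /d /dw /slope x0 ltxx/= !mulr0 expr0n/= mul0r.
rewrite (eq_bigr (fun i => (x 0 i * x 0 i) * (enorm x ^+ 2)^-1)); last first.
  by move=> i _; rewrite exprMn exprVn expr2.
rewrite -mulr_suml -/(dotr x x) -enorm_sqr divff ?mulr1//.
by rewrite expf_neq0.
Qed.

(* Equality would hold with k in place of k^2, and 0 <= k <= 1. *)
Lemma energy_le a b :
  \int[mu]_(x in B) (step a b r0 (enorm x) * dw (enorm x)) ^+ 2 <=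
  la * \int[mu]_(x in B) (source V u m x * (step a b r0 (enorm x) ^+ 2 * F (u (enorm x)))).
Proof.
have [del del0 H] := near_r0.
have w0 y : `|y - r0| < del -> w y = 0 by move=> /H[].
have dw0 y : `|y - r0| < del -> dw y = 0 by move=> /H[].
have stepE s : step a b r0 s ^+ 2 = step (a ^+ 2) (b ^+ 2) r0 s by rewrite /step; case: ifP.
pose g s := step a b r0 s ^+ 2 * w s; pose d s := (step a b r0 s * dw s) ^+ 2.
have cg : continuous g.
  rewrite /g; under eq_fun do rewrite stepE.
  exact: (@continuous_step _ _ _ _ _ _ del0 w0 cw).
have cd : continuous d.
  have cd' : continuous (fun s => step a b r0 s * dw s).
    exact: (@continuous_step _ _ _ _ _ _ del0 dw0 cdw).
  rewrite (_ : d = fun s => (step a b r0 s * dw s) * (step a b r0 s * dw s)); first exact: continuous_mul.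
  by apply/funext => s; rewrite /d expr2.
have dg (r : R) : 0 < r -> is_derive r 1 g (step a b r0 r ^+ 2 * dw r).
  move=> rpos; rewrite /g; under eq_fun do rewrite stepE.
  by rewrite stepE; apply: (is_derive_step _ _ del0 w0); exact: dw_derive.
have [mh [C hC]] := source_bounded mV v0_gt0 V_bounds m cu.
(* [T] compares the two sides over B_s. The layer-cake formula and
   [la * fl s = - (c * s ^+ n.-1 * slope s)] give [T] a nonnegative derivative with the factor
   [k (1 - k)], and [g 1 = 0] removes the boundary term at [s = 1]. *)
pose T s := la * (ball_integral (fun x => source V u m x * g (enorm x)) s - g s * fl s) -
  ball_integral (d \o enorm : 'rV[R]_n -> R) s.
have [_ u1 _ _] := u_sol.
have T0 : T 0 = 0.
  by rewrite /T /flux !ball_integral0 !(mulr0, subr0).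
have T1 : T 1 = la * \int[mu]_(x in B) (source V u m x * g (enorm x)) - \int[mu]_(x in B) d (enorm x).
  have -> : T 1 = la * (ball_integral (fun x => source V u m x * g (enorm x)) 1 - g 1 * fl 1) -
     ball_integral (d \o enorm : 'rV[R]_n -> R) 1 by [].
  have -> : g 1 = 0 by rewrite /g /w u1; have [_ ->] := kF0 (ltW e_gt0); rewrite mulr0.
  by rewrite mul0r subr0.
suff : T 0 <= T 1 by rewrite T0 T1 subr_ge0.
apply: (is_derive_ge0_le ler01 (df := fun s =>
  c * s ^+ n.-1 * (step a b r0 s ^+ 2 * (k (u s) * (1 - k (u s)) * slope s ^+ 2)))).
- move=> s /[dup] s01 /andP[s0 s1].
  have e1 := is_derive_radial n_gt0 cd s01.
  have e2 := is_deriveZ la (is_derive_layer_cake n_gt0 mh hC cg s01 (dg s s0)).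
  have [d5 v5] := is_deriveB e2 e1.
  apply: (DeriveDef (d5 : derivable T s 1)); apply: (etrans (v5 : 'D_1 T s = _)).
  rewrite /GRing.scale/= -[ball_integral _ s]/(fl s) /d exprMn /dw.
  have E : la * fl s = - (c * s ^+ n.-1 * slope s).
    rewrite /slope s01; have := polar_constant_gt0 (R := R) n_gt0; rewrite lt0r mulf_eq0 negb_or => /andP[/andP[un nn] _].
    have sn : s ^+ n.-1 != 0 by rewrite expf_neq0// gt_eqF.
    by move: (s ^+ n.-1) sn => y y0; field; rewrite un nn y0.
  have -> : la * - (step a b r0 s ^+ 2 * (k (u s) * slope s) * fl s) =
     - (step a b r0 s ^+ 2 * (k (u s) * slope s) * (la * fl s)) by ring.
  by rewrite E; ring.
- move=> s /andP[s0 s1]; have /andP[h0 h1] := k01 (u s).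
  have c0 : 0 <= c :> R by exact/ltW/polar_constant_gt0.
  apply: mulr_ge0; first by rewrite mulr_ge0// exprn_ge0// ltW.
  by rewrite mulr_ge0 ?sqr_ge0// mulr_ge0 ?sqr_ge0// mulr_ge0// subr_ge0.
- move=> s; apply: cvgB; last exact: (continuous_radial_integral n_gt0 cd).
  by apply: cvgM; [exact: cvg_cst|exact: (continuous_layer_cake n_gt0 mh hC cg)].
Qed.

Lemma no_dip_above r1 r2 : 0 <= r1 < r0 -> r0 < r2 < 1 -> 2 * e < u r1 -> 2 * e < u r2 -> False.
Proof.
move=> /andP[r1_0 r10] /andP[r02 r21] ur1 ur2.
have [del del0 H] := near_r0.
have w0 y : `|y - r0| < del -> w y = 0 by move=> /H[].
have w1 : 0 < w r1 by apply: lt_le_trans (F_ge _); rewrite subr_gt0.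
have w2 : 0 < w r2 by apply: lt_le_trans (F_ge _); rewrite subr_gt0.
have mB := @measurable_eball R n 1.
have r00 : 0 < r0 by case/andP: r0_01.
have cs a b : continuous (fun s => step a b r0 s * w s).
  exact: (@continuous_step _ _ _ _ _ _ del0 w0 cw).
have iV (h : R -> R) : continuous h -> mu.-integrable B (EFin \o (fun x => V x * h (enorm x))).
  move=> ch; have [mh [C hC]] := weighted_radial_bounded mV v0_gt0 V_bounds ch.
  exact: (@bounded_integrable _ _ _ _ C).
have pos (h : R -> R) r : continuous h -> (forall s, 0 <= h s) -> 0 <= r < 1 -> 0 < h r ->
    0 < \int[mu]_(x in B) (V x * h (enorm x)).
  move=> ch h0 r01 hr; have I0 := radial_integral_gt0 n_gt0 ch h0 r01 hr.
  have ih : mu.-integrable B (EFin \o (h \o enorm)).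
    have [C hC] := radial_bounded (n := n) ch.
    by apply: (@bounded_integrable _ _ _ _ C) => //; exact: measurable_radial.
  apply: (lt_le_trans (_ : 0 < v0 * \int[mu]_(x in B) h (enorm x))); first exact: mulr_gt0.
  rewrite -RintegralZl//; apply: le_Rintegral => //; [exact: (integrableZl mB v0 ih)|exact: iV|].
  by move=> x /V_bounds/andP[V0 _]; rewrite ler_wpM2r.
have s_ge0 a b s : 0 <= a -> 0 <= b -> 0 <= step a b r0 s * w s.
  by move=> a0 b0; rewrite mulr_ge0//; [rewrite /step; case: ifP|exact: F_ge0].
(* [c1] is the V-integral of [w] outside radius [r0], [c2] the one inside. In [eta] each part
   carries the integral of the other, so the two contributions to the mean cancel. *)
pose c1 := \int[mu]_(x in B) (V x * (step 0 1 r0 (enorm x) * w (enorm x))).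
pose c2 := \int[mu]_(x in B) (V x * (step 1 0 r0 (enorm x) * w (enorm x))).
have c1_gt0 : 0 < c1.
  apply: (pos _ r2 (cs 0 1)) => [s||]; first exact: s_ge0.
    by rewrite r21 andbT ltW// (lt_trans r00).
  by rewrite /step (le_gtF (ltW r02)) mul1r.
pose eta (x : 'rV[R]_n) := step c1 (- c2) r0 (enorm x) * F (u (enorm x)).
have [Ceta geta] := C1c_test c1 (- c2).
have eta0 : \int[mu]_(x in B) (V x * eta x) = 0.
  have i1 := integrableZl mB c1 (iV _ (cs 1 0)).
  have i2 := integrableZl mB c2 (iV _ (cs 0 1)).
  transitivity (\int[mu]_(x in B) (c1 * (V x * (step 1 0 r0 (enorm x) * w (enorm x))) -
      c2 * (V x * (step 0 1 r0 (enorm x) * w (enorm x))))).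
    apply: eq_Rintegral => x _; rewrite /eta /step -/(w (enorm x)); case: ifP => _; ring.
  rewrite RintegralB// RintegralZl//; last exact: iV (cs 1 0).
  rewrite RintegralZl//; last exact: iV (cs 0 1).
  by rewrite -/c1 -/c2 mulrC subrr.
have E : \int[mu]_(x in B) enorm (gradient eta x) ^+ 2 =
    \int[mu]_(x in B) (step c1 (- c2) r0 (enorm x) * dw (enorm x)) ^+ 2.
  by apply: eq_Rintegral => x _; exact: geta.
have := first Ceta eta0; rewrite E => /le_trans /(_ (energy_le c1 (- c2))); rewrite ler_pM2l//.
pose g s := step c1 (- c2) r0 s ^+ 2 * w s.
have gE s : g s = step (c1 ^+ 2) (c2 ^+ 2) r0 s * w s by rewrite /g /step; case: ifP => _; rewrite ?sqrrN.
have cg : continuous g.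
  by rewrite (_ : g = fun s => step (c1 ^+ 2) (c2 ^+ 2) r0 s * w s); [exact: cs|exact/funext].
have g0 s : 0 <= g s by rewrite gE s_ge0// sqr_ge0.
have Ig : 0 < \int[mu]_(x in B) (V x * g (enorm x)).
  apply: (pos _ r1) => //; first by rewrite r1_0 (lt_trans r10)//; case/andP: r0_01.
  by rewrite gE /step r10 mulr_gt0// exprn_gt0.
apply/negP; rewrite -ltNge -subr_gt0.
have c1w : continuous (fun s => step c1 (- c2) r0 s * w s) by exact: cs.
have csg : continuous (fun s => (u s - m) * g s).
  by apply: continuous_mul => // s; apply: cvgB; [exact: cu|exact: cvg_cst].
have i1 : mu.-integrable B (EFin \o (fun x => V x * eta x ^+ 2)).
  apply: (@iV (fun s => (step c1 (- c2) r0 s * w s) ^+ 2)).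
  rewrite (_ : (fun s => _) = fun s => (step c1 (- c2) r0 s * w s) * (step c1 (- c2) r0 s * w s)).
    exact: continuous_mul.
  exact/funext.
have i2 : mu.-integrable B (EFin \o (fun x => source V u m x * g (enorm x))).
  rewrite (_ : (fun x => _) = fun x => V x * ((u (enorm x) - m) * g (enorm x))); first exact: iV csg.
  by apply/funext => x; rewrite /source mulrA.
have iZ := integrableZl mB (m - 2 * e) (iV _ cg).
rewrite -RintegralB//; apply: (lt_le_trans (_ : 0 < (m - 2 * e) * \int[mu]_(x in B) (V x * g (enorm x)))).
  by rewrite mulr_gt0// subr_gt0.
rewrite -RintegralZl//; last exact: iV.
apply: le_Rintegral => //; first exact: (integrableB mB i1 i2).
move=> x /V_bounds/andP[V0 _].
have V1 : 0 <= V x by rewrite (le_trans (ltW v0_gt0)).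
(* The difference of the integrands is [(w - u + m) * (V * g)], at least [(m - 2 * e) * (V * g)]
   because the truncation loses at most [2 * e]. Its integral is positive, against the two
   inequalities combined. *)
have -> : V x * eta x ^+ 2 - source V u m x * g (enorm x) =
    (w (enorm x) - (u (enorm x) - m)) * (V x * g (enorm x)).
  by rewrite /source /eta /g -/(w (enorm x)); ring.
apply: ler_wpM2r; first exact: mulr_ge0.
by have := F_ge (u (enorm x)); rewrite -/(w (enorm x)); lra.
Qed.

End test_functions.

Lemma no_dip r1 r0 r2 : 0 <= r1 < r0 -> r0 < r2 < 1 -> 0 < u r1 -> 0 < u r2 -> 0 < u r0.
Proof.
move=> r10 r02 u1 u2; rewrite ltNge; apply/negP => u0.
(* Quarters keep [2 * e] strictly below [m], [u r1] and [u r2]. *)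
pose e := Num.min (m / 4) (Num.min (u r1 / 4) (u r2 / 4)).
have e0 : 0 < e by rewrite !lt_min !divr_gt0.
have e1 : e <= m / 4 by rewrite ge_min lexx.
have e2 : e <= u r1 / 4 by rewrite !ge_min lexx orbT.
have e3 : e <= u r2 / 4 by rewrite !ge_min lexx !orbT.
have [F [k [[cF ck dF] k01 kF0 F0 FG]]] := truncation e0.
have em : 2 * e < m by lra.
have r0_01 : 0 < r0 < 1.
  by case/andP: r10 => h1 h2; case/andP: r02 => h3 h4; rewrite (le_lt_trans h1)// (lt_trans h3).
by apply: (no_dip_above e0 em cF ck dF k01 kF0 F0 FG r0_01 u0 r10 r02); lra.
Qed.

Lemma flux_decreasing (p q t : R) : 0 <= p -> p < q -> q <= 1 -> 0 < t ->
  (forall r, p <= r < q -> u r <= m - t) -> fl q < fl p.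
Proof.
move=> p0 pq q1 t0 ut; have [cu _ _ _] := u_sol.
have [mh [C hC]] := source_bounded mV v0_gt0 V_bounds m cu.
have mS := @measurable_shell R n p q.
have SB : (eball q `\` eball p : set 'rV[R]_n) `<=` eball 1.
  by move=> x [] /(eball_sub q1).
rewrite -subr_lt0 /flux (ball_integral_increment mh hC)//; last exact: ltW.
apply: (@le_lt_trans _ _ (\int[mu]_(x in eball q `\` eball p) - (v0 * t))).
  apply: le_Rintegral => //.
  - apply: (@bounded_integrable _ _ _ _ C) => //; last by move=> x /SB; exact: hC.
    by apply: measurable_funS mh => //; exact: measurable_eball.
  - apply: (@bounded_integrable _ _ _ _ `|- (v0 * t)|) => //.
  - move=> x [xq /negP xp]; have x1 : B x by exact: eball_sub xq.
    have /andP[V0 _] := V_bounds x1.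
    have := ut (enorm x); rewrite leNgt xp => /(_ xq) ux.
    rewrite /source lerNr -mulrN; apply: ler_pM => //; [exact: ltW|exact: ltW|lra].
rewrite Rintegral_cst// mulNr oppr_lt0 volume_shell//; last exact: ltW.
rewrite mulr_gt0// ?mulr_gt0 ?unit_volume_gt0// subr_gt0 ltr_pXn2r// ?nnegrE//.
by rewrite (le_trans p0)// ltW.
Qed.

(** The mean value theorem for the radial equation: the sign of the flux at one intermediate radius
    decides the sign of the increment of [u]. *)
Lemma profile_increment (p q : R) : 0 <= p -> p < q -> q <= 1 ->
  exists s C, [/\ p < s < q, 0 < C & u p - u q = C * fl s].
Proof.
move=> p0 pq q1; have [cu _ _ eq] := u_sol.
have [||s + E] := @MVT R u (fun r => - (la / c) * (fl r * (r ^+ n.-1)^-1)) p q pq.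
- move=> s; rewrite in_itv/= => /andP[ps sq]; apply: eq.
  by rewrite (le_lt_trans p0)// (lt_le_trans sq).
- exact: continuous_subspaceT.
rewrite in_itv/= => /andP[ps sq].
exists s, (la / c * (s ^+ n.-1)^-1 * (q - p)); rewrite ps sq; split => //.
  rewrite mulr_gt0 ?subr_gt0// mulr_gt0 ?divr_gt0 ?polar_constant_gt0// invr_gt0 exprn_gt0//.
  exact: le_lt_trans ps.
by rewrite -opprB E; ring.
Qed.

Lemma sign_structure : exists a, [/\ 0 <= a < 1, forall r, a < r < 1 -> 0 < u r &
  0 < a -> forall r, 0 <= r < a -> u r < 0].
Proof.
have [cu u1 fl1 eq] := u_sol.
have [|del del0 Hdel] := @profile_small_near1 (m / 2); first by rewrite divr_gt0.
pose b := Num.max 0 (1 - del / 2).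
have b1 : b < 1 by rewrite gt_max ltr01/= ltrBlDr ltrDl divr_gt0.
have b0 : 0 <= b by rewrite le_max lexx.
have bpos r : b <= r < 1 -> 0 < u r.
  move=> /andP[br r1]; have r0 := le_trans b0 br.
  have [s [C [/andP[rs s1] C0 E]]] := profile_increment r0 r1 (lexx 1).
  rewrite u1 subr0 in E; rewrite E mulr_gt0// -fl1.
  (* On [[s, 1[] the profile stays below [m / 2], so the flux decreases strictly towards [fl 1 = 0]
     and is positive at [s]. *)
  apply: (@flux_decreasing s 1 (m / 2)) => //; [|by rewrite divr_gt0|].
    by rewrite (le_trans r0)// ltW.
  move=> x /andP[sx x1]; have := Hdel x; have : 1 - del / 2 <= b by rewrite le_max lexx orbT.
  by move=> bd /(_ ltac:(lra)); lra.
(* [a] is the supremum of these radii, or 0 if there are none; it cannot exceed [b], hence is less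
   than 1. *)
pose E := [set r | 0 <= r < 1 /\ u r <= 0].
have Eb r : E r -> r <= b.
  move=> [/andP[_ r1] ur]; rewrite leNgt; apply/negP => br.
  by have := bpos r; rewrite (ltW br) r1 ltNge ur => /(_ isT).
have [E0|/set0P nE] := eqVneq E set0.
  exists 0; split=> [|r /andP[r0 r1]|]; [by rewrite lexx ltr01| |by rewrite ltxx].
  rewrite ltNge; apply/negP => ur; suff : E r by rewrite E0.
  by split => //; rewrite ltW.
have hE : has_sup E by split => //; exists b => r /Eb.
pose a := sup E.
have aE r : E r -> r <= a by move=> Er; apply: sup_upper_bound.
have ab : a <= b by apply: ge_sup => // r /Eb.
have a0 : 0 <= a by have [r Er] := nE; apply: le_trans (aE _ Er); have [/andP[]] := Er.
have a1 : a < 1 by exact: le_lt_trans b1.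
have apos r : a < r < 1 -> 0 < u r.
  move=> /andP[ar r1]; rewrite ltNge; apply/negP => ur.
  suff /aE : E r by rewrite leNgt ar.
  by split => //; rewrite r1 andbT (le_trans a0)// ltW.
exists a; split => //; first by rewrite a0.
move=> a_gt0.
have ua : u a <= 0.
  rewrite leNgt; apply/negP => ua.
  have /cvgrPdist_lt/(_ _ ua)/nbhs_ballP[d /= d0 H] := @cu a.
  have [r Er ard] := sup_adherent d0 hE.
  have := H r; rewrite /ball/= ger0_norm ?subr_ge0 ?aE// ltrBlDr -ltrBlDl => /(_ _).
  rewrite -/a in ard; move=> /(_ ltac:(lra)) /(le_lt_trans (ler_norm _)).
  by rewrite ltrBlDr ltrDl; have [_] := Er; lra.
(* A radius [r < a] with [u r > 0] would make [a], where [u a <= 0], a dip between [r] and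
   [(a + 1) / 2]. *)
have uneg r : 0 <= r < a -> u r <= 0.
  move=> /andP[r0 ra]; rewrite leNgt; apply/negP => ur.
  suff : 0 < u a by rewrite ltNge ua.
  apply: (@no_dip r a ((a + 1) / 2)) => //; first by rewrite r0.
    by apply/andP; split; lra.
  by apply: apos; apply/andP; split; lra.
move=> r /andP[r0 ra].
have [s [C [/andP[rs sa] C0 D]]] := profile_increment r0 ra (ltW a1).
have fs : fl s < 0.
  rewrite -[ltRHS](ball_integral0 (source V u m)).
  apply: (@flux_decreasing 0 s m) => //; [exact: le_lt_trans rs|exact/ltW/(lt_trans sa)|].
  move=> x /andP[x0 xs]; rewrite subrr; apply: uneg; rewrite x0/=; exact: lt_trans sa.
have : C * fl s < 0 by rewrite pmulr_rlt0.
by rewrite -D; lra.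
Qed.

End no_dip.

(** * Counting nodal domains *)

Section counting.
Context {R : realType} {n : nat}.
Hypothesis n_gt0 : (0 < n)%N.

Lemma enorm_onto (r : R) : 0 <= r -> exists x : 'rV[R]_n, enorm x = r.
Proof.
move=> r0; exists (r *: delta_mx 0 (Ordinal n_gt0)).
rewrite enormZ ger0_norm// /enorm /dotr (bigD1 (Ordinal n_gt0))//= big1 ?addr0.
  by rewrite mxE !eqxx mulr1 sqrtr1 mulr1.
by move=> i /negbTE ni; rewrite mxE eqxx ni mulr0.
Qed.

(** The ends of a shell and the radius of a ball are zeros of [u], hence [a] or 1. The only shell is
    a < |x| < 1. If [a = 0], the only ball is B_1; if [a > 0], B_1 meets both signs and only B_a
    remains. *)
Lemma nodal_domain_le2 (u : R -> R) (a : R) : 0 <= a < 1 ->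
  (forall r, a < r < 1 -> 0 < u r) -> (0 < a -> forall r, 0 <= r < a -> u r < 0) ->
  exists X1 X2 : set 'rV[R]_n, forall Om, nodal_domain_of u Om -> Om = X1 \/ Om = X2.
Proof.
move=> /andP[a0 a1] up un.
have zero r : 0 <= r <= 1 -> u r = 0 -> r = a \/ r = 1.
  move=> /andP[r0 r1] ur; have [ra|ar|] := ltgtP r a; last by left.
    have := un (le_lt_trans r0 ra) r; rewrite r0 ra ur ltxx => /(_ isT) //.
  move: r1; rewrite le_eqVlt => /predU1P[|r1]; first by right.
  by have := up r; rewrite ar r1 ur ltxx => /(_ isT).
have shell p q : 0 <= p -> p < q -> q <= 1 -> u p = 0 -> u q = 0 -> p = a /\ q = 1.
  move=> p0 pq q1 hp hq.
  have [|pa|p1] := zero p _ hp; first by rewrite p0 (le_trans (ltW pq)).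
    split=> //; have [|qa|//] := zero q _ hq; first by rewrite q1 (le_trans p0)// ltW.
    by move: pq; rewrite pa qa ltxx.
  by move: pq; rewrite p1 ltNge q1.
move: a0; rewrite le_eqVlt => /predU1P[a0|a_gt0].
  exists (eball 1), (eshell 0 1) => Om [[[r [/andP[r0 r1] -> ur]]|
      [p [q [[p0 pq q1 ->] [hp hq _ _]]]]] _ _ _].
    left; have [|ra|->//] := zero r _ ur; first by rewrite r1 ltW.
    by move: r0; rewrite ra -a0 ltxx.
  by right; have [-> ->] := shell _ _ p0 pq q1 hp hq; rewrite a0.
exists (eball a), (eshell a 1) => Om [bc sg _ _].
case: bc => [[r [/andP[r0 r1] Or ur]]|[p [q [[p0 pq q1 ->] [hp hq _ _]]]]]; last first.
  by right; have [-> ->] := shell _ _ p0 pq q1 hp hq.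
left; have [|ra|re] := zero r _ ur; [by rewrite r1 ltW|by rewrite Or ra|].
have un0 : u 0 < 0 by apply: un => //; rewrite lexx.
have up1 : 0 < u ((a + 1) / 2) by apply: up; apply/andP; split; lra.
have [x Ex] := enorm_onto (lexx 0); have [|y Ey] := @enorm_onto ((a + 1) / 2); first lra.
have Ox : Om x by rewrite Or re /eball/= Ex.
have Oy : Om y by rewrite Or re /eball/= Ey; lra.
by case: sg => [/(_ _ Ox)|/(_ _ Oy)]; rewrite ?Ex ?Ey leNgt ?un0 ?up1.
Qed.

Lemma card_le2 (T : Type) (A : set T) (x y : T) : (forall z, A z -> z = x \/ z = y) ->
  (A #<= `I_2)%card.
Proof.
move=> H; pose g i := if i == 0%N then x else y.
apply: (@card_le_trans _ _ _ (g @` `I_2)); last exact: card_image_le.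
by apply: subset_card_le => z /H[->|->]; [exists 0%N|exists 1%N].
Qed.

End counting.

(** * From the eigenvalue problem to the radial equation *)

Section eigenvalue_problem.
Context {R : realType} {n : nat}.
Hypothesis n_gt0 : (0 < n)%N.
Local Notation mu := (lebesgue_rV R n).
Local Notation B := (eball 1 : set 'rV[R]_n).

Lemma continuous_on_eball_closure (g : 'rV[R]_n -> R) : {within closure B, continuous g} ->
  exists2 C, 0 <= C & forall x, B x -> `|g x| <= C.
Proof.
move=> cg; have [|C C0 HC] := @continuous_compact_bounded R n (closure B) g _ cg.
  apply: (subclosed_compact _ compact_eball_closure); first exact: closed_closure.
  have cl : closed [set x : 'rV[R]_n | enorm x <= 1].
    rewrite (_ : mkset _ = enorm @^-1` [set t | t <= 1])//.
    by apply: closed_comp => [x _|]; [exact: continuous_enorm|exact: closed_le].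
  rewrite closureE; apply: smallest_sub => // x /= x1; exact: ltW.
by exists C => // x Bx; apply: HC; exact: subset_closure.
Qed.

(** [psi] is bounded and nonnegative on the ball, so the argument of f' stays in the compact
    interval [[alpha, alpha + lam * M]]. Since [alpha > 0], f' is continuous and positive there. *)
Lemma weight_bounds (f : R -> R) (lam alpha : R) (psi : 'rV[R]_n -> R) :
  C2_halfline f -> (forall t, 0 < t -> 0 < derive1 f t) -> 0 <= lam ->
  constrained_solution f lam alpha psi ->
  measurable_fun B (weight f lam alpha psi) /\ exists v0 v1, 0 < v0 /\
    forall x, B x -> v0 <= weight f lam alpha psi x <= v1.
Proof.
move=> [_ _ df2 _ _] fpos lam0 [alpha0 [cpsi dpsi _ _ _] _ _ [psi0 _]].
have cf (t : R) : 0 < t -> {for t, continuous (derive1 f)}.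
  by move=> t0; apply/differentiable_continuous/derivable1_diffP; exact: df2.
have tpos x : B x -> 0 < alpha + lam * psi x.
  by move=> /psi0 Bx; rewrite ltr_wpDr// mulr_ge0// ltW.
split.
  apply: continuous_on_measurable; first exact: open_eball.
  move=> x; rewrite inE => Bx; apply: (@continuous_comp _ _ _ (fun x => alpha + lam * psi x) (derive1 f)).
    have cp := differentiable_continuous (dpsi x Bx).
    exact: (cvgD (cvg_cst _) (cvgM (cvg_cst _) cp)).
  exact/cf/tpos.
have [M M0 HM] := continuous_on_eball_closure cpsi.
have aM : alpha <= alpha + lam * M by rewrite lerDl mulr_ge0.
have cs : {within `[alpha, alpha + lam * M], continuous (derive1 f)}.
  apply/continuous_in_subspaceT => t; rewrite inE/= in_itv/= => /andP[at0 _].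
  by apply: cf; exact: lt_le_trans at0.
have [t0 t0in Ht0] := EVT_min aM cs; have [t1 t1in Ht1] := EVT_max aM cs.
exists (derive1 f t0), (derive1 f t1); split.
  by apply: fpos; move: t0in; rewrite in_itv/= => /andP[h _]; exact: lt_le_trans h.
move=> x Bx; have tin : alpha + lam * psi x \in `[alpha, alpha + lam * M].
  rewrite in_itv/= lerDl mulr_ge0 ?(ltW (psi0 _ Bx))//= lerD2l ler_wpM2l//.
  exact: le_trans (ler_norm _) (HM _ Bx).
by rewrite /weight Ht0// Ht1.
Qed.

Variables (V : 'rV[R]_n -> R) (v0 v1 : R).
Hypotheses (mV : measurable_fun B V) (v0_gt0 : 0 < v0).
Hypothesis V_bounds : forall x, B x -> v0 <= V x <= v1.
Variables lam sigma1 : R.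
Hypothesis first : first_eigenvalue V lam sigma1.

Let V_ge0 x : B x -> 0 <= V x.
Proof. by move=> /V_bounds/andP[h _]; rewrite (le_trans (ltW v0_gt0)). Qed.

Lemma mass_gt0 : 0 < \int[mu]_(x in B) V x.
Proof.
have mB := @measurable_eball R n 1.
have iV : mu.-integrable B (EFin \o V).
  apply: (@bounded_integrable _ _ _ _ v1) => // x Bx.
  by rewrite ger0_norm ?V_ge0//; have /andP[] := V_bounds Bx.
apply: (@lt_le_trans _ _ (\int[mu]_(x in B) v0)).
  rewrite Rintegral_cst// mulr_gt0//.
  exact: unit_volume_gt0.
apply: le_Rintegral => //; last by move=> x /V_bounds/andP[].
by apply: (@bounded_integrable _ _ _ _ `|v0|).
Qed.

(** Adding [lam] to a Rayleigh quotient cancels its negative term and leaves a quotient of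
    nonnegative integrals. *)
Lemma shifted_eigenvalue_ge0 : 0 <= lam -> 0 <= lam + sigma1.
Proof.
move=> lam0; have [[phi [G [_ _ ->]]] _] := first; rewrite /rayleigh.
set D := \int[mu]_(x in B) (V x * wcenter V phi x ^+ 2).
set N := \int[mu]_(x in B) enorm (G x) ^+ 2.
have N0 : 0 <= N by apply: Rintegral_ge0 => x _; exact: sqr_ge0.
have D0 : 0 <= D by apply: Rintegral_ge0 => x /V_ge0 Vx; rewrite mulr_ge0// sqr_ge0.
(* If [D = 0], the quotient takes the default value 0 and the sum is [lam]. *)
have [DE|DN] := eqVneq D 0; first by rewrite DE invr0 mulr0 addr0.
by rewrite mulrBl mulfK// addrC subrK divr_ge0.
Qed.

(** Mean zero makes [wcenter V eta] equal to [eta], so the minimum property loses its nonlocal term;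
    [lam] moves into the factor on the left. *)
Lemma first_eigenvalue_C1c eta : C1c B eta -> \int[mu]_(x in B) (V x * eta x) = 0 ->
  (lam + sigma1) * \int[mu]_(x in B) (V x * eta x ^+ 2) <=
  \int[mu]_(x in B) enorm (gradient eta x) ^+ 2.
Proof.
move=> Ceta eta0; have [_ min] := first.
have mean0 : wmean V eta = 0 by rewrite /wmean eta0 mul0r.
have cE : wcenter V eta = eta by apply/funext => x; rewrite /wcenter mean0 subr0.
set D := \int[mu]_(x in B) (V x * eta x ^+ 2).
set N := \int[mu]_(x in B) enorm (gradient eta x) ^+ 2.
have N0 : 0 <= N by apply: Rintegral_ge0 => x _; exact: sqr_ge0.
have D0 : 0 <= D by apply: Rintegral_ge0 => x /V_ge0 Vx; rewrite mulr_ge0// sqr_ge0.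
have [->|DN] := eqVneq D 0; first by rewrite mulr0.
have Dpos : 0 < D by rewrite lt_neqAle eq_sym DN.
have nz : nonzero B eta.
  move=> ae0; case/eqP: DN; rewrite /D.
  have mB := @measurable_eball R n 1.
  have me : measurable_fun B eta by exact: (measurable_continuous (C1_continuous (C1c_C1 Ceta))).
  transitivity (\int[mu]_(x in B) (0 : R)).
    apply: ae_eq_Rintegral => //.
      by apply: measurable_funM => //; exact: measurable_funX.
    by apply: filterS ae0 => x H Bx; rewrite H// expr0n mulr0.
  by rewrite Rintegral_cst// mul0r.
have := min _ _ (C1c_H10 Ceta) nz.
rewrite /rayleigh cE -/D -/N ler_pdivlMr// => H.
by rewrite mulrDl; lra.
Qed.

Lemma nodal_domains_of_radial phi (u : R -> R) : 0 <= lam -> eigenfunction V lam sigma1 phi ->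
  radial_profile phi u -> (generalized_nodal_domains V u #<= `I_2)%card.
Proof.
move=> lam0 [_ [G HG weak]] [cu01 phi_u].
have mB := @measurable_eball R n 1.
(* The profile is known to be continuous on [0, 1] only; clamping extends it to the line, with the
   constant value [u 1], which will turn out to be 0, beyond radius 1. *)
pose ut s := u (Num.max 0 (Num.min 1 s)).
have utE s : 0 <= s <= 1 -> ut s = u s by move=> /andP[s0 s1]; rewrite /ut min_r// max_r.
have cut : continuous ut.
  move=> s; apply/cvgrPdist_lt => e e0.
  have cl01 t : `[0, 1]%classic (Num.max 0 (Num.min 1 t) : R).
    by rewrite /= in_itv/= le_max lexx/= ge_max ler01 ge_min lexx.
  have /subspace_continuousP/(_ _ (cl01 s))/cvgrPdist_lt/(_ _ e0) := cu01.
  rewrite near_withinE => /nbhs_ballP[d /= d0 Hd].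
  have /cvgrPdist_lt/(_ d d0) := @continuous_clamp R 0 1 s.
  by apply: filterS => t td; exact: (Hd _ td (cl01 t)).
have phi_ut : {ae mu, forall x, B x -> phi x = ut (enorm x)}.
  apply: filterS phi_u => x H Bx; rewrite H// utE// enorm_ge0/=; exact: ltW.
set m := wmean V (fun x => u (enorm x)).
have mE : m = wmean V (fun x => ut (enorm x)).
  congr (_ / _); apply: eq_Rintegral => x; rewrite inE => Bx.
  by rewrite utE// enorm_ge0/=; exact: ltW.
have [[[mphi _] _ _] _] := HG.
have mut : measurable_fun B (fun x => ut (enorm x)) by exact: (@measurable_radial R n B _ cut).
have mphiE : wmean V phi = m.
  rewrite mE; congr (_ / _); apply: ae_eq_Rintegral.
  - exact: measurable_funM.
  - exact: measurable_funM.
  - by apply: filterS phi_ut => x H Bx; rewrite H.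
have [mh [C hC]] := weighted_radial_bounded mV v0_gt0 V_bounds cut.
have iVu : mu.-integrable B (EFin \o (fun x => V x * ut (enorm x))).
  exact: (@bounded_integrable _ _ _ _ C).
have iV : mu.-integrable B (EFin \o V).
  apply: (@bounded_integrable _ _ _ _ v1) => // x Bx.
  by rewrite ger0_norm ?V_ge0//; have /andP[] := V_bounds Bx.
(* By the choice of [m] as the weighted mean, [u - m] has V-integral 0 over the ball. *)
have flux1 : flux V ut m 1 = 0.
  have iVm := integrableZl mB m iV.
  transitivity (\int[mu]_(x in B) (V x * ut (enorm x) - m * V x)).
    by apply: eq_Rintegral => x _; rewrite /source; ring.
  rewrite RintegralB// RintegralZl// mE /wmean divfK ?subrr//.
  by rewrite gt_eqF// mass_gt0.
have weak_eq eta : C1c B eta -> \int[mu]_(x in B) dotr (G x) (gradient eta x) =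
    (lam + sigma1) * \int[mu]_(x in B) (source V ut m x * eta x).
  move=> Ceta; have := weak _ _ (C1c_H10 Ceta).
  have -> : \int[mu]_(x in B) (V x * wcenter V phi x * eta x) = \int[mu]_(x in B) (source V ut m x * eta x).
    have me : measurable_fun B eta by exact: (measurable_continuous (C1_continuous (C1c_C1 Ceta))).
    have [ms _] := source_bounded mV v0_gt0 V_bounds m cut.
    apply: ae_eq_Rintegral.
    - apply: measurable_funM => //; apply: measurable_funM => //.
      by apply: measurable_funB.
    - exact: measurable_funM.
    - by apply: filterS phi_ut => x H Bx; rewrite /wcenter /source mphiE H.
  by move=> /eqP; rewrite subr_eq mulrDl addrC => /eqP.
have sol : radial_solution V ut m (lam + sigma1).
  split => //; first exact: (profile_boundary n_gt0 HG cut phi_ut).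
  by move=> r r01; exact: (profile_interior n_gt0 mV v0_gt0 V_bounds HG cut phi_ut weak_eq flux1 r01).
have out s : 1 <= s -> ut s = 0.
  by have [_ <- _ _] := sol => s1; rewrite /ut min_l// min_l.
have neg_sol : radial_solution V (fun s => - ut s) (- m) (lam + sigma1).
  have [_ u1 _ eq] := sol.
  have [ms [Cs hCs]] := source_bounded mV v0_gt0 V_bounds m cut.
  have fN r : r <= 1 -> flux V (fun s => - ut s) (- m) r = - flux V ut m r.
    move=> r1; rewrite /flux /ball_integral -[RHS]mulN1r -RintegralZl.
    - by apply: eq_Rintegral => x _; rewrite /source; ring.
    - exact: measurable_eball.
    - apply: (@bounded_integrable _ _ _ _ Cs); [exact: measurable_eball|exact: eball_sub| |].
        by apply: measurable_funS ms => //; exact: eball_sub.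
      by move=> x /(eball_sub r1); exact: hCs.
  split.
  - by move=> s; apply: cvgN; exact: cut.
  - by rewrite u1 oppr0.
  - by rewrite fN// flux1 oppr0.
  - by move=> r /[dup] r01 /andP[_ /ltW r1]; rewrite fN// [X in _ * X]mulNr mulrN; apply: is_deriveN; exact: eq.
(* If [lam + sigma1] were 0, the radial equation would give u' = 0, hence u = u(1) = 0 and a zero
   mean. *)
have la_pos : m != 0 -> 0 < lam + sigma1.
  move=> m0; rewrite lt_neqAle shifted_eigenvalue_ge0// andbT.
  apply/eqP => la0; case/eqP: m0; rewrite mE /wmean.
  have [_ u1 _ eq] := sol.
  have ut0 s : 0 <= s <= 1 -> ut s = 0.
    move=> /andP[s0 s1]; rewrite -u1; apply: (is_derive_eq0_const s1); last exact: continuous_subspaceT.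
    move=> x /andP[sx x1]; have := eq x; rewrite -la0 mul0r oppr0 mul0r; apply.
    by rewrite (le_lt_trans s0).
  transitivity (\int[mu]_(x in B) (0 : R) / \int[mu]_(x in B) V x).
    congr (_ / _); apply: eq_Rintegral => x; rewrite inE => Bx; rewrite ut0 ?mulr0//.
    by rewrite enorm_ge0/=; exact: ltW.
  by rewrite Rintegral_cst// !mul0r.
(* For [m = 0] the set of domains is empty by definition; for [m < 0] the argument runs with [- u]
   and [- m]. *)
have [m0|m0|m0] := ltgtP m 0; last first.
- apply: (@card_le2 _ _ set0 set0) => Om; rewrite /generalized_nodal_domains/= -/m m0 ltxx.
  by move=> [[]|[]].
- have la0 := la_pos (lt0r_neq0 m0).
  have [a [a01 up un]] := sign_structure n_gt0 mV v0_gt0 V_bounds m0 la0 sol out first_eigenvalue_C1c.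
  have /andP[a0 a1] := a01.
  have [||X1 [X2 H]] := @nodal_domain_le2 R n n_gt0 u a a01.
  + by move=> r /[dup] /andP[ar r1] /up; rewrite utE// (ltW r1) andbT (le_trans a0)// ltW.
  + move=> apos r /[dup] /andP[r0 ra] /(un apos); rewrite utE// r0/=; exact/ltW/(lt_trans ra).
  apply: (@card_le2 _ _ X1 X2) => Om [[_ /H]//|[]].
  by rewrite -/m ltNge (ltW m0).
- have la0 := la_pos (ltr0_neq0 m0).
  have m0' : 0 < - m by rewrite oppr_gt0.
  have [|a [a01 up un]] := sign_structure n_gt0 mV v0_gt0 V_bounds m0' la0 neg_sol _ first_eigenvalue_C1c.
    by move=> s /out ->; rewrite oppr0.
  have /andP[a0 a1] := a01.
  have [||X1 [X2 H]] := @nodal_domain_le2 R n n_gt0 (fun r => - u r) a a01.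
  + by move=> r /[dup] /andP[ar r1] /up; rewrite utE// (ltW r1) andbT (le_trans a0)// ltW.
  + move=> apos r /[dup] /andP[r0 ra] /(un apos); rewrite utE// r0/=; exact/ltW/(lt_trans ra).
  apply: (@card_le2 _ _ X1 X2) => Om [[]|[_ /H]//].
  by rewrite -/m ltNge (ltW m0).
Qed.

End eigenvalue_problem.

Theorem theorem1p6 (R : realType) (n : nat) (f : R -> R) (lam alpha : R)
    (psi : 'rV[R]_n -> R) (sigma1 : R) (phi1 : 'rV[R]_n -> R) (u : R -> R) :
  (2 <= n)%N ->
  C2_halfline f ->
  (forall t, 0 <= t -> 0 <= f t) ->
  (forall t, 0 < t -> 0 < derive1 f t) ->
  0 <= lam ->
  constrained_solution f lam alpha psi ->
  first_eigenvalue (weight f lam alpha psi) lam sigma1 ->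
  eigenfunction (weight f lam alpha psi) lam sigma1 phi1 ->
  radial_profile phi1 u ->
  (generalized_nodal_domains (weight f lam alpha psi) u #<= `I_2)%card.

Proof.
move=> n2 Cf _ fpos lam0 sol first eig prof.
have n_gt0 : (0 < n)%N by apply: leq_trans n2.
have [mV [v0 [v1 [v0_gt0 V_bounds]]]] := weight_bounds Cf fpos lam0 sol.
exact: (nodal_domains_of_radial n_gt0 mV v0_gt0 V_bounds first lam0 eig prof).
Qed.
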